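(* Let $p\geq 2$ be an integer and let $X_N=I_p(f_N)$, $N\geq 1$, with $f_N\in H^{\odot p}$ for all $N\geq 1$. Assume that $X_N$ converges in distribution, as $N\to\infty$, to $N(0,\sigma^2)$ with $\sigma^2>0$. Then, for every real random variable $Y\in L^2(\Omega)$, $$(X_N,Y)\xrightarrow[N\to\infty]{(d)}(Z,Y),$$ where $Z\sim N(0,\sigma^2)$ and $Z$, $Y$ are independent.
   Context: $H$ is a real separable Hilbert space, $H^{\odot n}$ is the symmetric $n$-th tensor power of $H$ (symmetric elements of $H^{\otimes n}$), $(W(h),h\in H)$ is an isonormal Gaussian process on a probability space $(\Omega,\mathcal A,P)$, and $I_n$ is the multiple Wiener–Itô integral of order $n$ with respect to $W$, normalized so that $\mathbf E[I_n(f)I_m(g)]=n!\langle f,g\rangle_{H^{\otimes n}}$ if $n=m$ and $0$ otherwise, for symmetric $f,g$. $\xrightarrow{(d)}$ denotes convergence in distribution. *)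

(* Defs.v *)
From HB Require Import structures.
From mathcomp Require Import all_boot all_order all_algebra perm.
From mathcomp Require Import all_classical all_reals all_analysis.
Set Implicit Arguments.
Unset Strict Implicit.
Unset Printing Implicit Defensive.
Import Order.TTheory GRing.Theory Num.Theory.
Import numFieldNormedType.Exports.
Local Open Scope classical_set_scope.
Local Open Scope ring_scope.

(* Real Hilbert spaces: complete normed modules whose norm comes from an
   inner product. *)
HB.mixin Record NormedModule_isHilbert (R : realType) (H : Type)
    of CompleteNormedModule R H := {
  inner : {dot H for @idfun R} ;
  inner_norm : forall x : H, inner x x = `|x| ^+ 2
}.

#[short(type="hilbertType")]
HB.structure Definition Hilbert (R : realType) :=
  {H of CompleteNormedModule R H & NormedModule_isHilbert R H}.

Definition separable (T : topologicalType) : Prop :=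
  exists D : set T, countable D /\ dense D.

(* Hilbert n-th tensor powers of H, given by their defining properties, which
   determine them up to a unique isometry compatible with tens; the elementary
   tensor h_0 (x) ... (x) h_(n-1) is tens h. *)
Record tensor_power (R : realType) (H : hilbertType R) (n : nat) := TensorPower {
  tp_sort :> hilbertType R ;
  tens : ('I_n -> H) -> tp_sort ;
  tens_multilinear : forall (h : 'I_n -> H) (i : 'I_n) (a : R) (x y : H),
    let upd z := fun j => if j == i then z else h j in
    tens (upd (a *: x + y)) = a *: tens (upd x) + tens (upd y) ;
  tens_inner : forall h g : 'I_n -> H,
    inner (tens h) (tens g) = \prod_(i < n) inner (h i) (g i) ;
  tens_dense : dense [set t : tp_sort |
    exists (k : nat) (c : 'I_k -> R) (h : 'I_k -> 'I_n -> H),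
      t = \sum_(j < k) c j *: tens (h j)]
}.

(* f is identified with the n-linear form h |-> <f, h_0 (x) ... (x) h_(n-1)>,
   on which permutations act by permuting the arguments. *)
Definition sym_power (R : realType) (H : hilbertType R) (n : nat)
    (T : tensor_power H n) : set T :=
  [set f | forall (s : {perm 'I_n}) (h : 'I_n -> H),
    inner f (tens T (h \o s)) = inner f (tens T h)].

Section Probability.
Context d (Omega : measurableType d) (R : realType) (P : probability Omega R).

(* Equality of laws is required on measurable sets only: on other sets the
   library's set functions are unconstrained. *)
Definition has_law (X : {RV P >-> R}) (mu : set R -> \bar R) : Prop :=
  forall A : set R, measurable A -> distribution P X A = mu A.

(* normal_prob 0 0 is not the Dirac mass at 0, hence the separate case. *)
Definition centered_gaussian (X : {RV P >-> R}) : Prop :=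
  has_law X \d_(0 : R) \/ exists2 s : R, 0 < s & has_law X (normal_prob 0 s).

Definition independent_RV (X Y : {RV P >-> R}) : Prop :=
  forall A B : set R, measurable A -> measurable B ->
    P (X @^-1` A `&` Y @^-1` B) = (P (X @^-1` A) * P (Y @^-1` B))%E.

Definition isonormal (H : hilbertType R) (W : H -> {RV P >-> R}) : Prop :=
  (forall (k : nat) (c : 'I_k -> R) (h : 'I_k -> H),
     centered_gaussian (\sum_(j < k) c j *: (W (h j) : {mfun Omega >-> R}))) /\
  (forall g h : H, 'E_P[W g \* W h] = (inner g h)%:E)%E.

End Probability.

(* Probabilists' Hermite polynomials, so that 'E[He_n(N(0,1))^2] = n!. *)
Fixpoint hermite (R : realType) (n : nat) : {poly R} :=
  if n is m.+1 then 'X * hermite R m - (hermite R m)^`() else 1.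

(* I n is the multiple Wiener-Ito integral of order n: up to null sets, the
   linear map on the symmetric elements with I n (h^(x)n) = He_n(W h) for unit
   vectors h and E[I_n(f) I_m(g)] = n! <f, g> if n = m, 0 otherwise. Its values
   off sym_power are unconstrained. mint_const is implied by mint_hermite unless
   H is trivial. *)
Record is_multiple_integral d (Omega : measurableType d) (R : realType)
    (P : probability Omega R) (H : hilbertType R) (W : H -> {RV P >-> R})
    (T : forall n, tensor_power H n) (I : forall n, T n -> {RV P >-> R}) : Prop := {
  mint_linear : forall (n : nat) (a : R) (f g : T n),
    sym_power f -> sym_power g ->
    {ae P, forall w, I n (a *: f + g) w = a * I n f w + I n g w} ;
  mint_const : forall h : 'I_0 -> H,
    {ae P, forall w, I 0%N (tens (T 0%N) h) w = 1} ;
  mint_hermite : forall (n : nat) (h : H), `|h| = 1 ->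
    {ae P, forall w, I n (tens (T n) (fun=> h)) w = (hermite R n).[W h w]} ;
  mint_isometry : forall (n : nat) (f g : T n),
    sym_power f -> sym_power g ->
    ('E_P[I n f \* I n g] = (n`!%:R * inner f g)%:E)%E ;
  mint_orthogonal : forall (n m : nat) (f : T n) (g : T m), n != m ->
    sym_power f -> sym_power g -> ('E_P[I n f \* I m g] = 0)%E
}.

(* X N, defined on (Omega, P), converges in distribution to Z, defined on a
   possibly different space (Omega', P'). *)
Definition cvg_in_distribution (R : realType) (T : topologicalType)
    d (Omega : measurableType d) (P : probability Omega R) (X : nat -> Omega -> T)
    d' (Omega' : measurableType d') (P' : probability Omega' R)
    (Z : Omega' -> T) : Prop :=
  forall phi : T -> R, continuous phi -> bounded_fun phi ->
    ('E_P[phi \o X N] @[N --> \oo] --> 'E_P'[phi \o Z])%E.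

(* Main.v *)
(** Approximating f_N by finite sums of c h^(x)p with |h| = 1 turns X_N, up to an
    L^2 error, into a finite sum of c He_p(W h), that is, into a polynomial of chaos
    degree p in finitely many independent Gaussian variables. For such an X,
    integration by parts alone gives
      E X^8 <= 7^(4 p) (E X^2)^4   and, for |h| = 1,
      6 (p - 1) (E (D_h X)^2)^2 <= p (E X^4 - 3 (E X^2)^2).
    By the first bound the moments of order 2 and 4 of X_N converge to those of the
    normal limit, so the right-hand side of the second one tends to 0 and D_h X_N
    tends to 0 in L^2 for every fixed h. Hence replacing each vector by its
    projection on the orthogonal of h changes X_N by a quantity tending to 0 in L^2:
    for every tent function phi, phi(X_N) is asymptotically uncorrelated with
    cos (W h + c). Moreover phi(X_N) minus its mean is an L^2 limit of sums of such
    cosines, so it is asymptotically uncorrelated with any square integrable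
    variable, whether or not it is measurable with respect to W. Products of tent
    functions interpolate the continuous functions of (x, y). *)

Require Import Defs.
From HB Require Import structures.
From mathcomp Require Import all_boot all_order all_algebra perm.
From mathcomp Require Import all_classical all_reals all_analysis.
From mathcomp Require Import -(notations) mpoly.
From mathcomp Require Import measurable_realfun ring lra.
Set Implicit Arguments.
Unset Strict Implicit.
Unset Printing Implicit Defensive.
Import Order.TTheory GRing.Theory Num.Theory.
Import numFieldNormedType.Exports.
Local Open Scope classical_set_scope.
Local Open Scope ring_scope.

(** * Polynomials in independent Gaussian variables *)

(** Convergence in law controls bounded test functions only, whereas the fourth-moment inequality
    needs genuine moments. The eighth moment supplies the uniform integrability: it first bounds the
    second moments, then the tails of x^4; with the exponent 8 every Hölder step is a Cauchy-Schwarz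
    inequality between polynomials. The fourth cumulant is exploited one direction h at a time: X^2
    is compared with the single second-order element He_2(W h). This suffices because a finite
    cosine sum involves finitely many vectors. After the projection nothing is asymptotic any more:
    a function of variables W x with x orthogonal to h is exactly uncorrelated with cos (W h + c),
    by the Gaussian characteristic function. A variable Y may carry randomness foreign to W. It
    enters through a bounded function, split into a fixed cosine sum and a remainder almost
    orthogonal to all cosine sums. The split does not depend on N, so the error due to the remainder
    is uniform in N. *)

Section GaussianAlgebra.
Variables (R : realType) (n : nat).
Local Notation A := (mpoly n R).
Local Notation D := (@mderiv n R).
Local Notation Xi := (fun i : 'I_n => mpolyX R (mnm1 i)).

(** The carré du champ of the Ornstein-Uhlenbeck generator [ornstein]; [ornsteinM] links the two. *)
Definition grad_prod (P Q : A) : A := \sum_(i < n) D i P * D i Q.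
Local Notation "'Γ'" := grad_prod.
Definition ornstein (P : A) : A := \sum_(i < n) (D i (D i P) - Xi i * D i P).
Local Notation L := ornstein.

(* E plays the expectation of a standard Gaussian vector, of which integration by
   parts is the only analytic property needed. *)
Variable E : A -> R.
Hypothesis E_lin : forall a P Q, E (a *: P + Q) = a * E P + E Q.
Hypothesis E_pos : forall P, (forall v, 0 <= meval v P) -> 0 <= E P.
Hypothesis E_one : E 1 = 1.
Hypothesis E_ibp : forall i P, E (Xi i * P) = E (D i P).

Lemma E_D P Q : E (P + Q) = E P + E Q.
Proof. by rewrite -[P]scale1r E_lin mul1r scale1r. Qed.
Lemma E_0 : E 0 = 0.
Proof. by apply: (addrI (E 0)); rewrite -E_D !addr0. Qed.
Lemma E_Z a P : E (a *: P) = a * E P.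
Proof. by rewrite -[a *: P]addr0 E_lin E_0 addr0. Qed.
Lemma E_N P : E (- P) = - E P.
Proof. by rewrite -scaleN1r E_Z mulN1r. Qed.
Lemma E_B P Q : E (P - Q) = E P - E Q.
Proof. by rewrite E_D E_N. Qed.
Lemma E_sum (I : Type) (r : seq I) (K : pred I) (F : I -> A) :
  E (\sum_(i <- r | K i) F i) = \sum_(i <- r | K i) E (F i).
Proof. exact: (big_morph E E_D E_0). Qed.
Lemma E_mono P Q : (forall v, meval v P <= meval v Q) -> E P <= E Q.
Proof. by move=> h; rewrite -subr_ge0 -E_B; apply: E_pos => v; rewrite mevalB subr_ge0. Qed.
Lemma E_sqr_ge0 P : 0 <= E (P * P).
Proof. by apply: E_pos => v; rewrite mevalM -expr2 sqr_ge0. Qed.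

Lemma E_CS P Q : E (P * Q) ^+ 2 <= E (P * P) * E (Q * Q).
Proof.
have h s : 0 <= s ^+ 2 * E (P * P) + 2 * s * E (P * Q) + E (Q * Q).
  have := E_sqr_ge0 (s *: P + Q).
  have -> : (s *: P + Q) * (s *: P + Q)
    = s ^+ 2 *: (P * P) + ((2 * s) *: (P * Q) + Q * Q).
    rewrite -!mul_mpolyC expr2 !rmorphM /= !rmorph_nat; ring.
  by rewrite !E_D !E_Z addrA.
have := E_sqr_ge0 P; rewrite le_eqVlt => /orP[/eqP P0|Pgt].
- rewrite -P0 mul0r; have h' s : 0 <= 2 * s * E (P * Q) + E (Q * Q).
    by have := h s; rewrite -P0 mulr0 add0r.
  set b := E (P * Q) in h' *; set c := E (Q * Q) in h' *.
  have [->|b0] := eqVneq b 0; first by rewrite expr0n.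
  (* A nonnegative affine function of s has zero slope: this s would give it the value -1. *)
  have := h' (- (c + 1) / (2 * b)).
  suff -> : 2 * (- (c + 1) / (2 * b)) * b + c = -1 by rewrite lerNr oppr0 ler10.
  by field.
- have := h (- E (P * Q) / E (P * P)).
  set a := E (P * P) in Pgt *; set b := E (P * Q); set c := E (Q * Q).
  have a0 : a != 0 by rewrite gt_eqF.
  have -> : (- b / a) ^+ 2 * a + 2 * (- b / a) * b + c = (a * c - b ^+ 2) / a.
    by field.
  by rewrite pmulr_lge0 ?invr_gt0 // subr_ge0.
Qed.

(** Integration by parts applied to P * D_i Q: the term with X_i cancels P * D_i (D_i Q). Symmetry
    of the right-hand side makes [ornstein] self-adjoint under [E]. *)
Lemma E_ornstein P Q : E (P * L Q) = - E (Γ P Q).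
Proof.
rewrite /ornstein /grad_prod mulr_sumr !E_sum -sumrN; apply: eq_bigr => i _.
rewrite mulrBr E_B mulrCA E_ibp mderivM E_D; ring.
Qed.

Lemma grad_prodC P Q : Γ P Q = Γ Q P.
Proof. by apply: eq_bigr => i _; rewrite mulrC. Qed.

Lemma grad_prodMl P Q S : Γ (P * Q) S = P * Γ Q S + Q * Γ P S.
Proof.
rewrite /grad_prod !mulr_sumr -big_split; apply: eq_bigr => i _ /=.
by rewrite mderivM; ring.
Qed.

Lemma ornsteinM P Q : L (P * Q) = P * L Q + Q * L P + 2 * Γ P Q.
Proof.
rewrite /ornstein /grad_prod !mulr_sumr -!big_split; apply: eq_bigr => i _ /=.
rewrite !(mderivM, mderivD); ring.
Qed.

Lemma ornstein_lin a P Q : L (a *: P + Q) = a *: L P + L Q.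
Proof.
rewrite /ornstein scaler_sumr -big_split; apply: eq_bigr => i _ /=.
rewrite !(mderivD, mderivZ) -!mul_mpolyC; ring.
Qed.

Lemma mderiv_Xi i j : D i (Xi j) = (i == j)%:R.
Proof.
rewrite mderivX mnm1E eq_sym; case: eqP => [->|_]; last by rewrite scale0r.
rewrite scale1r; have -> : mnm_sub (mnm1 j) (mnm1 j) = mnm0.
  by apply/mnmP => k; rewrite mnmBE mnm0E subnn.
by rewrite mpolyX0.
Qed.

(** The drift X_j contributes the extra - D_i P, so a derivative lowers the chaos order by one. *)
Lemma mderiv_ornstein i P : D i (L P) = L (D i P) - D i P.
Proof.
rewrite /ornstein (big_morph (D i) (mderivD i) (mderiv0 _ i)).
have -> : \sum_(j < n) (D j (D j (D i P)) - Xi j * D j (D i P)) - D i P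
  = \sum_(j < n) (D j (D j (D i P)) - Xi j * D j (D i P) - (i == j)%:R * D j P).
  rewrite [RHS]big_split sumrN /=; congr (_ - _).
  rewrite (bigD1 i) //= eqxx mul1r big1 ?addr0 // => j /negPf.
  by rewrite eq_sym => ->; rewrite mul0r.
apply: eq_bigr => j _.
rewrite mderivB mderivM mderiv_Xi (mderiv_comm j i (D j P)) (mderiv_comm j i P).
ring.
Qed.

(** The homogeneous chaos of order q; the clause on derivatives lets induction on q run on gradients
    and end at constants. *)
Fixpoint in_chaos (q : nat) (P : A) : Prop :=
  if q is q'.+1 then L P = - q%:R *: P /\ forall i, in_chaos q' (D i P)
  else exists c, P = mpolyC n c.

Lemma in_chaos_ornstein q P : in_chaos q P -> L P = - q%:R *: P.
Proof.
case: q => [[c ->]|q []//].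
rewrite oppr0 scale0r /ornstein big1 // => i _.
by rewrite mderivC mderiv0 mulr0 subr0.
Qed.

Lemma in_chaos_lin q a P Q :
  in_chaos q P -> in_chaos q Q -> in_chaos q (a *: P + Q).
Proof.
elim: q P Q => [|q IH] P Q /=.
  move=> [c ->] [c' ->]; exists (a * c + c').
  by rewrite -mul_mpolyC -rmorphM -rmorphD.
move=> [P1 P2] [Q1 Q2]; split.
  by rewrite ornstein_lin P1 Q1 scalerDr !scalerA mulrC.
by move=> i; rewrite mderivD mderivZ; apply: IH.
Qed.

(** Total degree, read off iterated derivatives so that induction passes to gradients. *)
Fixpoint degree_le (d : nat) (P : A) : Prop :=
  if d is d'.+1 then forall i, degree_le d' (D i P)
  else exists c, P = mpolyC n c.

Lemma degree_leC d c : degree_le d (mpolyC n c).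
Proof.
elim: d c => [|d IH] c /=; first by exists c.
by move=> i; rewrite mderivC -[0](mpolyC0 n R); apply: IH.
Qed.

Lemma degree_le_lin d a P Q :
  degree_le d P -> degree_le d Q -> degree_le d (a *: P + Q).
Proof.
elim: d P Q => [|d IH] P Q /=.
  move=> [c ->] [c' ->]; exists (a * c + c').
  by rewrite -mul_mpolyC -rmorphM -rmorphD.
by move=> dP dQ i; rewrite mderivD mderivZ; apply: IH.
Qed.

Lemma degree_leW d d' P : (d <= d')%N -> degree_le d P -> degree_le d' P.
Proof.
elim: d d' P => [|d IH] [|d'] P //=; first by move=> _ [c ->] i; rewrite mderivC; exact: (degree_leC d' 0).
by rewrite ltnS => dd' dP i; apply: IH.
Qed.

Lemma degree_leM d d' P Q :
  degree_le d P -> degree_le d' Q -> degree_le (d + d') (P * Q).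
Proof.
move: {2}(d + d')%N (erefl (d + d')%N) => m.
elim: m d d' P Q => [|m IH] d d' P Q.
  case: d d' => [|d] [|d'] //= _ [c ->] [c' ->].
  by exists (c * c'); rewrite rmorphM.
move=> dd'; rewrite dd' => dP dQ /= i.
rewrite mderivM -[D i P * Q]scale1r; apply: degree_le_lin.
- case: d dP dd' => [[c ->]|d dP] dd'.
    by rewrite mderivC mul0r -[0](mpolyC0 n R); apply: degree_leC.
  by rewrite addSn in dd'; case: dd' => dd'; rewrite -dd'; apply: IH.
- case: d' dQ dd' => [[c ->]|d' dQ] dd'.
    by rewrite mderivC mulr0 -[0](mpolyC0 n R); apply: degree_leC.
  by rewrite addnS in dd'; case: dd' => dd'; rewrite -dd'; apply: IH.
Qed.

Lemma in_chaos_degree_le q P : in_chaos q P -> degree_le q P.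
Proof. by elim: q P => [|q IH] P //= [_ dP] i; apply: IH. Qed.

(** Families over a finite type: the gradient of a family is again a family, so iterated gradients
    need no new notion. *)
Definition sqnorm (J : finType) (F : J -> A) : A := \sum_j F j * F j.
Definition grad (J : finType) (F : J -> A) (ji : J * 'I_n) : A := D ji.2 (F ji.1).

Lemma sqnorm_grad (J : finType) (F : J -> A) :
  sqnorm (grad F) = \sum_j Γ (F j) (F j).
Proof.
rewrite /sqnorm /grad /grad_prod.
by rewrite -(pair_bigA _ (fun j i => D i (F j) * D i (F j))).
Qed.

(** On degree at most d the eigenvalues of - [ornstein] are at most d. The proof avoids eigenbases:
    with m0, m1, m2 the energies of F and of its first two gradients, 0 <= E |L F + (d + 1) F|^2 =
    m1 + m2 - 2 (d + 1) m1 + (d + 1)^2 m0, and induction on the gradient gives m2 <= d m1. *)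
Lemma reverse_poincare d (J : finType) (F : J -> A) :
  (forall j, degree_le d (F j)) ->
  E (sqnorm (grad F)) <= d%:R * E (sqnorm F).
Proof.
elim: d J F => [|d IH] J F dF.
  rewrite mul0r sqnorm_grad E_sum big1 // => j _.
  have [c ->] := dF j; rewrite /grad_prod big1 ?E_0 // => i _.
  by rewrite mderivC mul0r.
set m0 := E (sqnorm F); set m1 := E (sqnorm (grad F)).
set m2 := E (sqnorm (grad (grad F))).
have m2le : m2 <= d%:R * m1 by apply: IH => -[j i]; exact: dF.
have m1E : m1 = - \sum_j E (F j * L (F j)).
  by rewrite /m1 sqnorm_grad E_sum -sumrN; apply: eq_bigr => j _; rewrite E_ornstein opprK.
(* Integrated Bochner formula: the commutation [mderiv_ornstein] contributes the term m1. *)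
have LL : \sum_j E (L (F j) * L (F j)) = m1 + m2.
  rewrite /m1 /m2 !sqnorm_grad !E_sum -(pair_bigA _ (fun j i => E (Γ (grad F (j, i)) (grad F (j, i))))) /=.
  rewrite -big_split; apply: eq_bigr => j _ /=.
  rewrite E_ornstein grad_prodC /grad_prod !E_sum -sumrN -big_split /=.
  apply: eq_bigr => i _.
  rewrite mderiv_ornstein mulrBr E_B E_ornstein /grad /grad_prod /=.
  by rewrite opprB opprK.
have : 0 <= \sum_j E ((L (F j) + d.+1%:R *: F j) * (L (F j) + d.+1%:R *: F j)).
  by apply: sumr_ge0 => j _; apply: E_sqr_ge0.
have -> : \sum_j E ((L (F j) + d.+1%:R *: F j) * (L (F j) + d.+1%:R *: F j))
  = m1 + m2 - 2 * d.+1%:R * m1 + d.+1%:R ^+ 2 * m0.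
  rewrite -LL m1E mulrN opprK mulr_sumr /m0 /sqnorm E_sum mulr_sumr -!big_split /=.
  apply: eq_bigr => j _; rewrite -!E_Z -!E_D; congr E.
  rewrite -!mul_mpolyC !rmorphM /= !rmorph_nat; ring.
move=> h.
have d0 : 0 < d.+1%:R :> R by rewrite ltr0n.
rewrite -(ler_pM2l d0); rewrite -[d.+1%:R]natr1 in h *; lra.
Qed.

Lemma E_chaos_grad q (J : finType) (F : J -> A) :
  (forall j, in_chaos q (F j)) -> E (sqnorm (grad F)) = q%:R * E (sqnorm F).
Proof.
move=> cF; rewrite sqnorm_grad /sqnorm !E_sum mulr_sumr; apply: eq_bigr => j _.
apply: oppr_inj; rewrite -E_ornstein (in_chaos_ornstein (cF j)).
by rewrite -scalerAr E_Z mulNr.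
Qed.

Lemma meval_sqnorm_ge0 (J : finType) (F : J -> A) v : 0 <= meval v (sqnorm F).
Proof.
rewrite /sqnorm raddf_sum /=; apply: sumr_ge0 => j _.
by rewrite mevalM -expr2 sqr_ge0.
Qed.

(** Lagrange's identity: twice the gap is the sum of the squares (a_j b_k - a_k b_j)^2. *)
Lemma sum_CS (J : finType) (a b : J -> R) :
  (\sum_j a j * b j) ^+ 2 <= (\sum_j a j * a j) * (\sum_j b j * b j).
Proof.
have : 0 <= \sum_j \sum_k (a j * b k - a k * b j) ^+ 2.
  by do 2!apply: sumr_ge0 => ? _; exact: sqr_ge0.
have -> : \sum_j \sum_k (a j * b k - a k * b j) ^+ 2 =
  (\sum_j a j * a j) * (\sum_j b j * b j) * 2 - (\sum_j a j * b j) ^+ 2 * 2.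
  rewrite expr2 !big_distrlr /= !mulr_suml.
  under [X in _ = _ - X]eq_bigr do rewrite mulr_suml.
  under [X in _ = X - _]eq_bigr do rewrite mulr_suml.
  have -> : \sum_i \sum_j0 (a i * a i * (b j0 * b j0)) * 2 =
   \sum_i \sum_j0 (a i * a i * (b j0 * b j0)) + \sum_i \sum_j0 (a j0 * a j0 * (b i * b i)).
    rewrite [X in _ = _ + X]exchange_big -big_split; apply: eq_bigr => i _ /=.
    by rewrite -big_split; apply: eq_bigr => j _ /=; ring.
  rewrite -sumrN -!big_split; apply: eq_bigr => i _ /=.
  rewrite -sumrN -!big_split; apply: eq_bigr => j _ /=; ring.
by rewrite -mulrBl pmulr_lge0 ?ltr0n // subr_ge0.
Qed.

(* Testing L F = - q F against |F|^6 F costs 3 derivatives of |F|^2 on top of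
   the one on F, hence the constant 7 = 1 + 3 * 2. *)
Lemma chaos_norm8_step q (J : finType) (F : J -> A) :
  (forall j, in_chaos q.+1 (F j)) ->
  q.+1%:R * E (sqnorm F ^+ 4) <= 7 * E (sqnorm F ^+ 3 * sqnorm (grad F)).
Proof.
move=> cF; set N := sqnorm F; set M := sqnorm (grad F).
have NN : \sum_j F j * Γ N (F j) = \sum_(i < n) 2 * (\sum_j F j * D i (F j)) ^+ 2.
  have DN i : D i N = 2 * (\sum_j F j * D i (F j)).
    rewrite /N /sqnorm (big_morph (D i) (mderivD i) (mderiv0 _ i)) mulr_sumr.
    by apply: eq_bigr => j _; rewrite mderivM; ring.
  rewrite /grad_prod; under eq_bigr do rewrite mulr_sumr.
  rewrite exchange_big; apply: eq_bigr => i _ /=.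
  under eq_bigr do rewrite DN mulrCA.
  by rewrite -mulr_sumr expr2 mulrA.
have step : q.+1%:R * E (N ^+ 4) = E (N ^+ 3 * M) + E (3 * N ^+ 2 * \sum_j F j * Γ N (F j)).
  have -> : N ^+ 4 = \sum_j (N ^+ 3 * F j) * F j.
    by under eq_bigr do rewrite -mulrA; rewrite -mulr_sumr -exprSr.
  have -> : q.+1%:R * E (\sum_j (N ^+ 3 * F j) * F j) =
    \sum_j E (Γ (N ^+ 3 * F j) (F j)).
    rewrite E_sum mulr_sumr; apply: eq_bigr => j _.
    apply: oppr_inj; rewrite -E_ornstein (in_chaos_ornstein (cF j)).
    by rewrite -scalerAr E_Z mulNr.
  rewrite /M sqnorm_grad !mulr_sumr !E_sum -big_split; apply: eq_bigr => j _ /=.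
  rewrite -E_D; congr E; rewrite grad_prodMl !exprSr expr0 mul1r !grad_prodMl; ring.
(* As D_i N = 2 sum_j F_j D_i F_j, Cauchy-Schwarz over j bounds the sum in [NN] pointwise by 2 N M;
   the prefactor 3 N^2 makes this 6 N^3 M. *)
have key : E (3 * N ^+ 2 * \sum_j F j * Γ N (F j)) <= 6 * E (N ^+ 3 * M).
  rewrite -E_Z; apply: E_mono => v.
  have mX (P : A) k : meval v (P ^+ k) = meval v P ^+ k by rewrite rmorphXn.
  have mn k : meval v k%:R = k%:R by rewrite rmorph_nat.
  rewrite NN mevalZ [meval v (3 * _ * _)]mevalM [meval v (3 * _)]mevalM.
  rewrite [meval v (N ^+ 3 * _)]mevalM !mX mn.
  set x := meval v N.
  have x0 : 0 <= x by exact: meval_sqnorm_ge0.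
  have : meval v (\sum_(i < n) 2 * (\sum_j F j * D i (F j)) ^+ 2) <= 2 * (x * meval v M).
    rewrite raddf_sum /= /M sqnorm_grad /grad_prod exchange_big raddf_sum /= !mulr_sumr.
    apply: ler_sum => i _; rewrite [meval v (2 * _)]mevalM mX mn ler_pM2l ?ltr0n //.
    rewrite !raddf_sum /=.
    under eq_bigr do rewrite mevalM.
    apply: le_trans (sum_CS _ _) _; apply: ler_pM.
    - by apply: sumr_ge0 => j _; rewrite -expr2 sqr_ge0.
    - by apply: sumr_ge0 => j _; rewrite -expr2 sqr_ge0.
    - by rewrite /x /N /sqnorm raddf_sum /=; apply: ler_sum => j _; rewrite mevalM.
    - by apply: ler_sum => j _; rewrite mevalM.
  move=> h; have := ler_wpM2l (_ : 0 <= 3 * x ^+ 2) h.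
  rewrite mulr_ge0 ?sqr_ge0 // => /(_ isT) {}h.
  apply: le_trans h _; rewrite le_eqVlt; apply/orP; left; apply/eqP; ring.
by rewrite step; lra.
Qed.

Lemma E_const c : E (mpolyC n c) = c.
Proof. by rewrite -[mpolyC n c]mulr1 mul_mpolyC E_Z E_one mulr1. Qed.

(** Vector-valued so that induction can pass to the gradient. With k the order, y = E N^4, t =
    E[N^3 M] and z = E M^4, the previous lemma gives k y <= 7 t, two Cauchy-Schwarz inequalities
    give t^4 <= y^3 z, and induction bounds z with E M = k E N. The powers of k cancel, and each
    order costs 7^4. *)
Lemma chaos_norm8 q (J : finType) (F : J -> A) :
  (forall j, in_chaos q (F j)) ->
  E (sqnorm F ^+ 4) <= 7 ^+ (4 * q) * E (sqnorm F) ^+ 4.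
Proof.
elim: q J F => [|q IH] J F cF.
  suff [c ->] : exists c, sqnorm F = mpolyC n c.
    by rewrite -rmorphXn /= !E_const mul1r.
  exists (\sum_j mcoeff mnm0 (F j) * mcoeff mnm0 (F j)).
  rewrite /sqnorm rmorph_sum; apply: eq_bigr => j _.
  by have [c ->] := cF j; rewrite mcoeffC eqxx mulr1 rmorphM.
have step := chaos_norm8_step cF.
have := IH _ (grad F) (fun ji => (cF ji.1).2 ji.2).
rewrite (E_chaos_grad cF).
set N := sqnorm F in step *; set M := sqnorm (grad F) in step *.
have N2 : N ^+ 2 * N ^+ 2 = N ^+ 4 by rewrite -exprD.
have cs1 : E (N ^+ 3 * M) ^+ 2 <= E (N ^+ 4) * E (N ^+ 2 * M ^+ 2).
  have := E_CS (N ^+ 2) (N * M); rewrite N2.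
  have -> : N ^+ 2 * (N * M) = N ^+ 3 * M by ring.
  by have -> : N * M * (N * M) = N ^+ 2 * M ^+ 2 by ring.
have cs2 : E (N ^+ 2 * M ^+ 2) ^+ 2 <= E (N ^+ 4) * E (M ^+ 4).
  by have := E_CS (N ^+ 2) (M ^+ 2); rewrite -!exprD.
have y0 : 0 <= E (N ^+ 4) by rewrite -N2 E_sqr_ge0.
have t0 : 0 <= E (N ^+ 3 * M).
  apply: E_pos => v; rewrite mevalM.
  have -> : meval v (N ^+ 3) = meval v N ^+ 3 by rewrite rmorphXn.
  by rewrite mulr_ge0 ?exprn_ge0 ?meval_sqnorm_ge0.
move: step cs1 cs2 y0 t0.
set y := E (N ^+ 4); set t := E (N ^+ 3 * M); set u := E (N ^+ 2 * M ^+ 2).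
set z := E (M ^+ 4); set e := E N; set k : R := q.+1%:R.
move=> step cs1 cs2 y0 t0 zle.
have k0 : 0 < k by rewrite ltr0n.
have K0 : 0 < k ^+ 4 by rewrite exprn_gt0.
have -> : 7 ^+ (4 * q.+1) = 7 ^+ 4 * 7 ^+ (4 * q) :> R by rewrite mulnS exprD.
(* The factor y^3 is divided out below, so y = 0 is set apart. *)
move: y0; rewrite le_eqVlt => /orP[/eqP <-|y0].
  have e4 : 0 <= e ^+ 4 by rewrite (exprM e 2 2) sqr_ge0.
  by rewrite mulr_ge0 // mulr_ge0 ?exprn_ge0.
have h1 : (k * y) ^+ 4 <= (7 * t) ^+ 4.
  by rewrite ler_pXn2r ?nnegrE ?mulr_ge0 // ltW.
have h2 : t ^+ 4 <= y ^+ 3 * z.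
  have -> : t ^+ 4 = (t ^+ 2) ^+ 2 by rewrite -exprM.
  apply: (@le_trans _ _ ((y * u) ^+ 2)).
    by rewrite ler_pXn2r ?nnegrE ?sqr_ge0 //; apply: le_trans cs1; rewrite sqr_ge0.
  have -> : y ^+ 3 * z = y ^+ 2 * (y * z) by ring.
  by rewrite exprMn ler_pM2l // exprn_gt0.
have h3 : y ^+ 3 * (k ^+ 4 * y) <= y ^+ 3 * (7 ^+ 4 * z).
  have -> : y ^+ 3 * (k ^+ 4 * y) = (k * y) ^+ 4 by ring.
  apply: le_trans h1 _.
  have -> : y ^+ 3 * (7 ^+ 4 * z) = 7 ^+ 4 * (y ^+ 3 * z) by ring.
  by rewrite exprMn ler_pM2l // exprn_gt0.
rewrite ler_pM2l ?exprn_gt0 // in h3.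
rewrite -(ler_pM2l K0); apply: le_trans h3 _.
have -> : k ^+ 4 * (7 ^+ 4 * 7 ^+ (4 * q) * e ^+ 4)
  = 7 ^+ 4 * (7 ^+ (4 * q) * (k * e) ^+ 4) by rewrite exprMn; ring.
by rewrite ler_pM2l // exprn_gt0.
Qed.

Lemma chaos_moment8 q X : in_chaos q X ->
  E (X ^+ 8) <= 7 ^+ (4 * q) * E (X ^+ 2) ^+ 4.
Proof.
move=> cX; have := @chaos_norm8 q unit (fun=> X) (fun=> cX).
by rewrite /sqnorm big_const card_unit /= addr0 -expr2 -exprM.
Qed.

Lemma chaos_orthogonal q r X Y : in_chaos q X -> in_chaos r Y -> q != r ->
  E (X * Y) = 0.
Proof.
move=> /in_chaos_ornstein cX /in_chaos_ornstein cY qr.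
have /eqP : - r%:R * E (X * Y) = - q%:R * E (X * Y).
  by rewrite -[LHS]E_Z scalerAr -cY E_ornstein grad_prodC -E_ornstein cX -scalerAr E_Z [Y * X]mulrC.
by rewrite -subr_eq0 -mulrBl mulf_eq0 opprK addrC subr_eq0 eqr_nat (negPf qr) => /eqP.
Qed.

(** * Linear forms, Hermite polynomials and the fourth-moment inequality *)

Section LinearForm.
Variable t : 'I_n -> R.
Hypothesis t_unit : \sum_i t i * t i = 1.

(** For a unit vector h with coordinates t, [linear_form] stands for W h and [dirD] for the
    derivative D_h. *)
Definition linear_form : A := \sum_i t i *: Xi i.
Local Notation ell := linear_form.
Definition dirD (P : A) : A := \sum_i t i *: D i P.
Definition at_form (p : {poly R}) : A := (map_poly (@mpolyC n R) p).[ell].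

Lemma mderiv_linear_form i : D i ell = mpolyC n (t i).
Proof.
rewrite /linear_form (big_morph (D i) (mderivD i) (mderiv0 _ i)) (bigD1 i) //=.
rewrite mderivZ mderiv_Xi eqxx -mul_mpolyC mulr1 big1 ?addr0 // => j /negPf.
by rewrite eq_sym mderivZ mderiv_Xi => ->; rewrite scaler0.
Qed.

Lemma at_formD p q : at_form (p + q) = at_form p + at_form q.
Proof. by rewrite /at_form rmorphD hornerD. Qed.
Lemma at_formM p q : at_form (p * q) = at_form p * at_form q.
Proof. by rewrite /at_form rmorphM hornerM. Qed.
Lemma at_formZ a p : at_form (a *: p) = a *: at_form p.
Proof. by rewrite /at_form map_polyZ hornerZ mul_mpolyC. Qed.
Lemma at_formC c : at_form c%:P = mpolyC n c.
Proof. by rewrite /at_form map_polyC hornerC. Qed.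
Lemma at_formX : at_form 'X = ell.
Proof. by rewrite /at_form map_polyX hornerX. Qed.

Lemma mderiv_at_form i p : D i (at_form p) = t i *: at_form p^`().
Proof.
elim/poly_ind: p => [|p c IH].
  by rewrite deriv0 -(polyC0 R) at_formC mpolyC0 mderiv0 scaler0.
rewrite derivD derivM derivX derivC addr0 mulr1 !at_formD !at_formM at_formC at_formX.
rewrite mderivD mderivC addr0 mderivM IH mderiv_linear_form -!mul_mpolyC; ring.
Qed.

(** Chain rule; since t has unit length the second-order term is exactly p'', which leaves the
    one-dimensional operator of [hermite_ode]. *)
Lemma ornstein_at_form p : L (at_form p) = at_form (p^`()^`() - 'X * p^`()).
Proof.
rewrite at_formD -scaleN1r at_formZ at_formM at_formX /ornstein big_split sumrN /=.
rewrite scaleN1r; congr (_ - _).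
  under eq_bigr do rewrite !(mderiv_at_form, mderivZ) scalerA.
  by rewrite -scaler_suml t_unit scale1r.
rewrite mulr_suml; apply: eq_bigr => i _.
by rewrite mderiv_at_form -!mul_mpolyC; ring.
Qed.

Lemma meval_at_form v p : meval v (at_form p) = p.[\sum_i t i * v i].
Proof.
rewrite /at_form -horner_map -map_poly_comp; congr _.[_].
  by rewrite map_poly_id // => x _ /=; rewrite mevalC.
rewrite /linear_form raddf_sum; apply: eq_bigr => i _ /=.
by rewrite mevalZ mevalXU.
Qed.

Lemma hermiteS q : hermite R q.+1 = 'X * hermite R q - (hermite R q)^`().
Proof. by []. Qed.

Lemma deriv_hermite q : (hermite R q.+1)^`() = q.+1%:R *: hermite R q.
Proof.
elim: q => [|q IH].
  by rewrite /= derivB derivM derivX derivC !mulr1 !mulr0 deriv0 addr0 subr0 scale1r.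
rewrite hermiteS IH derivB derivM derivX mul1r derivZ IH.
rewrite -addrA -scalerAr -scalerBr -hermiteS.
by rewrite -[q.+2%:R]natr1 scalerDl scale1r addrC.
Qed.

Lemma hermite_ode q :
  (hermite R q)^`()^`() - 'X * (hermite R q)^`() = - q%:R *: hermite R q.
Proof.
case: q => [|q]; first by rewrite /= derivC deriv0 mulr0 subr0 oppr0 scale0r.
rewrite deriv_hermite derivZ -scalerAr -scalerBr -opprB -hermiteS.
by rewrite scalerN scaleNr.
Qed.

Lemma hermite_in_chaos q : in_chaos q (at_form (hermite R q)).
Proof.
elim: q => [|q IH].
  by exists 1; rewrite /= -(polyC1 R) at_formC.
split; first by rewrite ornstein_at_form hermite_ode at_formZ.
move=> i; rewrite mderiv_at_form deriv_hermite at_formZ scalerA -[X in in_chaos q X]addr0.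
apply: in_chaos_lin => //; have := in_chaos_lin (-1) IH IH.
by rewrite scaleN1r addNr.
Qed.

Lemma dirD_lin a P Q : dirD (a *: P + Q) = a *: dirD P + dirD Q.
Proof.
rewrite /dirD scaler_sumr -big_split; apply: eq_bigr => i _ /=.
by rewrite mderivD mderivZ -!mul_mpolyC; ring.
Qed.

Lemma dirDM P Q : dirD (P * Q) = dirD P * Q + P * dirD Q.
Proof.
rewrite /dirD mulr_suml mulr_sumr -big_split; apply: eq_bigr => i _ /=.
by rewrite mderivM -!mul_mpolyC; ring.
Qed.

Lemma in_chaos0 q : in_chaos q 0.
Proof.
elim: q => [|q IH]; first by exists 0; rewrite mpolyC0.
split; last by move=> i; rewrite mderiv0.
by rewrite scaler0 /ornstein big1 // => i _; rewrite !mderiv0 mulr0 subr0.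
Qed.

Lemma in_chaos_dirD q P : in_chaos q.+1 P -> in_chaos q (dirD P).
Proof.
move=> [_ cP]; rewrite /dirD.
apply: (big_rec (in_chaos q)) => [|i Q _ cQ]; first exact: in_chaos0.
by apply: in_chaos_lin => //; exact: cP.
Qed.

Lemma E_form P : E (ell * P) = E (dirD P).
Proof.
rewrite /linear_form /dirD mulr_suml !E_sum; apply: eq_bigr => i _.
by rewrite -scalerAl !E_Z E_ibp.
Qed.

(* With Z = X^2 and u = He_2 (ell), the left-hand side is 2 a^2 where 2 a = E[Z u];
   Z - E Z - a u has degree 2 p, so the reverse Poincare inequality bounds its
   Dirichlet energy, which is (4 p / 3) E[X^4] - 4 a^2. *)
Lemma fourth_moment_bound p X : in_chaos p.+2 X ->
  6 * p.+1%:R * E (dirD X * dirD X) ^+ 2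
    <= p.+2%:R * (E (X ^+ 4) - 3 * E (X ^+ 2) ^+ 2).
Proof.
move=> cX; have LX := in_chaos_ornstein cX.
set a := E (dirD X * dirD X).
set Z := X * X; set m := E Z; set u := at_form (hermite R 2).
have cu : in_chaos 2 u by exact: hermite_in_chaos.
have Lu := in_chaos_ornstein cu.
have Du : dirD ell = 1.
  rewrite /dirD; under eq_bigr do rewrite mderiv_linear_form -mul_mpolyC -mpolyCM.
  by rewrite -raddf_sum t_unit.
have uE : u = ell * ell - 1.
  rewrite /u hermiteS deriv_hermite scale1r [hermite R 1]hermiteS /= derivC subr0 mulr1.
  rewrite at_formD at_formM at_formX; congr (_ + _).
  by rewrite -scaleN1r at_formZ -(polyC1 R) at_formC scaleN1r.
have E_u : E u = 0 by rewrite uE E_B E_form Du subrr.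
have Dlin0 P Q : dirD (P + Q) = dirD P + dirD Q.
  by rewrite -[P in LHS]scale1r dirD_lin scale1r.
have Zu : E (Z * u) = 2 * a.
  rewrite uE mulrBr mulr1 E_B mulrC -mulrA E_form dirDM Du mul1r E_D E_form.
  rewrite /Z !dirDM Dlin0 !dirDM !E_D.
  (* X and its second derivative lie in chaoses of different orders, p + 2 and p. *)
  have X0 : E (X * dirD (dirD X)) = 0.
    apply: (@chaos_orthogonal p.+2 p) => //; first by do 2!apply: in_chaos_dirD.
    by rewrite gtn_eqF.
  by rewrite [dirD (dirD X) * X]mulrC X0 -/a; ring.
have uu : E (u * u) = 2.
  rewrite {1}uE mulrBl mul1r E_B E_u subr0 -mulrA E_form dirDM Du mul1r E_D E_u add0r E_form.
  have DU : dirD u = 2 * ell.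
    rewrite uE -[X in _ - X]mul1r -scaleN1r -mul_mpolyC Dlin0 !dirDM Du.
    have D1 : dirD 1 = 0 by rewrite /dirD big1 // => i _; rewrite -(mpolyC1 n R) mderivC scaler0.
    have DN1 : dirD (mpolyC n (-1)) = 0 by rewrite /dirD big1 // => i _; rewrite mderivC scaler0.
    by rewrite D1 DN1; ring.
  have -> : dirD (dirD u) = 2%:R *: 1.
    have -> : dirD u = 2%:R *: ell + 0 by rewrite DU addr0 -mul_mpolyC rmorph_nat.
    have D0 : dirD 0 = 0 by rewrite /dirD big1 // => i _; rewrite mderiv0 scaler0.
    by rewrite dirD_lin Du D0 addr0.
  by rewrite E_Z E_one mulr1.
have LZ : Γ X X = 2^-1 *: L Z + p.+2%:R *: Z.
  rewrite /Z ornsteinM LX -!mul_mpolyC.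
  have h2 : mpolyC n (2^-1) * 2 = 1 :> A.
    by rewrite -[2 in X in _ * X](rmorph_nat (@mpolyC n R)) -rmorphM /= mulVf ?pnatr_eq0.
  rewrite rmorphN /=; move: h2; set w := mpolyC n _; set c := mpolyC n _ => h2.
  have -> : w * (X * (- c * X) + X * (- c * X) + 2 * Γ X X) + c * (X * X)
    = w * 2 * Γ X X + (1 - w * 2) * c * X * X by ring.
  by rewrite h2 subrr !mul0r addr0 mul1r.
set z2 := E (Z * Z).
have X4 : E (X ^+ 4) = z2 by congr E; rewrite /Z; ring.
(* Testing L X = - q X, q = p + 2, against X^3 gives q z2 = 3 E[Z Γ(X, X)]; by [LZ] the right-hand
   side is 3 q z2 - (3 / 2) E[Γ(Z, Z)]. *)
have ZLZ : E (Γ Z Z) = 4 / 3 * p.+2%:R * z2.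
  have e1 : p.+2%:R * z2 = 3 * E (Z * Γ X X).
    have -> : p.+2%:R * z2 = - E (X * X * X * L X).
      by rewrite LX -scalerAr E_Z mulNr opprK; congr (_ * E _); rewrite /Z; ring.
    rewrite E_ornstein opprK -[3](_ : 1 + 1 + 1 = _); last by ring.
    rewrite !mulrDl !mul1r -!E_D; congr E; rewrite !grad_prodMl /Z; ring.
  move: e1; rewrite LZ mulrDr E_D -!scalerAr !E_Z E_ornstein -/z2 => e1.
  by lra.
have dY : degree_le (p.+2 + p.+2) (Z - mpolyC n m - a *: u).
  rewrite -scaleNr addrC; apply: degree_le_lin.
    by apply: (@degree_leW 2); [rewrite addSn ltnS addnS|exact: in_chaos_degree_le].
  rewrite addrC -[Z]scale1r addrC; apply: degree_le_lin.
    by apply: degree_leM; exact: in_chaos_degree_le.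
  rewrite -rmorphN; exact: degree_leC.
have := @reverse_poincare _ unit (fun=> Z - mpolyC n m - a *: u) (fun=> dY).
rewrite sqnorm_grad /sqnorm !big_const card_unit /= !addr0.
set Y := Z - _ - _.
have YE : Y = (- a) *: u + (-1 *: mpolyC n m + Z).
  by rewrite /Y scaleN1r scaleNr addrC [_ + Z]addrC.
have YY : E (Y * Y) = z2 - m ^+ 2 - 2 * a ^+ 2.
  have -> : Y * Y = Z * Z - (2 * m) *: Z + (m * m) *: 1 - (2 * a) *: (Z * u)
     + (2 * m * a) *: u + (a * a) *: (u * u).
    rewrite /Y -!mul_mpolyC !rmorphM /= rmorph_nat; ring.
  by rewrite !(E_B, E_D, E_Z) E_one E_u Zu uu -/m -/z2; ring.
have YLY : E (Γ Y Y) = E (Γ Z Z) - 4 * a ^+ 2.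
  apply: oppr_inj; rewrite -E_ornstein opprB.
  have LYE : L Y = L Z + (2 * a) *: u.
    rewrite YE !ornstein_lin Lu scalerA mulrNN [a * 2]mulrC addrC; congr (_ + _).
    suff -> : L (mpolyC n m) = 0 by rewrite scaler0 add0r.
    by rewrite (@in_chaos_ornstein 0) ?oppr0 ?scale0r //; exists m.
  rewrite LYE.
  have -> : Y * (L Z + (2 * a) *: u) = Z * L Z - m *: L Z - a *: (u * L Z)
    + (2 * a) *: (Z * u) - (2 * a * m) *: u - (2 * a * a) *: (u * u).
    rewrite /Y -!mul_mpolyC !rmorphM /= rmorph_nat; ring.
  have L1 : E (L Z) = 0.
    rewrite -[L Z]mul1r E_ornstein grad_prodC -E_ornstein.
    by rewrite (@in_chaos_ornstein 0 1) ?oppr0 ?scale0r ?mulr0 ?E_0 //; exists 1.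
  have uLZ : E (u * L Z) = - 4 * a.
    rewrite E_ornstein grad_prodC -E_ornstein Lu -scalerAr E_Z Zu; ring.
  by rewrite !(E_B, E_D, E_Z) E_ornstein L1 uLZ Zu E_u uu; ring.
(* With q = p + 2 the inequality reads (4 / 3) q z2 - 4 a^2 <= 2 q (z2 - m^2 - 2 a^2), which
   rearranges to 6 (q - 1) a^2 <= q (z2 - 3 m^2). *)
rewrite YLY YY ZLZ X4 natrD -[p.+2%:R]natr1; move=> h; lra.
Qed.

End LinearForm.
End GaussianAlgebra.

(** * The one-dimensional normal law *)

Section NormalIntegral.
Context {R : realType}.
Notation mu := (@lebesgue_measure R).

(** The Radon-Nikodym derivative of [normal_prob] agrees almost everywhere with [normal_pdf], both
    having the same integral over every measurable set. *)
Lemma ge0_integral_normal (m s : R) (f : R -> \bar R) :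
  measurable_fun setT f -> (forall x, 0 <= f x)%E ->
  (\int[normal_prob m s]_x f x = \int[mu]_x (f x * (normal_pdf m s x)%:E))%E.
Proof.
move=> mf f0.
pose nu : {finite_measure set _ -> \bar R} := normal_prob m s.
have dom := normal_prob_dominates m s.
rewrite -(@Radon_Nikodym_SigmaFinite.change_of_variables _ _ _ nu mu dom)//.
have iRN := @Radon_Nikodym_SigmaFinite.f_integrable _ _ _ nu mu dom.
have mpdf : measurable_fun setT (fun x => (normal_pdf m s x)%:E).
  by apply/measurable_EFinP; exact: measurable_normal_pdf.
apply: ae_eq_integral => //.
- by apply: emeasurable_funM => //; exact: measurable_int iRN.
- exact: emeasurable_funM.
- have : ae_eq mu setT (Radon_Nikodym_SigmaFinite.f nu mu)
      (fun x => (normal_pdf m s x)%:E).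
    apply: integral_ae_eq => // E _ mE.
    by rewrite -Radon_Nikodym_SigmaFinite.f_integral.
  by apply: filterS => x + xT => /(_ xT) ->.
Qed.

Lemma integrable_normal (m s : R) (f : R -> R) : measurable_fun setT f ->
  (normal_prob m s).-integrable setT (EFin \o f) <->
  mu.-integrable setT (fun x => (f x * normal_pdf m s x)%:E).
Proof.
move=> mf.
have e : (\int[normal_prob m s]_x `|(EFin \o f) x| =
   \int[mu]_x `|(f x * normal_pdf m s x)%:E|)%E.
  rewrite ge0_integral_normal//; last exact/measurable_EFinP/measurableT_comp.
  by apply: eq_integral => x _ /=; rewrite normrM (ger0_norm (normal_pdf_ge0 _ _ _)).
split=> /integrableP[_ fi]; apply/integrableP; split.
- apply/measurable_EFinP/measurable_funM => //; exact: measurable_normal_pdf.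
- by rewrite -e.
- exact/measurable_EFinP.
- by rewrite e.
Qed.

Lemma integral_normal (m s : R) (f : R -> R) :
  (normal_prob m s).-integrable setT (EFin \o f) ->
  (\int[normal_prob m s]_x (f x)%:E = \int[mu]_x (f x * normal_pdf m s x)%:E)%E.
Proof.
move=> fi; have mf : measurable_fun setT f by apply/measurable_EFinP; exact: measurable_int fi.
have fi' := (integrable_normal _ _ mf).1 fi.
rewrite integralE [RHS]integralE; congr (_ - _)%E.
- rewrite ge0_integral_normal//; last exact/measurable_funepos/measurable_EFinP.
  apply: eq_integral => x _; rewrite !funeposE /= -EFin_max -EFinM -EFin_max; congr EFin.
  by rewrite maxr_pMl ?normal_pdf_ge0// mul0r.
- rewrite ge0_integral_normal//; last exact/measurable_funeneg/measurable_EFinP.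
  apply: eq_integral => x _; rewrite !funenegE /= -EFin_max -EFinM -EFin_max; congr EFin.
  by rewrite maxr_pMl ?normal_pdf_ge0// mul0r mulNr.
Qed.

(* Completing the square: e^(t x) N(0, s) is e^(t^2 s^2 / 2) N(t s^2, s). *)
Lemma integrable_expR_normal (s t : R) : s != 0 ->
  (normal_prob 0 s).-integrable setT (fun x => (expR (t * x))%:E).
Proof.
move=> s0; apply/integrable_normal.
  by apply: measurableT_comp => //; exact: mulrl_measurable.
apply: (@eq_integrable _ _ _ mu setT measurableT
  (fun x => (expR (t ^+ 2 * s ^+ 2 / 2))%:E * (normal_pdf (t * s ^+ 2) s x)%:E)%E).
  move=> x _; rewrite -EFinM !normal_pdfE//; congr EFin.
  rewrite mulrCA [RHS]mulrCA /normal_fun -!expRD; congr (_ * expR _).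
  by field.
by apply: integrableZl => //; exact: integrable_normal_pdf.
Qed.

(** One criterion for polynomials, sines and cosines alike: exp (k |x|) is always one of exp (k x)
    and exp (- k x). *)
Lemma integrable_normal_exp_growth (s C k : R) (f : R -> R) : s != 0 ->
  measurable_fun setT f -> (forall x, `|f x| <= C * expR (k * `|x|)) ->
  (normal_prob 0 s).-integrable setT (EFin \o f).
Proof.
move=> s0 mf fC.
apply: (@le_integrable _ _ _ (normal_prob 0 s) _ measurableT _
   (fun x => C%:E * ((expR (k * x))%:E + (expR (- k * x))%:E))%E).
- exact/measurable_EFinP.
- move=> x _; rewrite -EFinD -EFinM /= lee_fin.
  have C0 : 0 <= C.
    by have := le_trans (normr_ge0 _) (fC 0); rewrite normr0 mulr0 expR0 mulr1.
  apply: le_trans (fC x) _; rewrite [leRHS]ger0_norm; last first.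
    by rewrite mulr_ge0// addr_ge0 ?expR_ge0.
  rewrite ler_wpM2l//.
  have [x0|x0] := leP 0 x; first by rewrite ger0_norm// lerDl expR_ge0.
  by rewrite ltr0_norm// mulrN mulNr lerDr expR_ge0.
- by apply: integrableZl => //; apply: integrableD => //; exact: integrable_expR_normal.
Qed.

Let scalerE (a b : R) : a *: (b : R^o) = a * b. Proof. by []. Qed.

Lemma is_derive_normal_pdf (s x : R) : s != 0 ->
  is_derive x 1 (normal_pdf 0 s) (- x / s ^+ 2 * normal_pdf 0 s x).
Proof.
move=> s0; rewrite normal_pdfE//; set c := - (s ^+ 2 *+ 2)^-1.
have -> : (fun x => normal_peak s * normal_fun 0 s x) =
    (fun y => normal_peak s * (expR \o (fun x => c * (x * x))) y).
  apply/funext => y; rewrite /normal_fun subr0 /=; congr (_ * expR _).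
  by rewrite /c; field.
have d1 : is_derive x 1 (fun x : R => c * (x * x)) (c * (x + x)).
  have h : is_derive x 1 (fun x : R => c * (x * x)) _ := is_deriveM (is_derive_cst c x 1)
    (is_deriveM (is_derive_id x (1 : R)) (is_derive_id x (1 : R))).
  by apply: (is_derive_eq h); rewrite scaler0 addr0 !scalerE !mulr1.
have d2 := is_derive1_comp (is_derive_expR _) d1.
have h : is_derive x 1 (fun y => normal_peak s * (expR \o (fun x => c * (x * x))) y) _
  := is_deriveM (is_derive_cst (normal_peak s) x 1) d2.
apply: (is_derive_eq h); rewrite scaler0 addr0 !scalerE /normal_fun subr0 /=.
have -> : - x ^+ 2 / (s ^+ 2 *+ 2) = c * (x * x) by rewrite /c; field.
by rewrite /c; field.
Qed.

(** Completing the square with k + 1 in place of k leaves a spare factor exp (- |x|), which kills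
    the boundary terms in [normal_ibp]. *)
Lemma normal_pdf_exp_decay (s k x : R) : s != 0 -> 0 <= k ->
  expR (k * `|x|) * normal_pdf 0 s x
    <= normal_peak s * expR ((k + 1) ^+ 2 * s ^+ 2 / 2) * expR (- `|x|).
Proof.
move=> s0 k0; rewrite normal_pdfE// mulrCA -mulrA ler_wpM2l ?normal_peak_ge0//.
rewrite /normal_fun -!expRD ler_expR subr0.
have -> : x ^+ 2 = `|x| ^+ 2 by rewrite -normrX ger0_norm// sqr_ge0.
rewrite -subr_ge0.
suff -> : (k + 1) ^+ 2 * s ^+ 2 / 2 + - `|x| - (k * `|x| + - `|x| ^+ 2 / (s ^+ 2 *+ 2))
  = (`|x| / s - (k + 1) * s) ^+ 2 / 2 by rewrite divr_ge0// sqr_ge0.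
by field.
Qed.

(** Stein's identity. With p the density, (f p)' = f' p - x f p / s^2 has integral 0: its integral
    over [- n, n] consists of boundary terms that vanish in the limit, and dominated convergence
    passes to the whole line. *)
Lemma normal_ibp (s C k : R) (f f' : R -> R) : s != 0 -> 0 <= k ->
  (forall x : R, is_derive x (1 : R) f (f' x)) -> continuous f' ->
  (forall x, `|f x| <= C * expR (k * `|x|)) ->
  (forall x, `|f' x| <= C * expR (k * `|x|)) ->
  (\int[normal_prob 0 s]_x (x * f x) = s ^+ 2 * \int[normal_prob 0 s]_x f' x)%R.
Proof.
move=> s0 k0 df cf' fC f'C.
have C0 : 0 <= C.
  by have := le_trans (normr_ge0 _) (fC 0); rewrite normr0 mulr0 expR0 mulr1.
set p := normal_pdf 0 s.
have cf : continuous f.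
  by move=> x; apply/differentiable_continuous/derivable1_diffP; have [] := df x.
have cp : continuous p by exact: continuous_normal_pdf.
have mf : measurable_fun setT f by exact: continuous_measurable_fun.
have mf' : measurable_fun setT f' by exact: continuous_measurable_fun.
have if' : (normal_prob 0 s).-integrable setT (EFin \o f').
  exact: (@integrable_normal_exp_growth _ C k).
have ixf : (normal_prob 0 s).-integrable setT (EFin \o (fun x => x * f x)).
  apply: (@integrable_normal_exp_growth _ C (k + 1)) => //.
    exact: measurable_funM.
  move=> x; rewrite normrM mulrDl expRD mul1r mulrA [leRHS]mulrC.
  apply: ler_pM => //; apply: le_trans (expR_ge1Dx _); by rewrite lerDr.
pose F x := f x * p x.
pose g x := f' x * p x - (s ^+ 2)^-1 * (x * f x * p x).
have dF (x : R) : is_derive x (1 : R) F (g x).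
  have h : is_derive x 1 F _ := is_deriveM (df x) (is_derive_normal_pdf x s0).
  apply: (is_derive_eq h); rewrite !scalerE /g -/p; field.
  by rewrite s0.
have cg : continuous g.
  move=> x; apply: (@cvgB _ R^o); first by apply: cvgM; [exact: cf'|exact: cp].
  apply: cvgM; first exact: cvg_cst.
  by apply: cvgM; [apply: cvgM; [exact: cvg_id|exact: cf]|exact: cp].
have ig : mu.-integrable setT (EFin \o g).
  have := integrableB measurableT ((integrable_normal 0 s mf').1 if')
    (integrableZl measurableT (s ^+ 2)^-1 ((integrable_normal 0 s (measurable_funM (@measurable_id _ _ setT) mf)).1 ixf)).
  by apply: eq_integrable.
have intg : (\int[mu]_x (g x)%:E = 0)%E.
  have mg : measurable_fun setT (EFin \o g) by exact: measurable_int ig.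
  pose gn n : R -> \bar R := (EFin \o g) \_ `[- n.+1%:R, n.+1%:R].
  have [] := @dominated_convergence _ _ _ mu setT measurableT gn (EFin \o g)
    (fun x => `|(EFin \o g) x|%E).
  - by move=> n; apply/measurable_restrict => //; exact: measurable_funTS.
  - exact: mg.
  - apply: aeW => x _; apply: cvg_near_cst; near=> n.
    rewrite /gn patchE mem_set//= in_itv/= -ler_norml.
    have : `|x| <= n%:R by near: n; exact: nbhs_infty_ger.
    by move/le_trans; apply; rewrite ler_nat.
  - exact: integrable_abse.
  - apply: aeW => x n _; rewrite /gn patchE; case: ifP => _ //.
    by rewrite abse0.
  move=> _ _ h; apply: (cvg_unique _ h) => //.
  have -> : [sequence (\int[mu]_x gn n x)%E]_n = (fun n => (F n.+1%:R - F (- n.+1%:R))%:E).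
    apply/funext => n.
    transitivity (\int[mu]_(x in `[(- n.+1%:R)%R, n.+1%:R%R]) (g x)%:E)%E.
      by rewrite [RHS]integral_mkcond.
    rewrite (@continuous_FTC2 _ g F) ?EFinB//.
    + by rewrite -subr_gt0 opprK addr_gt0.
    + exact: continuous_subspaceT.
    + have cF : continuous F.
        by move=> x; apply/differentiable_continuous/derivable1_diffP; have [] := dF x.
      split.
      * by move=> x _; have [] := dF x.
      * by apply: cvg_at_right_filter; exact: cF.
      * by apply: cvg_at_left_filter; exact: cF.
    + by move=> x _; rewrite derive1E; have [_ ->] := dF x.
  apply: cvg_EFin; first exact: nearW.
  pose K := C * (normal_peak s * expR ((k + 1) ^+ 2 * s ^+ 2 / 2)).
  have FK x : `|F x| <= K * expR (- `|x|).
    rewrite normrM (ger0_norm (normal_pdf_ge0 _ _ _)).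
    apply: (@le_trans _ _ (C * (expR (k * `|x|) * p x))).
      by rewrite mulrA ler_wpM2r ?normal_pdf_ge0.
    by rewrite /K -mulrA ler_wpM2l// normal_pdf_exp_decay.
  have K0 : 0 <= K by rewrite !mulr_ge0 ?normal_peak_ge0 ?expR_ge0.
  have e n : `|F n.+1%:R - F (- n.+1%:R)| <= (2 * K) * n.+1%:R^-1.
    apply: le_trans (ler_normB _ _) _.
    have h1 := FK n.+1%:R; have h2 := FK (- n.+1%:R).
    have nn : `|n.+1%:R : R| = n.+1%:R by rewrite ger0_norm.
    rewrite nn in h1; rewrite normrN nn in h2.
    have h3 : K * expR (- n.+1%:R) <= K * n.+1%:R^-1.
      rewrite ler_wpM2l// expRN lef_pV2 ?posrE ?expR_gt0//.
      by apply: le_trans (expR_ge1Dx _); rewrite lerDr.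
    apply: le_trans (lerD h1 h2) _.
    by rewrite -[leRHS]mulrA mulr_natl mulr2n lerD.
  apply: norm_cvg0; apply: (squeeze_cvgr _ (cvg_cst 0)).
    by near=> n; rewrite normr_ge0/=; exact: e.
  rewrite -(mulr0 (2 * K)); apply: cvgM; first exact: cvg_cst.
  exact: cvg_harmonic.
have e1 : \int[normal_prob 0 s]_x f' x = \int[mu]_x (f' x * p x).
  by rewrite /Rintegral integral_normal.
have e2 : \int[normal_prob 0 s]_x (x * f x) = \int[mu]_x (x * f x * p x).
  by rewrite /Rintegral integral_normal.
rewrite e1 e2.
have : \int[mu]_x g x = 0 by rewrite /Rintegral intg.
rewrite /g RintegralB//; last 2 first.
  exact: (integrable_normal 0 s mf').1.
  have := integrableZl measurableT (s ^+ 2)^-1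
    ((integrable_normal 0 s (measurable_funM (@measurable_id _ _ setT) mf)).1 ixf).
  by apply: eq_integrable.
rewrite RintegralZl//; last first.
  by apply: (integrable_normal 0 s (measurable_funM (@measurable_id _ _ setT) mf)).1.
move=> h; have -> : \int[mu]_x (f' x * p x) = (s ^+ 2)^-1 * \int[mu]_x (x * f x * p x).
  by apply/eqP; rewrite -subr_eq0 h.
by rewrite mulrA divff ?mul1r// expf_neq0.
Unshelve. all: by end_near. Qed.

Lemma exprn_le_fact_expR (k : nat) (x : R) : `|x ^+ k| <= k`!%:R * expR `|x|.
Proof.
rewrite normrX; case: k => [|k].
  by rewrite expr0 fact0 mul1r -[leLHS]expR0 ler_expR.
have k0 : 0 < (k.+1)`!%:R :> R by rewrite ltr0n fact_gt0.
rewrite mulrC -ler_pdivrMr//; apply: le_trans (expR_ge1Dxn k (normr_ge0 x)).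
by rewrite lerDr.
Qed.

Lemma normal_moment_integrable (s : R) (k : nat) : s != 0 ->
  (normal_prob 0 s).-integrable setT (EFin \o (fun x => x ^+ k)).
Proof.
move=> s0; apply: (@integrable_normal_exp_growth _ k`!%:R 1) => //.
by move=> x; rewrite mul1r exprn_le_fact_expR.
Qed.

Lemma is_derive_exprn (k : nat) (x : R) :
  is_derive x (1 : R) (fun y : R => y ^+ k.+1) (k.+1%:R * x ^+ k).
Proof.
have -> : (fun y : R => y ^+ k.+1) = (id : R -> R) ^+ k.+1.
  by apply/funext => y; rewrite fctE.
by apply: (is_derive_eq (is_deriveX k.+1 (is_derive_id x (1 : R)))); rewrite scalerE mulr1.
Qed.

Lemma normal_moment_rec (s : R) (k : nat) : s != 0 ->
  \int[normal_prob 0 s]_x (x ^+ k.+2) =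
    k.+1%:R * s ^+ 2 * \int[normal_prob 0 s]_x (x ^+ k).
Proof.
move=> s0.
have := @normal_ibp s (k.+1)`!%:R 1 (fun x => x ^+ k.+1) (fun x => k.+1%:R * x ^+ k) s0 ler01
  (is_derive_exprn k).
move=> -> //.
- rewrite RintegralZl//; last exact: normal_moment_integrable.
  by rewrite mulrCA mulrA.
- by move=> x; apply: cvgM; [exact: cvg_cst|exact: exprn_continuous].
- by move=> x; rewrite mul1r exprn_le_fact_expR.
- move=> x; rewrite mul1r normrM ger0_norm// factS natrM -mulrA.
  by rewrite ler_wpM2l// exprn_le_fact_expR.
Qed.

Lemma normal_mean (s : R) : s != 0 -> \int[normal_prob 0 s]_x x = 0.
Proof.
move=> s0.
have := @normal_ibp s 1 0 (fun x => 1) (fun x => 0) s0 (lexx _)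
  (fun x => is_derive_cst (1 : R) x 1).
under eq_Rintegral do rewrite mulr1.
move=> ->.
- by rewrite Rintegral_cst// mul0r mulr0.
- by move=> x; exact: cvg_cst.
- by move=> x; rewrite mul0r expR0 mulr1 normr1.
- by move=> x; rewrite mul0r expR0 mulr1 normr0.
Qed.

(** The integral G satisfies G' (u) = - u s^2 G (u), by differentiation under the integral and
    [normal_ibp] applied to - sin; hence G (u) exp (u^2 s^2 / 2) is constant. The phase a treats
    sines and cosines together. *)
Lemma normal_cos (s t a : R) : s != 0 ->
  \int[normal_prob 0 s]_x cos (t * x + a) = expR (- (t ^+ 2 * s ^+ 2 / 2)) * cos a.
Proof.
move=> s0; set N := normal_prob 0 s.
pose G u := \int[N]_x cos (u * x + a).
have dlin (u x : R) : is_derive x (1 : R) (fun y : R => u * y + a) u.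
  have h : is_derive x (1 : R) (fun y : R => u * y + a) _ :=
    is_deriveD (is_deriveM (is_derive_cst u x 1) (is_derive_id x (1 : R)))
      (is_derive_cst a x 1).
  by apply: (is_derive_eq h); rewrite scaler0 !addr0 scalerE mulr1.
have dcos (u x : R) : is_derive x (1 : R) (fun y : R => cos (u * y + a)) (- sin (u * x + a) * u).
  exact: (is_derive1_comp (is_derive_cos _) (dlin u x)).
have dsin (u x : R) : is_derive x (1 : R) (fun y : R => sin (u * y + a)) (cos (u * x + a) * u).
  exact: (is_derive1_comp (is_derive_sin _) (dlin u x)).
have clin (u : R) : continuous (fun y : R => u * y + a).
  by move=> x; apply/differentiable_continuous/derivable1_diffP; have [] := dlin u x.
have icos u : N.-integrable setT (EFin \o (fun x => cos (u * x + a))).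
  apply: (@integrable_normal_exp_growth _ 1 0) => //.
    apply: continuous_measurable_fun => x.
    by apply/differentiable_continuous/derivable1_diffP; have [] := dcos u x.
  by move=> x; rewrite mul0r expR0 mulr1 ler_norml cos_geN1 cos_le1.
have dG (u : R) : is_derive u (1 : R) G (- (u * s ^+ 2) * G u).
  have d1E (x y : R) : partial1of2 (fun u x => cos (u * x + a)) x y = - sin (x * y + a) * y.
    have h : is_derive x (1 : R) (fun u => cos (u * y + a)) (- sin (x * y + a) * y).
      have -> : (fun u => cos (u * y + a)) = (fun u => cos (y * u + a)).
        by apply/funext => v; rewrite mulrC.
      by rewrite [x * y]mulrC; exact: dcos.
    by rewrite /partial1of2 derive1E; have [_ ->] := h.
  have uI : `]u - 1, u + 1[%classic u by rewrite /= in_itv/= ltrBlDr ltrDl ltr01.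
  have inorm : N.-integrable setT (EFin \o (fun y : R => `|y|)).
    by apply: integrable_norm; have := normal_moment_integrable 1 s0; apply: eq_integrable.
  have Gub x y : `]u - 1, u + 1[%classic x -> [set: R] y ->
     `|partial1of2 (fun u x => cos (u * x + a)) x y| <= `|y|.
    move=> _ _; rewrite d1E normrM normrN ler_piMl//.
    by rewrite ler_norml sin_geN1 sin_le1.
  have der x y : `]u - 1, u + 1[%classic x -> [set: R] y ->
     derivable ((fun u x => cos (u * x + a)) ^~ y) x 1.
    move=> _ _.
    have -> : (fun u => cos (u * y + a)) = (fun u => cos (y * u + a)).
      by apply/funext => v; rewrite mulrC.
    by have [] := dcos y x.
  split.
    exact: (derivable_under_integral measurableT uI (fun x _ => icos x) der (fun y => normr_ge0 y) inorm Gub).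
  rewrite -derive1E (differentiation_under_integral measurableT uI (fun x _ => icos x) der (fun y => normr_ge0 y) inorm Gub)//.
  transitivity (\int[N]_x (x * - sin (u * x + a))).
    by apply: eq_Rintegral => x _; rewrite d1E mulrC.
  have nsin (x : R) : is_derive x (1 : R) (fun y => - sin (u * y + a)) (- (cos (u * x + a) * u)).
    exact: (is_deriveN (dsin u x)).
  have C1 : 0 <= 1 + `|u| by rewrite addr_ge0.
  rewrite (@normal_ibp s (1 + `|u|) 0 _ _ s0 (lexx _) nsin); first last.
  - move=> x; rewrite mul0r expR0 mulr1 normrN normrM.
    apply: (@le_trans _ _ (1 * `|u|)); last by rewrite mul1r lerDr.
    by rewrite ler_wpM2r// ler_norml cos_geN1 cos_le1.
  - move=> x; rewrite mul0r expR0 mulr1 normrN.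
    apply: (@le_trans _ _ 1); last by rewrite lerDl.
    by rewrite ler_norml sin_geN1 sin_le1.
  - move=> x; apply: (@cvgN _ R^o); apply: cvgM; last exact: cvg_cst.
    by apply/differentiable_continuous/derivable1_diffP; have [] := dcos u x.
  have -> : \int[N]_x - (cos (u * x + a) * u) = - u * G u.
    rewrite /G -RintegralZl//.
    by apply: eq_Rintegral => x _; rewrite mulrC mulNr.
  by ring.
pose H u := G u * expR (u ^+ 2 * (s ^+ 2 / 2)).
have dE (u : R) : is_derive u (1 : R) (fun u => expR (u ^+ 2 * (s ^+ 2 / 2)))
    (expR (u ^+ 2 * (s ^+ 2 / 2)) * (u * s ^+ 2)).
  have h1 : is_derive u (1 : R) (fun u : R => u ^+ 2 * (s ^+ 2 / 2)) _ :=
    is_deriveM (is_derive_exprn 1 u) (is_derive_cst (s ^+ 2 / 2) u 1).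
  have h2 : is_derive u (1 : R) (fun u : R => u ^+ 2 * (s ^+ 2 / 2)) (u * s ^+ 2).
    by apply: (is_derive_eq h1); rewrite scaler0 add0r /GRing.scale /= expr1; field.
  exact: (is_derive1_comp (is_derive_expR _) h2).
have dH (u : R) : is_derive u (1 : R) H 0.
  have h : is_derive u (1 : R) H _ := is_deriveM (dG u) (dE u).
  by apply: (is_derive_eq h); rewrite !scalerE; ring.
have := is_derive_0_is_cst t 0 dH.
rewrite /H expr0n mul0r expR0 mulr1 => e.
have G0 : G 0 = cos a.
  transitivity (\int[N]_x cos a).
    by apply: eq_Rintegral => x _; rewrite mul0r add0r.
  by rewrite Rintegral_cst// [X in fine X]probability_setT mulr1.
rewrite -/(G t) -G0 -e mulrCA -expRD.
have -> : - (t ^+ 2 * s ^+ 2 / 2) + t ^+ 2 * (s ^+ 2 / 2) = 0 by field.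
by rewrite expR0 mulr1.
Qed.

End NormalIntegral.

(** * Symmetric tensors *)

Section Hilbert.
Context {R : realType} {H : hilbertType R}.
Implicit Types x y z : H.

Lemma innerC x y : inner x y = inner y x.
Proof. by rewrite hermC expr0 mul1r. Qed.
Lemma inner_linl a x y z : inner (a *: x + y) z = a * inner x z + inner y z.
Proof. by rewrite linearPl. Qed.
Lemma innerDl x y z : inner (x + y) z = inner x z + inner y z.
Proof. by rewrite linearDl. Qed.
Lemma innerZl a x y : inner (a *: x) y = a * inner x y.
Proof. by rewrite linearZl_LR. Qed.
Lemma innerZr a x y : inner x (a *: y) = a * inner x y.
Proof. by rewrite innerC innerZl innerC. Qed.
Lemma innerDr x y z : inner z (x + y) = inner z x + inner z y.
Proof. by rewrite innerC innerDl !(innerC _ z). Qed.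
Lemma inner0l x : inner 0 x = 0.
Proof. by rewrite linear0l. Qed.
Lemma inner0r x : inner x 0 = 0.
Proof. by rewrite innerC inner0l. Qed.
Lemma innerBl x y z : inner (x - y) z = inner x z - inner y z.
Proof. by rewrite -scaleN1r innerDl innerZl mulN1r. Qed.
Lemma innerBr x y z : inner z (x - y) = inner z x - inner z y.
Proof. by rewrite innerC innerBl !(innerC _ z). Qed.
Lemma inner_suml (I : Type) (r : seq I) (K : pred I) (F : I -> H) z :
  inner (\sum_(i <- r | K i) F i) z = \sum_(i <- r | K i) inner (F i) z.
Proof. by apply: (big_morph (fun x => inner x z)) => [x y|]; rewrite ?innerDl ?inner0l. Qed.
Lemma inner_sumr (I : Type) (r : seq I) (K : pred I) (F : I -> H) z :
  inner z (\sum_(i <- r | K i) F i) = \sum_(i <- r | K i) inner z (F i).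
Proof. by rewrite innerC inner_suml; apply: eq_bigr => i _; rewrite innerC. Qed.

Lemma sqr_normD x y : `|x + y| ^+ 2 = `|x| ^+ 2 + 2 * inner x y + `|y| ^+ 2.
Proof. by rewrite -!inner_norm innerDl !innerDr (innerC y x); ring. Qed.

Lemma sqr_normB x y : `|x - y| ^+ 2 = `|x| ^+ 2 - 2 * inner x y + `|y| ^+ 2.
Proof. by rewrite -!inner_norm innerBl !innerBr (innerC y x); ring. Qed.

(** Gram-Schmidt, one vector at a time; it supplies the finitely many coordinates in which W acts as
    a standard Gaussian vector. *)
Lemma orthonormal_coordinates (hs : seq H) : exists (n : nat) (e : 'I_n -> H),
  (forall i j, inner (e i) (e j) = (i == j)%:R) /\
  (forall h, h \in hs -> exists t : 'I_n -> R, h = \sum_i t i *: e i).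
Proof.
elim: hs => [|h hs [n [e [e_on he]]]].
  by exists 0%N, (fun=> 0); split => [[]|] //.
pose h' := h - \sum_i inner h (e i) *: e i.
have h'e j : inner h' (e j) = 0.
  rewrite innerBl inner_suml (bigD1 j)//= innerZl e_on eqxx mulr1 big1 ?addr0 ?subrr// => i /negPf ij.
  by rewrite innerZl e_on ij mulr0.
have hE : h = h' + \sum_i inner h (e i) *: e i by rewrite subrK.
(* A vector already in the span adds nothing to the family. *)
have [h'0|h'0] := eqVneq h' 0.
  exists n, e; split => // g; rewrite inE => /predU1P[->|/he//].
  by exists (fun i => inner h (e i)); rewrite {1}hE h'0 add0r.
pose c := `|h'|^-1.
have c0 : c != 0 by rewrite invr_eq0 normr_eq0.
have ch : c ^+ 2 * inner h' h' = 1.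
  by rewrite inner_norm -exprMn mulVf ?expr1n// normr_eq0.
pose e' (i : 'I_n.+1) := if unlift ord0 i is Some j then e j else c *: h'.
have e'0 : e' ord0 = c *: h' by rewrite /e' unlift_none.
have e'S j : e' (lift ord0 j) = e j by rewrite /e' liftK.
exists n.+1, e'; split.
  move=> i j; case: (unliftP ord0 i) => [i'|] ->; case: (unliftP ord0 j) => [j'|] ->.
  - by rewrite !e'S e_on (inj_eq lift_inj).
  - by rewrite e'S e'0 innerZr innerC h'e mulr0 eq_sym (negPf (neq_lift _ _)).
  - by rewrite e'S e'0 innerZl h'e mulr0 (negPf (neq_lift _ _)).
  - by rewrite e'0 innerZl innerZr mulrA -expr2 ch eqxx.
move=> g; rewrite inE => /predU1P[->|/he[t ->]].
  exists (fun i => if unlift ord0 i is Some j then inner h (e j) else c^-1).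
  rewrite big_ord_recl unlift_none e'0 scalerA mulVf// scale1r {1}hE; congr (_ + _).
  by apply: eq_bigr => i _; rewrite liftK e'S.
exists (fun i => if unlift ord0 i is Some j then t j else 0).
rewrite big_ord_recl unlift_none scale0r add0r.
by apply: eq_bigr => i _; rewrite liftK e'S.
Qed.

End Hilbert.

Definition sgb (R : realType) (b : bool) : R := (-1) ^+ b.

(** For a fixed phi the signs add up to 2^n if phi is a permutation; otherwise phi misses an index,
    and flipping its sign cancels the sum. A general [F] serves both tensors and monomials. *)
Lemma polarization (R : realType) (V : lmodType R) (n : nat)
    (F : {ffun 'I_n -> 'I_n} -> V) :
  \sum_(e : {ffun 'I_n -> bool}) (\prod_i sgb R (e i)) *:
     \sum_(phi : {ffun 'I_n -> 'I_n}) (\prod_k sgb R (e (phi k))) *: F phi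
  = (2 ^ n)%:R *: \sum_(s : {perm 'I_n}) F [ffun i => s i].
Proof.
under eq_bigr do rewrite scaler_sumr.
rewrite exchange_big /=.
under eq_bigr do under eq_bigr do rewrite scalerA.
under eq_bigr do rewrite -scaler_suml.
have sgb2 b : sgb R b * sgb R b = 1 by rewrite /sgb -expr2 sqrr_sign.
rewrite (bigID (fun phi : {ffun 'I_n -> 'I_n} => injectiveb phi)) /= [X in _ + X]big1 ?addr0; last first.
  move=> phi /injectiveP ninj.
  have [i0 ni0] : exists i0, i0 \notin codom phi.
    apply/existsP; apply: contrapT => /negP; rewrite negb_exists => /forallP onto.
    apply: ninj; apply/injectiveP/card_uniqP.
    rewrite size_codom card_ord -[RHS]card_ord; apply: eq_card => i.
    by have := onto i; rewrite negbK => ->; rewrite inE.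
  set S := (X in X *: _); suff -> : S = 0 by rewrite scale0r.
  (* The prefactor contains the sign at i0 once and the product along phi never does, so the flip
     negates the sum. *)
  pose flip (e : {ffun 'I_n -> bool}) : {ffun 'I_n -> bool} :=
    [ffun i => if i == i0 then ~~ e i else e i].
  have flipK : involutive flip.
    by move=> e; apply/ffunP => i; rewrite !ffunE; case: eqP => //; rewrite negbK.
  have SN : S = - S.
    rewrite {1}/S (reindex_inj (inv_inj flipK)) /S -sumrN; apply: eq_bigr => e _.
    rewrite -mulNr; congr (_ * _).
      rewrite (bigD1 i0)//= [in RHS](bigD1 i0)//= -mulNr; congr (_ * _).
        by rewrite ffunE eqxx /sgb signrN.
      by apply: eq_bigr => i /negPf ii0; rewrite ffunE ii0.
    apply: eq_bigr => k _; rewrite ffunE; case: eqP => // pk.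
    by move: ni0; rewrite -pk codom_f.
  by lra.
rewrite scaler_sumr.
rewrite (reindex_onto (fun s : {perm 'I_n} => [ffun i => s i])
   (fun phi => insubd (1%g : {perm 'I_n}) phi)) /=; last first.
  move=> phi inj; apply/ffunP => i; rewrite ffunE.
  by rewrite -[in RHS](insubdK (1%g : {perm 'I_n}) inj) /= pvalE.
apply: congr_big => // [s|s _].
  apply/andP; split.
    by apply/injectiveP => i j; rewrite !ffunE => /perm_inj.
  apply/eqP/permP => i.
  have inj : injectiveb ([ffun i => s i] : {ffun 'I_n -> 'I_n}).
    by apply/injectiveP => j k; rewrite !ffunE => /perm_inj.
  set phi := [ffun i => s i] in inj *.
  have -> : s i = phi i by rewrite ffunE.
  by rewrite -[in RHS](insubdK (1%g : {perm 'I_n}) inj) /= pvalE.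
congr (_ *: _).
rewrite (eq_bigr (fun=> 1)); last first.
  move=> e _; rewrite (_ : \prod_k sgb R (e ([ffun i => s i] k)) = \prod_k sgb R (e k)).
    by rewrite -big_split; apply: big1 => i _ /=.
  by rewrite [RHS](reindex_inj (@perm_inj _ s)); apply: eq_bigr => k _; rewrite ffunE.
by rewrite sumr_const card_ffun card_bool card_ord.
Qed.

Section TensorPower.
Context {R : realType} {H : hilbertType R} {n : nat} (T : tensor_power H n).

Lemma tensor_approx (v : T) (eps : R) : 0 < eps ->
  exists (k : nat) (c : 'I_k -> R) (h : 'I_k -> 'I_n -> H),
    `|v - \sum_(j < k) c j *: tens T (h j)| < eps.
Proof.
move=> eps0.
have /(_ (ball v eps)) := @tens_dense _ _ _ T.
case.
- by exists v; exact: ballxx.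
- exact: ball_open.
- move=> t [vt [k [c [h tE]]]]; exists k, c, h; rewrite -tE.
  by move: vt; rewrite -ball_normE.
Qed.

(** The difference u is orthogonal to all elementary tensors, and some combination of them lies
    within eps of u; Pythagoras then bounds |u| by eps. *)
Lemma tensor_ext (v w : T) :
  (forall g, inner v (tens T g) = inner w (tens T g)) -> v = w.
Proof.
move=> vw; apply/eqP; rewrite -subr_eq0 -normr_eq0; apply/eqP.
set u := v - w; have u0 g : inner u (tens T g) = 0 by rewrite innerBl vw subrr.
apply/eqP; rewrite eq_le normr_ge0 andbT; apply/ler_addgt0Pl => eps eps0.
rewrite addr0; have [k [c [h uh]]] := tensor_approx u eps0.
apply: le_trans (ltW uh); rewrite -(@ler_pXn2r _ 2) ?nnegrE//.
rewrite [leRHS]sqr_normB inner_sumr [X in _ - 2 * X]big1; last first.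
  by move=> j _; rewrite innerZr u0 mulr0.
by rewrite mulr0 subr0 lerDl sqr_ge0.
Qed.

Lemma sym_power_lin a (f g : T) :
  sym_power f -> sym_power g -> sym_power (a *: f + g).
Proof. by move=> sf sg s h; rewrite !inner_linl sf sg. Qed.

Lemma sym_power0 : sym_power (0 : T).
Proof. by move=> s h; rewrite !inner0l. Qed.

Definition tpow (h : H) : T := tens T (fun=> h).

Lemma inner_tpow g h : inner (tpow g) (tpow h) = inner g h ^+ n.
Proof. by rewrite /tpow tens_inner prodr_const card_ord. Qed.

Lemma inner_tpow_tens g h : inner (tpow g) (tens T h) = \prod_i inner g (h i).
Proof. by rewrite /tpow tens_inner. Qed.

Lemma sym_tpow h : sym_power (tpow h).
Proof.
move=> s g; rewrite !inner_tpow_tens [RHS](reindex_inj (@perm_inj _ s)).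
by apply: eq_bigr.
Qed.

Lemma tpowZ a h : tpow (a *: h) = a ^+ n *: tpow h.
Proof.
apply: tensor_ext => g; rewrite innerZl !inner_tpow_tens.
under eq_bigr do rewrite innerZl.
by rewrite big_split /= prodr_const card_ord.
Qed.

Definition tpow_comb (s : seq (R * H)) : T := \sum_(x <- s) x.1 *: tpow x.2.

(** [mint_hermite] prescribes the integral on powers of unit vectors, hence this normalization. *)
Definition unit_comb (s : seq (R * H)) : Prop := forall x, x \in s -> `|x.2| = 1.

Lemma sym_tpow_comb s : sym_power (tpow_comb s).
Proof.
rewrite /tpow_comb; elim: s => [|x s IH]; first by rewrite big_nil; exact: sym_power0.
by rewrite big_cons; apply: sym_power_lin => //; exact: sym_tpow.
Qed.

Lemma inner_tpow_comb s t :
  inner (tpow_comb s) (tpow_comb t) =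
    \sum_(x <- s) \sum_(y <- t) x.1 * y.1 * inner x.2 y.2 ^+ n.
Proof.
rewrite inner_suml; apply: eq_bigr => x _; rewrite inner_sumr; apply: eq_bigr => y _.
by rewrite innerZl innerZr inner_tpow mulrA.
Qed.

Hypothesis n_gt0 : (0 < n)%N.

Let unit_span (v : T) := exists2 s, unit_comb s & v = tpow_comb s.

Lemma unit_span_lin a v w : unit_span v -> unit_span w -> unit_span (a *: v + w).
Proof.
move=> [s us ->] [t ut ->]; exists ([seq (a * x.1, x.2) | x <- s] ++ t).
  by move=> x; rewrite mem_cat => /orP[/mapP[y ys ->]|/ut//]; exact: (us y ys).
rewrite /tpow_comb big_cat big_map scaler_sumr /=; congr (_ + _).
by apply: eq_bigr => x _; rewrite scalerA.
Qed.

Lemma unit_span0 : unit_span 0.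
Proof. by exists [::] => //; rewrite /tpow_comb big_nil. Qed.

Lemma unit_span_sum (I : Type) (r : seq I) (c : I -> R) (F : I -> T) :
  (forall i, unit_span (F i)) -> unit_span (\sum_(i <- r) c i *: F i).
Proof.
move=> uF; elim: r => [|i r IH]; first by rewrite big_nil; exact: unit_span0.
by rewrite big_cons; apply: unit_span_lin => //; exact: uF.
Qed.

Lemma unit_span_tpow h : unit_span (tpow h).
Proof.
have [->|h0] := eqVneq h 0.
  have -> : tpow 0 = 0 by rewrite -(scale0r 0) tpowZ expr0n gtn_eqF// scale0r.
  exact: unit_span0.
exists [:: (`|h| ^+ n, `|h|^-1 *: h)].
  by move=> x; rewrite inE => /eqP ->; rewrite normrZ normfV normr_id mulVf ?normr_eq0.
by rewrite /tpow_comb big_seq1 -tpowZ scalerA divff ?normr_eq0// scale1r.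
Qed.

(** Expanding the power of a signed sum of the h k produces the tensors along all maps phi, and
    [polarization] retains the permutations. *)
Lemma unit_span_symmetrization (h : 'I_n -> H) :
  unit_span (\sum_(s : {perm 'I_n}) tens T (h \o s)).
Proof.
have := polarization (fun phi : {ffun 'I_n -> 'I_n} => tens T (h \o phi)).
set Q := \sum_(e : _) _ => QE.
have QS : unit_span Q.
  apply: unit_span_sum => e.
  suff -> : \sum_(phi : {ffun 'I_n -> 'I_n})
      (\prod_(k < n) sgb R (e (phi k))) *: tens T (h \o phi)
      = tpow (\sum_k sgb R (e k) *: h k) by exact: unit_span_tpow.
  apply: tensor_ext => g; rewrite inner_tpow_tens inner_suml.
  under [RHS]eq_bigr do rewrite inner_suml.
  rewrite bigA_distr_bigA; apply: eq_bigr => phi _ /=.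
  rewrite innerZl tens_inner -big_split /=; apply: eq_bigr => k _.
  by rewrite innerZl.
have -> : \sum_(s : {perm 'I_n}) tens T (h \o s) = (2 ^ n)%:R^-1 *: Q + 0.
  rewrite addr0 QE scalerA mulVf ?scale1r; last by rewrite pnatr_eq0 -lt0n expn_gt0.
  by apply: eq_bigr => s _; congr tens; apply/funext => i; rewrite /= ffunE.
by apply: unit_span_lin => //; exact: unit_span0.
Qed.

(** An approximating tensor is averaged over permutations. Permuting factors is isometric and fixes
    f, so each permuted copy is as close to f as the original, and the average lies in the span of
    powers of unit vectors. *)
Lemma sym_power_approx (f : T) (eps : R) : sym_power f -> 0 < eps ->
  exists2 s, unit_comb s & `|f - tpow_comb s| < eps.
Proof.
move=> symf eps0; have [k [c [h fh]]] := tensor_approx f eps0.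
pose t (s : {perm 'I_n}) : T := \sum_(j < k) c j *: tens T (h j \o s).
have ft s : `|f - t s| = `|f - \sum_(j < k) c j *: tens T (h j)|.
  apply/eqP; rewrite -(@eqrXn2 _ 2)//; apply/eqP; rewrite !sqr_normB -!inner_norm.
  congr (_ - 2 * _ + _).
    by rewrite !inner_sumr; apply: eq_bigr => j _; rewrite !innerZr symf.
  rewrite !inner_suml; apply: eq_bigr => j _; rewrite !inner_sumr.
  apply: eq_bigr => i _; rewrite !innerZl !innerZr !tens_inner; do 2 congr (_ * _).
  by rewrite [RHS](reindex_inj (@perm_inj _ s)).
have fact0 : (#|{perm 'I_n}|%:R : R) != 0.
  by rewrite pnatr_eq0 -lt0n; apply/card_gt0P; exists 1%g.
pose S : T := #|{perm 'I_n}|%:R^-1 *: \sum_(s : {perm 'I_n}) t s.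
have [s us SE] : unit_span S.
  rewrite /S /t exchange_big /=.
  under eq_bigr do rewrite -scaler_sumr.
  rewrite -[_ *: _]addr0; apply: unit_span_lin; last exact: unit_span0.
  apply: unit_span_sum => j; exact: unit_span_symmetrization.
exists s => //; rewrite -SE; apply: le_lt_trans fh.
have -> : f - S = #|{perm 'I_n}|%:R^-1 *: \sum_(s : {perm 'I_n}) (f - t s).
  rewrite sumrB scalerBr; congr (_ - _).
  have -> : \sum_(s : {perm 'I_n}) f = #|{perm 'I_n}|%:R *: f by rewrite sumr_const scaler_nat.
  by rewrite scalerA mulVf// scale1r.
have card_gt0 : 0 < #|{perm 'I_n}|%:R :> R by rewrite lt0r fact0 ler0n.
rewrite normrZ normfV normr_nat ler_pdivrMl//.
apply: le_trans (ler_norm_sum _ _ _) _.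
by under eq_bigr do rewrite ft; rewrite sumr_const mulr_natl.
Qed.

(** Projected vectors lose their unit length or vanish. Rescaling keeps each new vector collinear
    with an old one, so orthogonality to h survives. *)
Lemma tpow_comb_normalize (s : seq (R * H)) : exists s',
  [/\ unit_comb s', forall x, x \in s' -> exists2 y, y \in s & exists a, x.2 = a *: y.2
    & tpow_comb s = tpow_comb s'].
Proof.
elim: s => [|x s [s' [us' s's ss']]]; first by exists [::].
have [x0|x0] := eqVneq x.2 0.
  exists s'; split => //.
    by move=> z /s's[y ys yz]; exists y => //; rewrite inE ys orbT.
  rewrite /tpow_comb big_cons x0 -(scale0r 0) tpowZ expr0n gtn_eqF// scale0r scaler0 add0r.
  exact: ss'.
exists ((x.1 * `|x.2| ^+ n, `|x.2|^-1 *: x.2) :: s'); split.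
- move=> z; rewrite inE => /predU1P[->|/us'//].
  by rewrite normrZ normfV normr_id mulVf ?normr_eq0.
- move=> z; rewrite inE => /predU1P[->|/s's[y ys yz]].
    by exists x; [exact: mem_head|exists `|x.2|^-1].
  by exists y => //; rewrite inE ys orbT.
- rewrite /tpow_comb !big_cons /= -scalerA -tpowZ scalerA divff ?normr_eq0// scale1r.
  by congr (_ + _); exact: ss'.
Qed.

End TensorPower.

(** * Projection on the orthogonal of a unit vector *)

Section Projection.
Context {R : realType} {H : hilbertType R} (T : forall n, tensor_power H n).
Variable h : H.
Hypothesis h1 : `|h| = 1.

Definition orth (x : H) : H := x - inner x h *: h.

Lemma orthK x : inner (orth x) h = 0.
Proof. by rewrite innerBl innerZl inner_norm h1 expr1n mulr1 subrr. Qed.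

Lemma inner_orthr x y : inner x (orth y) = inner (orth x) (orth y).
Proof. by rewrite [in RHS]innerBl innerZl [inner h _]innerC orthK mulr0 subr0. Qed.

Lemma inner_orthE x y : inner x y = inner x h * inner y h + inner (orth x) (orth y).
Proof. by rewrite -inner_orthr innerBr innerZr mulrC addrC subrK. Qed.

Let gram (s : seq (R * H)) (w : R * H -> R) a b :=
  \sum_(x <- s) \sum_(y <- s)
     w x * w y * (inner x.2 y.2 ^+ a * inner (orth x.2) (orth y.2) ^+ b).

(** This is the squared norm of the w-weighted sum of tensors with a factors x and b factors
    [orth x]. *)
Lemma gram_ge0 s w a b : 0 <= gram s w a b.
Proof.
pose t (x : R * H) : 'I_(a + b) -> H :=
  fun i => if fintype.split i is inl _ then x.2 else orth x.2.
have -> : gram s w a b = `|\sum_(x <- s) w x *: tens (T (a + b)) (t x)| ^+ 2.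
  rewrite -inner_norm inner_suml; apply: eq_bigr => x _.
  rewrite inner_sumr; apply: eq_bigr => y _.
  rewrite innerZl innerZr mulrA; congr (_ * _).
  rewrite tens_inner big_split_ord /=; congr (_ * _).
    rewrite (eq_bigr (fun=> inner x.2 y.2)) ?prodr_const ?card_ord// => i _.
    by rewrite /t (unsplitK (inl _ i)).
  rewrite (eq_bigr (fun=> inner (orth x.2) (orth y.2))) ?prodr_const ?card_ord// => i _.
  by rewrite /t (unsplitK (inr _ i)).
exact: sqr_ge0.
Qed.

(** Replacing one factor <orth x, orth y> by <x, y> adds <x, h> <y, h>, that is, a Gram form with
    weights w x <x, h>, which is nonnegative. *)
Lemma gram_le s w a b : gram s w a b <= gram s w (a + b) 0.
Proof.
elim: b a => [|b IH] a; first by rewrite addn0.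
apply: le_trans (_ : gram s w a.+1 b <= _); last by rewrite addnS -addSn.
rewrite -subr_ge0.
have := gram_ge0 s (fun x => w x * inner x.2 h) a b.
suff -> : gram s (fun x => w x * inner x.2 h) a b = gram s w a.+1 b - gram s w a b.+1 by [].
rewrite /gram -sumrB; apply: eq_bigr => x _; rewrite -sumrB; apply: eq_bigr => y _.
rewrite !exprS {2}(inner_orthE x.2 y.2); ring.
Qed.

(** The projection is orthogonal, so the squared distance is a difference of squared norms.
    Factoring u^(n+1) - v^(n+1) with u = <x, y>, v = <orth x, orth y> and u - v = <x, h> <y, h>
    leaves n + 1 Gram forms, each bounded through [gram_le]. The tensor on the right is the
    contraction with h. *)
Lemma tpow_comb_proj_dist s n :
  `|tpow_comb (T n.+1) s - tpow_comb (T n.+1) [seq (x.1, orth x.2) | x <- s]| ^+ 2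
  <= n.+1%:R * `|tpow_comb (T n) [seq (x.1 * inner x.2 h, x.2) | x <- s]| ^+ 2.
Proof.
rewrite sqr_normB -!inner_norm !inner_tpow_comb !big_map /=.
under [X in _ - 2 * X]eq_bigr do rewrite big_map /=.
under [X in _ + X]eq_bigr do rewrite big_map /=.
under [X in _ <= _ * X]eq_bigr do rewrite big_map /=.
pose w (x : R * H) := x.1 * inner x.2 h.
have -> : \sum_(x <- s) \sum_(y <- s) w x * w y * inner x.2 y.2 ^+ n = gram s w n 0.
  by apply: eq_bigr => x _; apply: eq_bigr => y _; rewrite expr0 mulr1.
set A := (X in X - _ + _); set B := (X in _ - 2 * X + _); set C := (X in _ + X <= _).
have BC : B = C.
  by apply: eq_bigr => x _; apply: eq_bigr => y _; rewrite inner_orthr.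
have -> : A - 2 * B + C = \sum_(i < n.+1) gram s w (n - i) i.
  have -> : A - 2 * B + C = A - C by rewrite BC; ring.
  rewrite /gram exchange_big -sumrB; apply: eq_bigr => x _ /=.
  rewrite exchange_big -sumrB; apply: eq_bigr => y _ /=.
  rewrite -mulrBr subrXX.
  have -> : inner x.2 y.2 - inner (orth x.2) (orth y.2) = inner x.2 h * inner y.2 h.
    by rewrite {1}inner_orthE addrK.
  rewrite mulrA mulr_sumr; apply: eq_bigr => i _; rewrite ?subSS /= /w; ring.
apply: (@le_trans _ _ (\sum_(i < n.+1) gram s w n 0)).
  apply: ler_sum => i _; have := gram_le s w (n - i) i.
  by rewrite subnK// -ltnS.
by rewrite sumr_const card_ord mulr_natl.
Qed.

End Projection.

(** * Expectations and isonormal processes *)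

Section Expectation.
Context d {Omega : measurableType d} {R : realType} (P : probability Omega R).
Implicit Types f g : Omega -> R.

Definition ex f : R := \int[P]_w f w.
Definition intg f := P.-integrable setT (EFin \o f).

Lemma intg_meas f : intg f -> measurable_fun setT f.
Proof. by move=> fi; apply/measurable_EFinP; exact: measurable_int fi. Qed.

Lemma exE f : intg f -> ('E_P[f])%E = (ex f)%:E.
Proof. by move=> fi; rewrite unlock /ex /Rintegral fineK// integrable_fin_num. Qed.

Lemma intgD f g : intg f -> intg g -> intg (fun w => f w + g w).
Proof. by move=> fi gi; have := integrableD measurableT fi gi; apply: eq_integrable. Qed.
Lemma intgZ a f : intg f -> intg (fun w => a * f w).
Proof. by move=> fi; have := integrableZl measurableT a fi; apply: eq_integrable. Qed.
Lemma intgN f : intg f -> intg (fun w => - f w).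
Proof. by move=> fi; have := integrableN fi; apply: eq_integrable. Qed.
Lemma intgB f g : intg f -> intg g -> intg (fun w => f w - g w).
Proof. by move=> fi gi; apply: intgD => //; exact: intgN. Qed.
Lemma intg_cst a : intg (fun=> a).
Proof. exact: finite_measure_integrable_cst. Qed.
Lemma intg_le f g : measurable_fun setT f -> (forall w, `|f w| <= g w) -> intg g -> intg f.
Proof.
move=> mf fg gi; apply: (le_integrable measurableT _ _ gi); first exact/measurable_EFinP.
by move=> w _ /=; rewrite lee_fin (le_trans (fg w))// ler_norm.
Qed.
Lemma intg_bnd f a : measurable_fun setT f -> (forall w, `|f w| <= a) -> intg f.
Proof. by move=> mf fa; apply: (intg_le mf fa); exact: intg_cst. Qed.
Lemma intg_norm f : intg f -> intg (fun w => `|f w|).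
Proof. exact: integrable_norm. Qed.
Lemma intg_sum (I : Type) (r : seq I) (F : I -> Omega -> R) :
  (forall i, intg (F i)) -> intg (fun w => \sum_(i <- r) F i w).
Proof.
move=> iF; elim: r => [|i r IH].
  by under eq_fun do rewrite big_nil; exact: intg_cst.
by under eq_fun do rewrite big_cons; exact: intgD.
Qed.

Lemma exD f g : intg f -> intg g -> ex (fun w => f w + g w) = ex f + ex g.
Proof. exact: RintegralD. Qed.
Lemma exZ a f : intg f -> ex (fun w => a * f w) = a * ex f.
Proof. exact: RintegralZl. Qed.
Lemma exB f g : intg f -> intg g -> ex (fun w => f w - g w) = ex f - ex g.
Proof. exact: RintegralB. Qed.
Lemma ex_cst a : ex (fun=> a) = a.
Proof. by rewrite /ex Rintegral_cst// [X in fine X]probability_setT mulr1. Qed.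
Lemma ex_sum (I : Type) (r : seq I) (F : I -> Omega -> R) :
  (forall i, intg (F i)) -> ex (fun w => \sum_(i <- r) F i w) = \sum_(i <- r) ex (F i).
Proof.
move=> iF; elim: r => [|i r IH].
  by under eq_fun do rewrite big_nil; rewrite ex_cst big_nil.
by under eq_fun do rewrite big_cons; rewrite exD// ?big_cons ?IH//; exact: intg_sum.
Qed.
Lemma ex_ge0 f : (forall w, 0 <= f w) -> 0 <= ex f.
Proof. by move=> f0; exact: Rintegral_ge0. Qed.
Lemma ex_le f g : intg f -> intg g -> (forall w, f w <= g w) -> ex f <= ex g.
Proof. by move=> fi gi fg; apply: le_Rintegral => // w _; exact: fg. Qed.
Lemma ex_norm f : intg f -> `|ex f| <= ex (fun w => `|f w|).
Proof. exact: le_normr_Rintegral. Qed.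
Lemma ex_norm_le f g : intg f -> intg g -> (forall w, `|f w| <= g w) -> `|ex f| <= ex g.
Proof. by move=> fi gi fg; apply: le_trans (ex_norm fi) _; apply: ex_le => //; exact: intg_norm. Qed.
Lemma ex_ae f g : measurable_fun setT f -> measurable_fun setT g ->
  {ae P, forall w, f w = g w} -> ex f = ex g.
Proof.
move=> mf mg fg; rewrite /ex /Rintegral; congr fine; apply: ae_eq_integral => //.
- exact/measurable_EFinP.
- exact/measurable_EFinP.
- by apply: filterS fg => w fgw _; rewrite fgw.
Qed.

Lemma intg_ge0_fin f : measurable_fun setT f -> (forall w, 0 <= f w) ->
  ('E_P[f] < +oo)%E -> intg f.
Proof.
move=> mf f0; rewrite unlock => foo; apply/integrableP; split.
  exact/measurable_EFinP.
by under eq_integral do rewrite /= ger0_norm//.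
Qed.

Definition sqint f := measurable_fun setT f /\ intg (fun w => f w ^+ 2).

Lemma sqintM f g : sqint f -> sqint g -> intg (fun w => f w * g w).
Proof.
move=> [mf fi] [mg gi]; apply: (intg_le _ _ (intgD fi gi)).
  exact: measurable_funM.
move=> w; rewrite normrM -(real_normK (num_real (f w))) -(real_normK (num_real (g w))).
have := sqr_ge0 (`|f w| - `|g w|); have := normr_ge0 (f w); have := normr_ge0 (g w).
set a := `|f w|; set b := `|g w|; rewrite sqrrB mulr2n; nra.
Qed.

Lemma sqint_bnd f a : measurable_fun setT f -> (forall w, `|f w| <= a) -> sqint f.
Proof.
move=> mf fa; split=> //; apply: (@intg_bnd _ (a ^+ 2)).
  exact: measurable_funX.
by move=> w; rewrite normrX lerXn2r ?nnegrE ?(le_trans (normr_ge0 _) (fa w)).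
Qed.

Lemma sqint_cst a : sqint (fun=> a).
Proof. exact: (@sqint_bnd _ `|a|). Qed.

Lemma sqint_intg f : sqint f -> intg f.
Proof. by move=> fi; have := sqintM fi (sqint_cst 1); under eq_fun do rewrite mulr1. Qed.

Lemma sqint_lin a f g : sqint f -> sqint g -> sqint (fun w => a * f w + g w).
Proof.
move=> fi gi; split.
  by apply: measurable_funD (gi.1); apply: measurable_funM (fi.1).
have -> : (fun w => (a * f w + g w) ^+ 2) =
    (fun w => (a ^+ 2 * (f w ^+ 2) + (2 * a) * (f w * g w)) + g w ^+ 2).
  by apply/funext => w; ring.
apply: intgD gi.2; apply: intgD; apply: intgZ; [exact: fi.2|exact: sqintM].
Qed.

Lemma sqintB f g : sqint f -> sqint g -> sqint (fun w => f w - g w).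
Proof.
move=> fi gi; have := sqint_lin (-1) gi fi.
by under eq_fun do rewrite mulN1r addrC.
Qed.

Lemma ex_CS f g : sqint f -> sqint g ->
  ex (fun w => f w * g w) ^+ 2 <= ex (fun w => f w ^+ 2) * ex (fun w => g w ^+ 2).
Proof.
move=> fi gi; set a := ex (fun w => f w ^+ 2); set b := ex (fun w => f w * g w).
set c := ex (fun w => g w ^+ 2).
have h s t : 0 <= s ^+ 2 * a + 2 * s * t * b + t ^+ 2 * c.
  have : 0 <= ex (fun w => (s * f w + t * g w) ^+ 2).
    by apply: ex_ge0 => w; exact: sqr_ge0.
  have -> : (fun w => (s * f w + t * g w) ^+ 2) =
      (fun w => (s ^+ 2 * (f w ^+ 2) + (2 * s * t) * (f w * g w)) + t ^+ 2 * (g w ^+ 2)).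
    by apply/funext => w; ring.
  have ifg := sqintM fi gi.
  have i1 := intgZ (s ^+ 2) fi.2; have i2 := intgZ (2 * s * t) ifg.
  have i3 := intgZ (t ^+ 2) gi.2.
  rewrite (exD (intgD i1 i2) i3) (exD i1 i2) (exZ _ fi.2) (exZ _ ifg) (exZ _ gi.2).
  by [].
have a0 : 0 <= a by apply: ex_ge0 => w; exact: sqr_ge0.
have c0 : 0 <= c by apply: ex_ge0 => w; exact: sqr_ge0.
move: a0; rewrite le_eqVlt => /orP[/eqP a0|a0].
  rewrite -a0 mul0r; have [->|b0] := eqVneq b 0; first by rewrite expr0n.
  have := h (- (c + 1) / (2 * b)) 1; rewrite -a0.
  suff -> : (- (c + 1) / (2 * b)) ^+ 2 * 0 + 2 * (- (c + 1) / (2 * b)) * 1 * b + 1 ^+ 2 * c = -1.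
    by rewrite lerNr oppr0 ler10.
  by field.
have := h (- b) a.
have -> : (- b) ^+ 2 * a + 2 * (- b) * a * b + a ^+ 2 * c = a * (a * c - b ^+ 2) by ring.
by rewrite pmulr_rge0// subr_ge0.
Qed.

Lemma ex_sqr_eq0 f : sqint f -> ex (fun w => f w ^+ 2) = 0 -> {ae P, forall w, f w = 0}.
Proof.
move=> [mf fi] f0.
have : ae_eq P setT (fun w => (f w ^+ 2)%:E) (cst 0%E).
  apply/(ae_eq_integral_abs P measurableT); first exact/measurable_EFinP/measurable_funX.
  under eq_integral do rewrite gee0_abs ?lee_fin ?sqr_ge0//.
  have := integrable_fin_num measurableT fi; rewrite -/(EFin \o _) => /fineK e.
  by move: f0; rewrite /ex /Rintegral => f0; rewrite -[LHS]e f0.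
apply: filterS => w /(_ I) /eqP; rewrite eqe sqrf_eq0 => /eqP; exact.
Qed.

(** Unlike square integrability, this class is stable under products, so every polynomial in the
    variables W h is integrable. *)
Definition allmom f := measurable_fun setT f /\ forall k, intg (fun w => `|f w| ^+ k).

Lemma allmom_cst a : allmom (fun=> a).
Proof. by split => // k; exact: intg_cst. Qed.

Lemma allmomM f g : allmom f -> allmom g -> allmom (fun w => f w * g w).
Proof.
move=> [mf fi] [mg gi]; split; first exact: measurable_funM.
move=> k; apply: (intg_le _ _ (intgD (fi (k * 2)%N) (gi (k * 2)%N))).
  by apply: measurable_funX; apply: measurableT_comp => //; exact: measurable_funM.
move=> w; rewrite normrX normr_id normrM exprMn !exprM.
have := sqr_ge0 (`|f w| ^+ k - `|g w| ^+ k).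
have := exprn_ge0 k (normr_ge0 (f w)); have := exprn_ge0 k (normr_ge0 (g w)).
set a := `|f w| ^+ k; set b := `|g w| ^+ k; rewrite sqrrB mulr2n; nra.
Qed.

Lemma allmomX f k : allmom f -> allmom (fun w => f w ^+ k).
Proof.
move=> fi; elim: k => [|k IH]; first by under eq_fun do rewrite expr0; exact: allmom_cst.
by under eq_fun do rewrite exprS; exact: allmomM.
Qed.

Lemma allmomD f g : allmom f -> allmom g -> allmom (fun w => f w + g w).
Proof.
move=> [mf fi] [mg gi]; split; first exact: measurable_funD.
move=> k; apply: (intg_le _ _ (intgZ (2 ^+ k) (intgD (fi k) (gi k)))).
  by apply: measurable_funX; apply: measurableT_comp => //; exact: measurable_funD.
move=> w; rewrite normrX normr_id.
apply: (@le_trans _ _ ((2 * Num.max `|f w| `|g w|) ^+ k)).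
  rewrite lerXn2r ?nnegrE ?mulr_ge0// ?le_max ?normr_ge0//.
  apply: le_trans (ler_normD _ _) _; rewrite mulr_natl mulr2n lerD// le_max lexx ?orbT//.
rewrite exprMn ler_wpM2l ?exprn_ge0//; case: (leP `|f w| `|g w|) => _.
- by rewrite lerDr exprn_ge0.
- by rewrite lerDl exprn_ge0.
Qed.

Lemma allmomZ a f : allmom f -> allmom (fun w => a * f w).
Proof. by move=> fi; apply: allmomM => //; exact: allmom_cst. Qed.

Lemma allmom_sum (I : Type) (r : seq I) (F : I -> Omega -> R) :
  (forall i, allmom (F i)) -> allmom (fun w => \sum_(i <- r) F i w).
Proof.
move=> iF; elim: r => [|i r IH].
  by under eq_fun do rewrite big_nil; exact: allmom_cst.
by under eq_fun do rewrite big_cons; exact: allmomD.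
Qed.

Lemma allmom_prod (I : Type) (r : seq I) (F : I -> Omega -> R) :
  (forall i, allmom (F i)) -> allmom (fun w => \prod_(i <- r) F i w).
Proof.
move=> iF; elim: r => [|i r IH].
  by under eq_fun do rewrite big_nil; exact: allmom_cst.
by under eq_fun do rewrite big_cons; exact: allmomM.
Qed.

Lemma allmom_intg f : allmom f -> intg f.
Proof.
move=> [mf fi]; apply: (intg_le mf _ (fi 1%N)) => w; by rewrite expr1.
Qed.

Lemma allmom_sqint f : allmom f -> sqint f.
Proof. by move=> fi; split; [exact: fi.1|apply: allmom_intg; exact: allmomX]. Qed.

Lemma allmom_horner f (p : {poly R}) : allmom f -> allmom (fun w => p.[f w]).
Proof.
move=> fi; under eq_fun do rewrite horner_coef.
by apply: allmom_sum => i; apply: allmomM; [exact: allmom_cst|exact: allmomX].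
Qed.

End Expectation.

(** * Laws, linearity and integration by parts for an isonormal process *)

Section Isonormal.
Context {R : realType} {H : hilbertType R}.
Context d {Omega : measurableType d} (P : probability Omega R).

Lemma has_law_ex (X : {RV P >-> R}) (mu : probability (measurableTypeR R) R) (f : R -> R) :
  has_law X mu -> measurable_fun setT f -> mu.-integrable setT (EFin \o f) ->
  intg P (fun w => f (X w)) /\ ex P (fun w => f (X w)) = \int[mu]_x f x.
Proof.
move=> XL mf fi.
have mX : measurable_fun setT (X : Omega -> measurableTypeR R) := measurable_funP X.
(* The same function, retyped with target [measurableTypeR R], on which mu lives. *)
pose X' : {mfun Omega >-> measurableTypeR R} :=
  HB.pack (X : Omega -> measurableTypeR R) (isMeasurableFun.Build _ _ _ _ _ mX).
have XLe : forall A : set (measurableTypeR R), measurable A -> A `<=` setT ->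
    mu A = distribution P X' A.
  by move=> A mA _; rewrite -[RHS]/(distribution P X A) XL.
have mfX : measurable_fun setT (fun w => f (X w)) by exact: measurableT_comp.
have fXi : intg P (fun w => f (X w)).
  apply/integrableP; split; first exact/measurable_EFinP.
  have /integrableP[_] := fi; rewrite (eq_measure_integral (distribution P X') XLe).
  rewrite ge0_integral_distribution//.
  by apply: measurableT_comp => //; exact/measurable_EFinP.
split=> //; rewrite /ex /Rintegral; congr fine.
rewrite (eq_measure_integral (distribution P X') XLe) integral_distribution//.
exact/measurable_EFinP.
Qed.

Let dirac0 : probability (measurableTypeR R) R := dirac (0 : measurableTypeR R).

Variable W : H -> {RV P >-> R}.
Hypothesis isoW : isonormal W.

Lemma isonormal_gaussian h : centered_gaussian (W h).
Proof.
have [+ _] := isoW => /(_ 1%N (fun=> 1) (fun=> h)).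
by rewrite big_ord_recl big_ord0 addr0 scale1r.
Qed.

(** [centered_gaussian] leaves the variance open. Comparing the second moment of each candidate law
    with E[(W h)^2] = |h|^2 fixes s = |h|, and forces |h| = 0 in the Dirac case. *)
Lemma isonormal_law h : (`|h| = 0 /\ has_law (W h) \d_(0 : R)) \/
  (`|h| != 0 /\ has_law (W h) (normal_prob 0 `|h|)).
Proof.
have [_ /(_ h h)] := isoW; rewrite inner_norm => Ehh.
have ae0 : forall mu : probability (measurableTypeR R) R, has_law (W h) mu ->
    mu.-integrable setT (EFin \o (fun x : R => x ^+ 2)) ->
    \int[mu]_x (x ^+ 2) = `|h| ^+ 2.
  move=> mu L i2; have [i e] := has_law_ex L (exprn_measurable 2) i2.
  rewrite -e; apply: EFin_inj; rewrite -Ehh -exE//.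
have [L|[s s0 L]] := isonormal_gaussian h; [left|right].
- split=> //; have i2 : dirac0.-integrable setT (EFin \o (fun x : R => x ^+ 2)).
    apply/integrableP; split; first by apply/measurable_EFinP; exact: exprn_measurable.
    rewrite integral_dirac//; last first.
      by apply: measurableT_comp => //; apply/measurable_EFinP; exact: exprn_measurable.
    by rewrite diracE mem_set//= mul1e ltry.
  have := ae0 dirac0 L i2.
  rewrite /Rintegral integral_dirac//; last by apply/measurable_EFinP; exact: exprn_measurable.
  rewrite diracE mem_set//= mul1r expr0n/= => /esym/eqP.
  by rewrite sqrf_eq0 => /eqP.
- have i2 := normal_moment_integrable 2 (lt0r_neq0 s0).
  have := ae0 (normal_prob 0 s) L i2.
  rewrite (normal_moment_rec 0 (lt0r_neq0 s0)) mul1r.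
  have -> : \int[normal_prob 0 s]_x (x ^+ 0) = 1.
    exact: (ex_cst (normal_prob 0 s) 1).
  rewrite mulr1 => /esym/eqP.
  rewrite (@eqrXn2 _ 2 `|h| s isT (normr_ge0 h) (ltW s0)) => /eqP ->.
  by rewrite gt_eqF.
Qed.

Lemma isonormal_norm0 h : `|h| = 0 -> forall f : R -> R, measurable_fun setT f ->
  intg P (fun w => f (W h w)) /\ ex P (fun w => f (W h w)) = f 0.
Proof.
move=> h0 f mf; have [[_ L]|[]] := isonormal_law h; last by rewrite h0 eqxx.
have i2 : dirac0.-integrable setT (EFin \o f).
  apply/integrableP; split; first exact/measurable_EFinP.
  rewrite integral_dirac//; last by apply: measurableT_comp => //; exact/measurable_EFinP.
  by rewrite diracE mem_set//= mul1e ltry.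
have [i ->] := @has_law_ex (W h) dirac0 f L mf i2; split=> //.
rewrite /Rintegral integral_dirac//; last exact/measurable_EFinP.
by rewrite diracE mem_set//= mul1r.
Qed.

Lemma allmom_W h : allmom P (W h).
Proof.
split=> // k; have mk : measurable_fun setT (fun x : R => `|x| ^+ k).
  exact: measurable_funX.
have [[h0 _]|[h0 L]] := isonormal_law h.
  exact: (isonormal_norm0 h0 mk).1.
have i : (normal_prob 0 `|h|).-integrable setT (EFin \o (fun x : R => `|x| ^+ k)).
  have := integrable_norm (normal_moment_integrable k h0).
  by apply: eq_integrable => // x _ /=; rewrite normrX.
exact: (has_law_ex L mk i).1.
Qed.

Lemma ex_W_moment h k :
  ex P (fun w => W h w ^+ k.+2) = k.+1%:R * `|h| ^+ 2 * ex P (fun w => W h w ^+ k).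
Proof.
have [[h0 _]|[h0 L]] := isonormal_law h.
  rewrite (isonormal_norm0 h0 (exprn_measurable k.+2)).2 h0.
  by rewrite !expr0n /= mulr0 mul0r.
have i1 := normal_moment_integrable k.+2 h0; have i2 := normal_moment_integrable k h0.
rewrite (has_law_ex L (exprn_measurable _) i1).2 (has_law_ex L (exprn_measurable _) i2).2.
exact: normal_moment_rec.
Qed.

Lemma ex_W h : ex P (W h) = 0.
Proof.
have [[h0 _]|[h0 L]] := isonormal_law h.
  exact: (isonormal_norm0 h0 (@measurable_id _ _ setT)).2.
have i : (normal_prob 0 `|h|).-integrable setT (EFin \o (fun x : R => x)).
  by have := normal_moment_integrable 1 h0; apply: eq_integrable.
rewrite (has_law_ex L (@measurable_id _ _ setT) i).2.
exact: normal_mean.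
Qed.

Lemma ex_W_moment_norm g h k : `|g| = `|h| ->
  ex P (fun w => W g w ^+ k) = ex P (fun w => W h w ^+ k).
Proof.
move=> gh; elim/ltn_ind: k => -[_|[_|k IH]].
- by [].
- exact: etrans (ex_W g) (esym (ex_W h)).
- by rewrite !ex_W_moment gh IH.
Qed.

Lemma measurable_cosD (a : R) : measurable_fun setT (fun x : R => cos (x + a)).
Proof.
apply: continuous_measurable_fun => x.
apply: (@continuous_comp _ _ _ (fun x => x + a) cos); last exact: continuous_cos.
by apply: (@cvgD _ R^o); [exact: cvg_id|exact: cvg_cst].
Qed.

Lemma ex_cosW h a : ex P (fun w => cos (W h w + a)) = expR (- (`|h| ^+ 2 / 2)) * cos a.
Proof.
have mc := measurable_cosD a.
have [[h0 _]|[h0 L]] := isonormal_law h.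
  by rewrite (isonormal_norm0 h0 mc).2 h0 expr0n/= mul0r oppr0 expR0 mul1r add0r.
have i : (normal_prob 0 `|h|).-integrable setT (EFin \o (fun x : R => cos (x + a))).
  apply: (@integrable_normal_exp_growth _ _ 1 0) => // x.
  by rewrite mul0r expR0 mulr1 ler_norml cos_geN1 cos_le1.
rewrite (has_law_ex L mc i).2.
have := normal_cos 1 a h0; rewrite expr1n mul1r => <-.
by apply: eq_Rintegral => x _; rewrite mul1r.
Qed.

Lemma sqint_W h : sqint P (W h).
Proof. exact/allmom_sqint/allmom_W. Qed.

Lemma ex_WW g h : ex P (fun w => W g w * W h w) = inner g h.
Proof.
apply: EFin_inj; have [_ <-] := isoW; rewrite -exE//.
exact: sqintM (sqint_W g) (sqint_W h).
Qed.

(** The covariances alone force it: expanding the square shows that the defect of linearity has zero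
    second moment. *)
Lemma W_lin a g h : {ae P, forall w, W (a *: g + h) w = a * W g w + W h w}.
Proof.
have iV : sqint P (fun w => W (a *: g + h) w - (a * W g w + W h w)).
  by apply: sqintB; [exact: sqint_W|apply: sqint_lin; exact: sqint_W].
suff : {ae P, forall w, W (a *: g + h) w - (a * W g w + W h w) = 0}.
  by apply: filterS => w /eqP; rewrite subr_eq0 => /eqP.
apply: (ex_sqr_eq0 iV).
set v := a *: g + h.
have -> : (fun w => (W v w - (a * W g w + W h w)) ^+ 2) =
  (fun w => (W v w * W v w + (- (2 * a)) * (W v w * W g w)) + ((- 2) * (W v w * W h w)
     + (a ^+ 2 * (W g w * W g w) + ((2 * a) * (W g w * W h w) + W h w * W h w)))).
  by apply/funext => w; ring.
have i x y := sqintM (sqint_W x) (sqint_W y).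
have j c x y := intgZ c (i x y).
rewrite !exD; do ?[by apply: i | by apply: j | apply: intgD].
rewrite !exZ; do ?[by apply: i].
rewrite !ex_WW /v !(inner_linl, innerDr, innerZr) (innerC h g); ring.
Qed.

Lemma W_sum (I : Type) (r : seq I) (c : I -> R) (e : I -> H) :
  {ae P, forall w, W (\sum_(i <- r) c i *: e i) w = \sum_(i <- r) c i * W (e i) w}.
Proof.
elim: r => [|i r IH].
  rewrite big_nil; apply: filterS (W_lin (-1) 0 0) => w.
  by rewrite scaler0 addr0 big_nil => ->; rewrite mulN1r addNr.
rewrite big_cons.
have h := W_lin (c i) (e i) (\sum_(j <- r) c j *: e j).
by apply: (filterS2 _ _ h IH) => w -> ->; rewrite big_cons.
Qed.

(* The law of W (g + s v) depends only on its norm, hence is even in s. *)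
Lemma ex_W_orth v g m : inner v g = 0 -> ex P (fun w => W v w * W g w ^+ m) = 0.
Proof.
move=> vg.
pose c k := 'C(m.+1, k)%:R * ex P (fun w => W g w ^+ (m.+1 - k) * W v w ^+ k).
have iM k : intg P (fun w => W g w ^+ (m.+1 - k) * W v w ^+ k).
  by apply: allmom_intg; apply: allmomM; apply: allmomX; exact: allmom_W.
have expand s : ex P (fun w => W (s *: v + g) w ^+ m.+1) = \sum_(k < m.+2) c k * s ^+ k.
  rewrite (@ex_ae _ _ _ P _ (fun w => \sum_(k < m.+2)
      ('C(m.+1, k)%:R * s ^+ k) * (W g w ^+ (m.+1 - k) * W v w ^+ k))).
  - rewrite ex_sum; last by move=> k; exact: intgZ.
    by apply: eq_bigr => k _; rewrite exZ// /c mulrAC.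
  - exact: measurable_funX.
  - by apply: intg_meas; apply: intg_sum => k; exact: intgZ.
  apply: filterS (W_lin s v g) => w ->; rewrite addrC exprDn; apply: eq_bigr => k _.
  by rewrite exprMn -mulr_natl; ring.
have even s : \sum_(k < m.+2) c k * s ^+ k = \sum_(k < m.+2) c k * (- s) ^+ k.
  rewrite -!expand; apply: ex_W_moment_norm.
  apply/eqP; rewrite -(@eqrXn2 _ 2)//; apply/eqP.
  by rewrite !sqr_normD !normrZ normrN !innerZl vg !mulr0.
(* Evenness as a polynomial identity: [q] has degree below m + 2 and vanishes at 0, ..., m + 1, so
   it is zero; its coefficient of degree 1 is 2 (m + 1) E[W v (W g)^m]. *)
pose q : {poly R} := \poly_(k < m.+2) (c k * (1 - (-1) ^+ k)).
have q0 : q = 0.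
  apply: (@roots_geq_poly_eq0 _ _ [seq i%:R | i <- iota 0 m.+2]).
  - apply/allP => x _; rewrite /root horner_poly; apply/eqP.
    rewrite -[RHS](subrr (\sum_(k < m.+2) c k * x ^+ k)) {2}even -sumrB.
    apply: eq_bigr => k _.
    by rewrite (_ : (- x) ^+ k = (-1) ^+ k * x ^+ k); [ring|rewrite -exprMn mulN1r].
  - by rewrite map_inj_uniq ?iota_uniq//; exact: (mulrIn (oner_neq0 _)).
  - by rewrite size_map size_iota size_poly.
have /eqP := congr1 (fun p : {poly R} => p`_1) q0.
rewrite coef_poly coef0 /= expr1 opprK mulf_eq0 (_ : (1 + 1 : R) == 0 = false) ?orbF; last first.
  by apply/negbTE; rewrite -[1 + 1]/(2%:R) pnatr_eq0.
rewrite /c bin1 mulf_eq0 pnatr_eq0/= subn1 /= => /eqP.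
by under eq_fun do rewrite expr1 mulrC.
Qed.

(** v splits into a multiple of g, settled by the moment recursion [ex_W_moment], and a vector
    orthogonal to g, settled by [ex_W_orth]. *)
Lemma ex_W_ibp v g m : ex P (fun w => W v w * W g w ^+ m) =
  m%:R * inner v g * ex P (fun w => W g w ^+ m.-1).
Proof.
have [g0|g0] := eqVneq g 0.
  case: m => [|m].
    by rewrite !mul0r; under eq_fun do rewrite expr0 mulr1; exact: ex_W.
  rewrite g0 inner0r mulr0 mul0r; apply: ex_W_orth; exact: inner0r.
pose a := inner v g / `|g| ^+ 2.
have gn : `|g| ^+ 2 != 0 by rewrite expf_neq0// normr_eq0.
pose u := v - a *: g.
have ug : inner u g = 0 by rewrite innerBl innerZl inner_norm /a divfK// subrr.
have vE : v = a *: g + u by rewrite addrC subrK.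
have iM x k : intg P (fun w => W x w * W g w ^+ k).
  by apply: allmom_intg; apply: allmomM; [|apply: allmomX]; exact: allmom_W.
rewrite (@ex_ae _ _ _ P _ (fun w => a * (W g w * W g w ^+ m) + W u w * W g w ^+ m)).
- rewrite exD ?exZ//; last exact: intgZ.
  rewrite (ex_W_orth m ug) addr0; under eq_fun do rewrite -exprS.
  case: m => [|m].
    by under eq_fun do rewrite expr1; rewrite ex_W !mul0r mulr0.
  have -> : inner v g = a * `|g| ^+ 2 by rewrite /a divfK.
  by rewrite ex_W_moment /=; ring.
- exact: intg_meas.
- by apply: intg_meas; apply: intgD => //; exact: intgZ.
- by apply: filterS (W_lin a g u) => w; rewrite -vE => ->; rewrite mulrDl mulrA.
Qed.

End Isonormal.

(** * Hermite sums in an isonormal process *)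

Section Polynomials.
Context {R : realType} {H : hilbertType R}.
Context d {Omega : measurableType d} (P : probability Omega R).
Variable W : H -> {RV P >-> R}.
Hypothesis isoW : isonormal W.
Variables (n : nat) (e : 'I_n -> H).
Hypothesis e_on : forall i j, inner (e i) (e j) = (i == j)%:R.

Local Notation Xi := (fun i : 'I_n => mpolyX R (mnm1 i)).

Definition coords (w : Omega) (i : 'I_n) : R := W (e i) w.
Definition pex (Q : mpoly n R) : R := ex P (fun w => meval (coords w) Q).

Lemma allmom_meval Q : allmom P (fun w => meval (coords w) Q).
Proof.
under eq_fun do rewrite mevalE.
apply: allmom_sum => m; apply: allmomM; first exact: allmom_cst.
by apply: allmom_prod => i; apply: allmomX; exact: allmom_W.
Qed.

Lemma pex_lin a Q S : pex (a *: Q + S) = a * pex Q + pex S.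
Proof.
have iQ := allmom_intg (allmom_meval Q); have iS := allmom_intg (allmom_meval S).
rewrite /pex -exZ// -exD//; last exact: intgZ.
by congr ex; apply/funext => w; rewrite mevalD mevalZ.
Qed.

Lemma pex_pos Q : (forall v, 0 <= meval v Q) -> 0 <= pex Q.
Proof. by move=> Q0; apply: ex_ge0 => w; exact: Q0. Qed.

Lemma pex_one : pex 1 = 1.
Proof. by rewrite -[RHS](ex_cst P); congr ex; apply/funext => w; rewrite meval1. Qed.

Lemma W_coords (t : 'I_n -> R) :
  {ae P, forall w, W (\sum_i t i *: e i) w = \sum_i t i * coords w i}.
Proof. exact: W_sum. Qed.

Lemma pex_at_form t p : pex (at_form t p) = ex P (fun w => p.[W (\sum_i t i *: e i) w]).
Proof.
apply: ex_ae.
- exact/intg_meas/allmom_intg/allmom_meval.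
- by apply/intg_meas/allmom_intg/allmom_horner; exact: allmom_W.
- by apply: filterS (W_coords t) => w ->; rewrite meval_at_form.
Qed.

(** The failure of integration by parts. Being linear in Q, it vanishes everywhere once it does on
    monomials; on powers of linear forms this is [ex_W_ibp]. *)
Let defect i Q := pex (Xi i * Q) - pex (mderiv i Q).

Let defect_lin i a Q S : defect i (a *: Q + S) = a * defect i Q + defect i S.
Proof. by rewrite /defect mulrDr -scalerAr mderivD mderivZ !pex_lin; ring. Qed.

Let defect0 i : defect i 0 = 0.
Proof. by have := defect_lin i (-1) 0 0; rewrite scaler0 addr0 mulN1r addNr. Qed.

Let defect_power i t m : defect i (at_form t 'X^m) = 0.
Proof.
apply/eqP; rewrite subr_eq0; apply/eqP.
have -> : pex (mderiv i (at_form t 'X^m)) =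
    m%:R * t i * ex P (fun w => W (\sum_i t i *: e i) w ^+ m.-1).
  have := pex_at_form t 'X^(m.-1); under eq_fun do rewrite hornerXn.
  move=> <-; rewrite mderiv_at_form derivXn -[_ *+ m]scaler_nat at_formZ scalerA.
  by rewrite (E_Z pex_lin) [t i * _]mulrC.
have ei : inner (e i) (\sum_i t i *: e i) = t i.
  rewrite inner_sumr (bigD1 i)//= innerZr e_on eqxx mulr1 big1 ?addr0// => j /negPf ji.
  by rewrite innerZr e_on eq_sym ji mulr0.
rewrite -{1}ei -(ex_W_ibp isoW); apply: ex_ae.
- exact/intg_meas/allmom_intg/allmom_meval.
- by apply/intg_meas/allmom_intg/allmomM; [|apply: allmomX]; exact: allmom_W.
- apply: filterS (W_coords t) => w ->.
  by rewrite mevalM mevalXU meval_at_form hornerXn.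
Qed.

Let is_prod (Q : mpoly n R) := exists k (f : 'I_k -> 'I_n), Q = \prod_(j < k) Xi (f j).

Lemma is_prod_mpolyX m : is_prod (mpolyX R m).
Proof.
have is_prodM i k Q : is_prod Q -> is_prod (Xi i ^+ k * Q).
  move=> QP; elim: k => [|k [l [f fE]]]; first by rewrite expr0 mul1r.
  exists l.+1, (fun j => if unlift ord0 j is Some j' then f j' else i).
  rewrite exprS -mulrA fE big_ord_recl unlift_none; congr (_ * _).
  by apply: eq_bigr => j _; rewrite liftK.
rewrite mpolyXE_id; apply: (big_rec is_prod) => [|i Q _]; last exact: is_prodM.
have f0 : 'I_0 -> 'I_n by case.
by exists 0%N, f0; rewrite big_ord0.
Qed.

(* Polarization: monomials are combinations of powers of linear forms. *)
Let defect_prod i Q : is_prod Q -> defect i Q = 0.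
Proof.
move=> [k [f ->]].
have := polarization (fun phi : {ffun 'I_k -> 'I_k} => \prod_(j < k) Xi (f (phi j))).
set S := \sum_(b : _) _ => SE.
(* f may repeat a variable, so the coefficient of X_l gathers the signs of all j with f j = l. *)
pose t (b : {ffun 'I_k -> bool}) (l : 'I_n) : R := \sum_(j < k | f j == l) sgb R (b j).
have {}SE : S = \sum_(b : {ffun 'I_k -> bool}) (\prod_i sgb R (b i)) *: at_form (t b) 'X^k.
  rewrite /S; apply: eq_bigr => b _; congr (_ *: _).
  have -> : at_form (t b) 'X^k = \prod_(l < k) \sum_j sgb R (b j) *: Xi (f j).
    rewrite prodr_const card_ord /at_form rmorphXn /= map_polyX hornerXn; congr (_ ^+ _).
    rewrite /linear_form [RHS](partition_big f predT)//=; apply: eq_bigr => l _.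
    by rewrite /t scaler_suml; apply: eq_bigr => j /eqP ->.
  rewrite bigA_distr_bigA /=; apply: eq_bigr => phi _.
  by rewrite scaler_prod.
have S0 : defect i S = 0.
  rewrite SE; apply: (big_rec (fun Q' => defect i Q' = 0)); first exact: defect0.
  by move=> b Q' _ Q0; rewrite defect_lin defect_power Q0 mulr0 addr0.
move: (polarization (fun phi : {ffun 'I_k -> 'I_k} => \prod_(j < k) Xi (f (phi j)))).
rewrite -/S => SE2.
pose N : R := (2 ^ k)%:R * #|{perm 'I_k}|%:R.
have N0 : N != 0.
  rewrite mulf_neq0// pnatr_eq0 -lt0n ?expn_gt0//.
  by apply/card_gt0P; exists 1%g.
have SN : S = N *: \prod_(j < k) Xi (f j).
  rewrite SE2 /N -scalerA; congr (_ *: _).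
  rewrite scaler_nat -sumr_const; apply: eq_bigr => s _.
  rewrite [RHS](reindex_inj (@perm_inj _ s)); apply: eq_bigr => j _.
  by rewrite ffunE.
have -> : \prod_(j < k) Xi (f j) = N^-1 *: S + 0.
  by rewrite SN scalerA mulVf// scale1r addr0.
by rewrite defect_lin S0 defect0 mulr0 addr0.
Qed.

Lemma pex_ibp i Q : pex (Xi i * Q) = pex (mderiv i Q).
Proof.
apply/eqP; rewrite -subr_eq0 -/(defect i Q); apply/eqP.
elim/mpolyind: Q => [|c m Q _ _ IH]; first exact: defect0.
by rewrite defect_lin IH defect_prod ?mulr0 ?addr0//; exact: is_prod_mpolyX.
Qed.

End Polynomials.

Lemma ae_seq d (Omega : measurableType d) (R : realType) (P : {measure set Omega -> \bar R})
    (I : eqType) (s : seq I) (Q : I -> Omega -> Prop) :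
  (forall i, i \in s -> {ae P, forall w, Q i w}) -> {ae P, forall w, {in s, forall i, Q i w}}.
Proof.
elim: s => [|i s IH] h; first by apply: aeW => w i.
have h1 := h i (mem_head _ _).
have h2 : {ae P, forall w, {in s, forall j, Q j w}}.
  by apply: IH => j js; apply: h; rewrite inE js orbT.
by apply: (filterS2 _ _ h1 h2) => w Qi Qs j; rewrite inE => /predU1P[->//|/Qs].
Qed.

Section ChaosVariables.
Context {R : realType} {H : hilbertType R}.
Context d {Omega : measurableType d} (P : probability Omega R).
Variable W : H -> {RV P >-> R}.

Definition chaos_var p (s : seq (R * H)) (w : Omega) : R :=
  \sum_(x <- s) x.1 * (hermite R p).[W x.2 w].

Hypothesis isoW : isonormal W.

Lemma allmom_chaos_var p s : allmom P (chaos_var p s).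
Proof.
apply: allmom_sum => x; apply: allmomZ; apply: allmom_horner; exact: allmom_W.
Qed.

(** The bridge from [mpoly] to random variables. Orthonormalizing h together with the vectors of s
    makes D_h the derivative [dirD] along the coordinates of h; the last clause is He_p' = p
    He_(p-1) with the chain-rule factor <x, h>. *)
Let polynomial_model p (s : seq (R * H)) (h : H) : unit_comb s -> `|h| = 1 ->
  exists (n : nat) (e : 'I_n -> H) (t : 'I_n -> R) (Q : mpoly n R),
  [/\ forall i j, inner (e i) (e j) = (i == j)%:R,
      \sum_i t i * t i = 1,
      in_chaos p Q,
      {ae P, forall w, meval (coords W e w) Q = chaos_var p s w} &
      {ae P, forall w, meval (coords W e w) (dirD t Q) =
        p%:R * chaos_var p.-1 [seq (x.1 * inner x.2 h, x.2) | x <- s] w}].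
Proof.
move=> us h1.
have [n [e [e_on he]]] := orthonormal_coordinates (h :: [seq x.2 | x <- s]).
have /choice[t tE] : forall x, exists t : 'I_n -> R,
    x \in h :: [seq x.2 | x <- s] -> x = \sum_i t i *: e i.
  move=> x; have [/he[t xE]|xh] := boolP (x \in h :: [seq x.2 | x <- s]).
    by exists t.
  by exists (fun=> 0).
have hE := tE h (mem_head _ _).
have sE x : x \in s -> x.2 = \sum_i t x.2 i *: e i.
  by move=> xs; apply: tE; rewrite inE map_f ?orbT.
have inn (u v : 'I_n -> R) : inner (\sum_i u i *: e i) (\sum_i v i *: e i) = \sum_i u i * v i.
  rewrite inner_suml; apply: eq_bigr => i _; rewrite innerZl inner_sumr; congr (_ * _).
  rewrite (bigD1 i)//= innerZr e_on eqxx mulr1 big1 ?addr0// => j /negPf ij.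
  by rewrite innerZr e_on eq_sym ij mulr0.
have tu x : x = \sum_i t x i *: e i -> `|x| = 1 -> \sum_i t x i * t x i = 1.
  by move=> xE x1; rewrite -inn -xE inner_norm x1 expr1n.
pose Q : mpoly n R := \sum_(x <- s) x.1 *: at_form (t x.2) (hermite R p).
exists n, e, (t h), Q; split=> //.
- exact: tu.
- rewrite /Q big_seq; apply: (big_rec (in_chaos p)); first exact: in_chaos0.
  move=> x S xs cS; apply: in_chaos_lin => //; apply: hermite_in_chaos.
  by apply: tu; [exact: sE|exact: us].
- have aes : {ae P, forall w, {in s, forall x, W x.2 w = \sum_i t x.2 i * coords W e w i}}.
    by apply: ae_seq => x xs; apply: filterS (W_coords isoW e (t x.2)) => w; rewrite -sE.
  apply: filterS aes => w ws; rewrite /Q raddf_sum /chaos_var big_seq [RHS]big_seq.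
  by apply: eq_bigr => x xs /=; rewrite mevalZ meval_at_form ws.
- have aes : {ae P, forall w, {in s, forall x, W x.2 w = \sum_i t x.2 i * coords W e w i}}.
    by apply: ae_seq => x xs; apply: filterS (W_coords isoW e (t x.2)) => w; rewrite -sE.
  apply: filterS aes => w ws.
  have -> : dirD (t h) Q = \sum_(x <- s) (x.1 * (\sum_i t h i * t x.2 i)) *: at_form (t x.2) (hermite R p)^`().
    rewrite /dirD /Q.
    under eq_bigr do rewrite (big_morph _ (mderivD _) (mderiv0 _ _)) scaler_sumr.
    rewrite exchange_big /=; apply: eq_bigr => x _.
    under eq_bigr do rewrite mderivZ mderiv_at_form !scalerA.
    rewrite -scaler_suml mulr_sumr; congr (_ *: _).
    by apply: eq_bigr => i _; ring.
  rewrite raddf_sum /chaos_var big_map mulr_sumr big_seq [RHS]big_seq.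
  apply: eq_bigr => x xs /=; rewrite mevalZ meval_at_form -ws// -inn -hE -sE// innerC.
  case: p {Q} => [|p].
    by rewrite derivC horner0 mulr0 mul0r.
  by rewrite deriv_hermite hornerZ /=; ring.
Qed.

Lemma chaos_var_moment8 p s : unit_comb s ->
  ex P (fun w => chaos_var p s w ^+ 8) <= 7 ^+ (4 * p) * ex P (fun w => chaos_var p s w ^+ 2) ^+ 4.
Proof.
(* The unit vector that [polynomial_model] asks for is taken from the list, so the empty list is
   treated apart. *)
case: s => [|x0 s] us.
  rewrite /chaos_var; under eq_fun do rewrite big_nil expr0n; rewrite ex_cst.
  by rewrite mulr_ge0 ?exprn_ge0 ?ex_ge0// => w; exact: sqr_ge0.
have [n [e [t [Q [e_on tu cQ QX _]]]]] := polynomial_model p us (us x0 (mem_head _ _)).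
have QXk k : pex W e (Q ^+ k) = ex P (fun w => chaos_var p (x0 :: s) w ^+ k).
  apply: ex_ae.
  - exact/intg_meas/allmom_intg/allmom_meval.
  - by apply/intg_meas/allmom_intg/allmomX; exact: allmom_chaos_var.
  - by apply: filterS QX => w <-; rewrite rmorphXn.
rewrite -!QXk; apply: (@chaos_moment8 R n (pex W e)) => //.
- exact: pex_lin.
- exact: pex_pos.
- exact: pex_one.
- exact: pex_ibp.
Qed.

Lemma chaos_var_fourth p s h : unit_comb s -> `|h| = 1 ->
  6 * p.+1%:R * (p.+2%:R ^+ 2 *
    ex P (fun w => chaos_var p.+1 [seq (x.1 * inner x.2 h, x.2) | x <- s] w ^+ 2)) ^+ 2
  <= p.+2%:R * (ex P (fun w => chaos_var p.+2 s w ^+ 4)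
       - 3 * ex P (fun w => chaos_var p.+2 s w ^+ 2) ^+ 2).
Proof.
move=> us h1.
have [n [e [t [Q [e_on tu cQ QX DX]]]]] := polynomial_model p.+2 us h1.
have QXk k : pex W e (Q ^+ k) = ex P (fun w => chaos_var p.+2 s w ^+ k).
  apply: ex_ae.
  - exact/intg_meas/allmom_intg/allmom_meval.
  - by apply/intg_meas/allmom_intg/allmomX; exact: allmom_chaos_var.
  - by apply: filterS QX => w <-; rewrite rmorphXn.
have := @fourth_moment_bound R n (pex W e).
move=> /(_ (pex_lin isoW e) (pex_pos W e) (pex_one W e) (pex_ibp isoW e_on) _ tu _ _ cQ).
rewrite !QXk; congr (_ * _ ^+ 2 <= _).
have iD : allmom P (chaos_var p.+1 [seq (x.1 * inner x.2 h, x.2) | x <- s]).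
  exact: allmom_chaos_var.
rewrite -exZ; last exact/allmom_intg/allmomX.
apply: ex_ae.
- exact/intg_meas/allmom_intg/allmom_meval.
- exact/intg_meas/allmom_intg/(allmomZ _ (allmomX 2 iD)).
- by apply: filterS DX => w; rewrite mevalM => ->; rewrite /=; ring.
Qed.

End ChaosVariables.

(** * Trigonometric approximation *)

Section Trig.
Context {R : realType} {H : hilbertType R}.
Context d {Omega : measurableType d} (P : probability Omega R).
Variable W : H -> {RV P >-> R}.
Hypothesis isoW : isonormal W.

Definition cosW (h : H) (a : R) (w : Omega) : R := cos (W h w + a).

(** An entry is a coefficient, a phase and a vector. Phases turn sines into cosines, and the vector
    0 yields constants, since W 0 = 0 almost surely. *)
Definition trig (s : seq (R * R * H)) (w : Omega) : R :=
  \sum_(x <- s) x.1.1 * cosW x.2 x.1.2 w.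

Lemma measurable_cosW h a : measurable_fun setT (cosW h a).
Proof. exact: (measurableT_comp (measurable_cosD a)). Qed.

Lemma cosW_le1 h a w : `|cosW h a w| <= 1.
Proof. by rewrite ler_norml cos_geN1 cos_le1. Qed.

Lemma sqint_cosW h a : sqint P (cosW h a).
Proof. by apply: (@sqint_bnd _ _ _ _ _ 1); [exact: measurable_cosW|exact: cosW_le1]. Qed.

Lemma sqint_trig s : sqint P (trig s).
Proof.
rewrite /trig; elim: s => [|x s IH].
  by under eq_fun do rewrite big_nil; exact: sqint_cst.
by under eq_fun do rewrite big_cons; apply: sqint_lin => //; exact: sqint_cosW.
Qed.

Lemma trig_bounded s : exists M, forall w, `|trig s w| <= M.
Proof.
exists (\sum_(x <- s) `|x.1.1|) => w; apply: le_trans (ler_norm_sum _ _ _) _.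
by apply: ler_sum => x _; rewrite normrM ler_piMr// cosW_le1.
Qed.

Lemma cosWM g h a b : {ae P, forall w, cosW g a w * cosW h b w =
  2^-1 * cosW (g + h) (a + b) w + 2^-1 * cosW (g - h) (a - b) w}.
Proof.
have h1 := W_lin isoW 1 g h; have h2 := W_lin isoW (-1) h g.
apply: (filterS2 _ _ h1 h2) => w; rewrite scale1r scaleN1r [- h + g]addrC /cosW => -> ->.
have -> : 1 * W g w + W h w + (a + b) = (W g w + a) + (W h w + b) by ring.
have -> : -1 * W h w + W g w + (a - b) = (W g w + a) - (W h w + b) by ring.
set u := W g w + a; set v := W h w + b.
by rewrite cosD cosB; field.
Qed.

(** For orthogonal g and h both g + h and g - h have squared norm |g|^2 + |h|^2, so the two terms of
    [cosWM] share one Gaussian factor and cos (a + b) + cos (a - b) = 2 cos a cos b. This plays the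
    role of the independence of W g and W h. *)
Lemma ex_cosW_orth g h a b : inner g h = 0 ->
  ex P (fun w => cosW g a w * cosW h b w) = ex P (cosW g a) * ex P (cosW h b).
Proof.
move=> gh.
have i g' a' : intg P (cosW g' a') by exact/sqint_intg/sqint_cosW.
rewrite (ex_ae _ _ (cosWM g h a b)); first last.
- by apply: intg_meas; apply: intgD; exact: intgZ.
- by apply: measurable_funM; exact: measurable_cosW.
rewrite exD; [|exact: intgZ|exact: intgZ].
rewrite !exZ// !(ex_cosW isoW) sqr_normD sqr_normB gh !mulr0 addr0 subr0.
rewrite cosD cosB.
have -> : expR (- ((`|g| ^+ 2 + `|h| ^+ 2) / 2)) =
    expR (- (`|g| ^+ 2 / 2)) * expR (- (`|h| ^+ 2 / 2)).
  by rewrite -expRD; congr expR; field.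
by field.
Qed.

Variable K : H -> Prop.
Hypothesis K_lin : forall a x y, K x -> K y -> K (a *: x + y).
Hypothesis K_0 : K 0.

(** [K] stands for a subspace of [H]: the orthogonal of a vector for exact decorrelation, all of [H]
    for approximation. *)
Definition trigK (s : seq (R * R * H)) := forall x, x \in s -> K x.2.

(** Uniform approximation of bounded functions, unlike L^2 approximation, is stable under products,
    so a Stone-Weierstrass argument can run here. It holds almost everywhere because W is linear
    only almost surely. *)
Definition uclosure (f : Omega -> R) := measurable_fun setT f /\
  (exists M, forall w, `|f w| <= M) /\
  forall eps : R, 0 < eps ->
    exists2 s, trigK s & {ae P, forall w, `|f w - trig s w| <= eps}.

Lemma trigK_lin a s t : trigK s -> trigK t ->
  exists2 u, trigK u & forall w, trig u w = a * trig s w + trig t w.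
Proof.
move=> Ks Kt; exists ([seq (a * x.1.1, x.1.2, x.2) | x <- s] ++ t).
  by move=> x; rewrite mem_cat => /orP[/mapP[y ys ->]|/Kt//]; exact: (Ks y ys).
move=> w; rewrite /trig big_cat big_map /= mulr_sumr; congr (_ + _).
by apply: eq_bigr => x _; rewrite mulrA.
Qed.

Lemma trigKM s t : trigK s -> trigK t ->
  exists2 u, trigK u & {ae P, forall w, trig u w = trig s w * trig t w}.
Proof.
move=> Ks Kt.
have one x : K x.2 -> exists2 u, trigK u &
    {ae P, forall w, trig u w = x.1.1 * cosW x.2 x.1.2 w * trig t w}.
  move=> Kx; elim: t Kt => [|y t IH] Kt.
    exists [::] => //; apply: aeW => w; by rewrite /trig !big_nil mulr0.
  have Ky := Kt y (mem_head _ _).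
  have [|u Ku uE] := IH; first by move=> z zt; apply: Kt; rewrite inE zt orbT.
  exists [:: (x.1.1 * y.1.1 / 2, x.1.2 + y.1.2, x.2 + y.2),
             (x.1.1 * y.1.1 / 2, x.1.2 - y.1.2, x.2 - y.2) & u].
    move=> z; rewrite !inE => /predU1P[->|/predU1P[->|/Ku//]] /=.
      by rewrite -[x.2]scale1r; exact: K_lin.
    by rewrite addrC -scaleN1r; exact: K_lin.
  apply: (filterS2 _ _ uE (cosWM x.2 y.2 x.1.2 y.1.2)) => w uw cw.
  have -> : trig (y :: t) w = y.1.1 * cosW y.2 y.1.2 w + trig t w by rewrite /trig big_cons.
  rewrite {1}/trig !big_cons -/(trig u w) uw /= mulrDr mulrACA cw addrA.
  by congr (_ + _); field.
elim: s Ks => [|x' s IH] Ks.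
  by exists [::] => //; apply: aeW => w; rewrite /trig !big_nil mul0r.
have [|u Ku uE] := IH; first by move=> z zs; apply: Ks; rewrite inE zs orbT.
have [v Kv vE] := one x' (Ks x' (mem_head _ _)).
have [z Kz zE] := trigK_lin 1 Kv Ku; exists z => //.
apply: (filterS2 _ _ uE vE) => w uw vw; rewrite zE mul1r uw vw.
by rewrite [in RHS]/trig big_cons mulrDl.
Qed.

Lemma uclosure_lin a f g : uclosure f -> uclosure g -> uclosure (fun w => a * f w + g w).
Proof.
move=> [mf [[M fM] fK]] [mg [[N gN] gK]]; split; last split.
- by apply: measurable_funD => //; exact: measurable_funM.
- exists (`|a| * M + N) => w; apply: le_trans (ler_normD _ _) _; rewrite normrM.
  by rewrite lerD// ler_wpM2l.
move=> eps eps0; have a1 : 0 < `|a| + 1 by rewrite ltr_wpDl.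
have e1 : 0 < eps / 2 / (`|a| + 1) by rewrite !divr_gt0.
have e2 : 0 < eps / 2 by rewrite divr_gt0.
have [s Ks sE] := fK _ e1; have [t Kt tE] := gK _ e2.
have [u Ku uE] := trigK_lin a Ks Kt; exists u => //.
apply: (filterS2 _ _ sE tE) => w sw tw; rewrite uE.
have -> : a * f w + g w - (a * trig s w + trig t w) =
   a * (f w - trig s w) + (g w - trig t w) by ring.
apply: le_trans (ler_normD _ _) _; rewrite [leRHS]splitr lerD// normrM.
apply: le_trans (_ : (`|a| + 1) * (eps / 2 / (`|a| + 1)) <= _).
  by apply: ler_pM => //; rewrite lerDl.
by rewrite mulrC divfK// gt_eqF.
Qed.

Lemma uclosure_cst c : uclosure (fun=> c).
Proof.
split; first exact: measurable_cst.
split; first by exists `|c|.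
move=> eps eps0; exists [:: (c, 0, 0)].
  by move=> x; rewrite inE => /eqP ->.
have := W_lin isoW (-1) 0 0; apply: filterS => w.
rewrite scaler0 addr0 mulN1r addNr /trig big_seq1 /cosW => -> /=.
by rewrite addr0 cos0 mulr1 subrr normr0 ltW.
Qed.

Lemma uclosureM f g : uclosure f -> uclosure g -> uclosure (fun w => f w * g w).
Proof.
move=> [mf [[M fM] fK]] [mg [[N gN] gK]].
have [w0|noW] := pselect (exists w : Omega, True); last first.
  split; first exact: measurable_funM.
  split; first by exists 0 => w; case: noW; exists w.
  move=> eps eps0; exists [::] => //.
  by apply: aeW => w; case: noW; exists w.
have M0 : 0 <= M by have [w _] := w0; exact: le_trans (normr_ge0 _) (fM w).
have N0 : 0 <= N by have [w _] := w0; exact: le_trans (normr_ge0 _) (gN w).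
split; first exact: measurable_funM.
split; first by exists (M * N) => w; rewrite normrM ler_pM.
move=> eps eps0.
have e2 : 0 < eps / 2 / (N + 1) by rewrite !divr_gt0// ltr_wpDl.
have [s Ks sE] := fK _ e2.
(* [s] is fixed before the tolerance for g, which depends on the bound of [trig W s]. *)
have [L sL] := trig_bounded s.
have L0 : 0 <= L by have [w _] := w0; exact: le_trans (normr_ge0 _) (sL w).
have e1 : 0 < eps / 2 / (L + 1) by rewrite !divr_gt0// ltr_wpDl.
have [t Kt tE] := gK _ e1.
have [u Ku uE] := trigKM Ks Kt; exists u => //.
apply: (filterS3 _ _ uE sE tE) => w -> sw tw.
have -> : f w * g w - trig s w * trig t w =
   (f w - trig s w) * g w + trig s w * (g w - trig t w) by ring.
apply: le_trans (ler_normD _ _) _; rewrite [leRHS]splitr !normrM.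
apply: lerD.
- apply: le_trans (_ : eps / 2 / (N + 1) * (N + 1) <= _).
    by apply: ler_pM => //; apply: le_trans (gN w) _; rewrite lerDl.
  by rewrite divfK// gt_eqF// ltr_wpDl.
- apply: le_trans (_ : (L + 1) * (eps / 2 / (L + 1)) <= _).
    by apply: ler_pM => //; apply: le_trans (sL w) _; rewrite lerDl.
  by rewrite mulrC divfK// gt_eqF// ltr_wpDl.
Qed.

Lemma uclosure_lim (f : Omega -> R) : measurable_fun setT f ->
  (forall eps : R, 0 < eps -> exists2 g, uclosure g & forall w, `|f w - g w| <= eps) ->
  uclosure f.
Proof.
move=> mf fK; split => //; split.
  have [g [_ [[M gM] _]] fg] := fK 1 ltr01; exists (1 + M) => w.
  rewrite -[f w](subrK (g w)); apply: le_trans (ler_normD _ _) _; exact: lerD.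
move=> eps eps0; have e2 : 0 < eps / 2 by rewrite divr_gt0.
have [g [_ [_ gK]] fg] := fK _ e2; have [s Ks sE] := gK _ e2.
exists s => //; apply: filterS sE => w sw.
have -> : f w - trig s w = (f w - g w) + (g w - trig s w) by ring.
apply: le_trans (ler_normD _ _) _; by rewrite [leRHS]splitr lerD.
Qed.

Lemma uclosure_sum (I : Type) (r : seq I) (F : I -> Omega -> R) (c : I -> R) :
  (forall i, uclosure (F i)) -> uclosure (fun w => \sum_(i <- r) c i * F i w).
Proof.
move=> FK; elim: r => [|i r IH].
  by under eq_fun do rewrite big_nil; exact: uclosure_cst.
by under eq_fun do rewrite big_cons; exact: uclosure_lin.
Qed.

Lemma uclosureX f k : uclosure f -> uclosure (fun w => f w ^+ k).
Proof.
move=> fK; elim: k => [|k IH]; first by under eq_fun do rewrite expr0; exact: uclosure_cst.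
by under eq_fun do rewrite exprS; exact: uclosureM.
Qed.

Lemma uclosure_horner f (p : {poly R}) : uclosure f -> uclosure (fun w => p.[f w]).
Proof.
move=> fK; under eq_fun do rewrite horner_coef.
by apply: uclosure_sum => i; exact: uclosureX.
Qed.

End Trig.

(** * Tent functions and polynomial approximation of the absolute value *)

Section Tent.
Context {R : realType}.

Lemma continuous_cvgn (u : nat -> R) (l : R) (g : R -> R) : continuous g ->
  u n @[n --> \oo] --> l -> g (u n) @[n --> \oo] --> g l.
Proof. by move=> cg ul; exact: (cvg_comp u g ul (cg l)). Qed.

(* Polynomials increasing to |x| on [-1, 1]: one Newton-like step of slope 1/2
   for the equation a^2 = x^2. *)
Fixpoint abs_poly (n : nat) : {poly R} :=
  if n is m.+1 then abs_poly m + 2^-1 *: ('X^2 - abs_poly m ^+ 2) else 0.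

(** The last clause bounds the error D by sqrt (2 / n). One step gives D' = D (1 - (|x| + a) / 2) <=
    D - D^2 / 2, as |x| + a >= D; the gain D^2 / 2 pays for passing from n to n + 1. *)
Lemma abs_polyP n (x : R) : `|x| <= 1 ->
  [/\ 0 <= (abs_poly n).[x], (abs_poly n).[x] <= `|x| &
      n%:R * (`|x| - (abs_poly n).[x]) ^+ 2 / 2 + (`|x| - (abs_poly n).[x]) <= 1].
Proof.
move=> x1; have x0 := normr_ge0 x.
have xx : x ^+ 2 = `|x| ^+ 2 by rewrite real_normK ?num_real.
elim: n => [|n [a0 ax an]].
  by rewrite horner0 subr0 !mul0r add0r.
have -> : (abs_poly n.+1).[x] =
    (abs_poly n).[x] + 2^-1 * (`|x| ^+ 2 - (abs_poly n).[x] ^+ 2).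
  by rewrite /= hornerD hornerZ hornerD hornerN hornerXn horner_exp xx.
move: a0 ax an.
set y := `|x| in x0 x1 *; set a := (abs_poly n).[x] => a0 ax an.
rewrite -[n.+1%:R]natr1; set N : R := n%:R in an *.
have N0 : 0 <= N by rewrite ler0n.
have e : y - (a + 2^-1 * (y ^+ 2 - a ^+ 2)) = (y - a) * (1 - (y + a) / 2) by field.
have d0 : 0 <= y - a by rewrite subr_ge0.
have s0 : 0 <= 1 - (y + a) / 2 by lra.
have d' : y - (a + 2^-1 * (y ^+ 2 - a ^+ 2)) <= (y - a) - (y - a) ^+ 2 / 2 by rewrite e; nra.
have d'0 : 0 <= y - (a + 2^-1 * (y ^+ 2 - a ^+ 2)) by rewrite e mulr_ge0.
split; [nra|by rewrite -subr_ge0|].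
move: d' d'0; set D := y - (a + _) => d' d'0.
have DD : D <= y - a by have := sqr_ge0 (y - a); lra.
have D2 : D ^+ 2 <= (y - a) ^+ 2 by rewrite ler_pXn2r ?nnegrE.
have ND : N * D ^+ 2 <= N * (y - a) ^+ 2 by rewrite ler_wpM2l.
lra.
Qed.

(** Half the second difference of the absolute value, a form to which [uclosure_norm] applies
    directly and whose shifts telescope. *)
Definition tent (x : R) : R := (`|x + 1| + `|x - 1|) / 2 - `|x|.

Lemma tentE x : tent x = Num.max 0 (1 - `|x|).
Proof.
rewrite /tent; case: (leP 0 (1 - `|x|)) => h.
- have := ler_norm x; have := ler_norm (- x); rewrite normrN => h1 h2.
  rewrite (@ger0_norm _ (x + 1)); last lra.
  rewrite (@ler0_norm _ (x - 1)); last lra.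
  by field.
- case: (leP 0 x) => x0; [rewrite (ger0_norm x0) in h *|rewrite (ltr0_norm x0) in h *].
  + by rewrite (@ger0_norm _ (x + 1)) ?(@ger0_norm _ (x - 1)); lra.
  + by rewrite (@ler0_norm _ (x + 1)) ?(@ler0_norm _ (x - 1)); lra.
Qed.

Lemma tent_ge0 x : 0 <= tent x. Proof. by rewrite tentE le_max lexx. Qed.
Lemma tent_le1 x : tent x <= 1.
Proof. by rewrite tentE ge_max ler01/= gerBl. Qed.
Lemma tent_norm x : `|tent x| <= 1.
Proof. by rewrite ger0_norm ?tent_le1 ?tent_ge0. Qed.

Lemma tent_lip x y : `|tent x - tent y| <= 2 * `|x - y|.
Proof.
have h (u v : R) : `| `|u| - `|v| | <= `|u - v| by exact: ler_dist_dist.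
have h1 := h (x + 1) (y + 1); have h2 := h (x - 1) (y - 1); have h3 := h x y.
rewrite (_ : x + 1 - (y + 1) = x - y) in h1; last by ring.
rewrite (_ : x - 1 - (y - 1) = x - y) in h2; last by ring.
rewrite ler_norml /tent; move: h1 h2 h3; rewrite !ler_norml.
move=> /andP[? ?] /andP[? ?] /andP[? ?]; apply/andP; split; lra.
Qed.

Lemma continuous_tent : continuous tent.
Proof.
move=> x; apply: (@cvgB _ R^o); last exact: norm_continuous.
apply: cvgM; last exact: cvg_cst.
by apply: (@cvgD _ R^o); apply: (@cvg_norm _ R^o); [apply: (@cvgD _ R^o)|apply: (@cvgB _ R^o)];
  [exact: cvg_id|exact: cvg_cst|exact: cvg_id|exact: cvg_cst].
Qed.

Lemma measurable_tent (a b : R) : measurable_fun setT (fun x : R => tent (a * x + b)).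
Proof.
apply: (measurableT_comp (continuous_measurable_fun continuous_tent)).
by apply: measurable_funD => //; exact: measurable_funM.
Qed.

(** The derivative of sine at 0. Through it W h is approached by bounded functions that are
    themselves cosines in multiples of h. *)
Lemma cvg_sin_scaled (x : R) : (n.+1%:R * sin (x / n.+1%:R)) @[n --> \oo] --> x.
Proof.
have dlin : is_derive (0 : R) (1 : R) (fun h : R => x * h) x.
  have h : is_derive (0 : R) (1 : R) (fun h : R => x * h) _ :=
    is_deriveM (is_derive_cst x (0 : R) (1 : R)) (is_derive_id (0 : R) (1 : R)).
  by apply: (is_derive_eq h); rewrite scaler0 addr0 /GRing.scale /= mulr1.
have ds : is_derive (0 : R) (1 : R) (fun h : R => sin (x * h)) x.
  have h := is_derive1_comp (is_derive_sin (x * 0)) dlin.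
  by apply: (is_derive_eq h); rewrite mulr0 cos0 mul1r.
have [dsd dsE] := ds.
have : h^-1 *: (((fun h : R => sin (x * h)) \o shift 0) (h *: (1 : R)) - sin (x * 0)) @[h --> 0^'] --> x.
  by rewrite -[X in _ --> X]dsE; exact: dsd.
move/cvgr_dnbhsP => /(_ (fun n => n.+1%:R^-1)); rewrite /comp /shift.
have -> : (fun n : nat => n.+1%:R^-1^-1 *: (sin (x * (n.+1%:R^-1 *: 1 + 0)) - sin (x * 0)))
  = (fun n : nat => n.+1%:R * sin (x / n.+1%:R)).
  apply/funext => n; rewrite invrK mulr0 sin0 subr0 addr0 /GRing.scale /=.
  by rewrite mulr1.
apply; split; first by move=> n; rewrite invr_eq0.
exact: cvg_harmonic.
Qed.

End Tent.

Section TrigClosure.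
Context {R : realType} {H : hilbertType R}.
Context d {Omega : measurableType d} (P : probability Omega R).
Variable W : H -> {RV P >-> R}.
Hypothesis isoW : isonormal W.
Variable K : H -> Prop.
Hypothesis K_lin : forall a x y, K x -> K y -> K (a *: x + y).
Hypothesis K_0 : K 0.

Local Notation uclosure := (uclosure W K).

Lemma uclosureZ a f : uclosure f -> uclosure (fun w => a * f w).
Proof.
move=> fK; have := uclosure_lin a fK (uclosure_cst isoW K_0 0).
by under eq_fun do rewrite addr0.
Qed.

Lemma uclosureD f g : uclosure f -> uclosure g -> uclosure (fun w => f w + g w).
Proof.
move=> fK gK; have := uclosure_lin 1 fK gK.
by under eq_fun do rewrite mul1r.
Qed.

(** The lattice step of Stone-Weierstrass: f is rescaled into [-1, 1], where [abs_poly] is uniformly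
    within sqrt (2 / n) of the absolute value. *)
Lemma uclosure_norm f : uclosure f -> uclosure (fun w => `|f w|).
Proof.
move=> fK; have [mf [[M fM] _]] := fK.
have mn : measurable_fun setT (fun w => `|f w|) by exact: measurableT_comp.
apply: uclosure_lim => // eps eps0.
pose L := `|M| + 1; have L0 : 0 < L by rewrite ltr_wpDl.
have fL w : `|f w / L| <= 1.
  rewrite normrM normfV (gtr0_norm L0) ler_pdivrMr// mul1r.
  by apply: le_trans (fM w) _; apply: le_trans (ler_norm M) _; rewrite lerDl.
pose del := eps / L; have del0 : 0 < del by rewrite divr_gt0.
pose n := Num.bound (2 / del ^+ 2).
have n2 : 2 / del ^+ 2 < n%:R by apply: archi_boundP; rewrite divr_ge0// sqr_ge0.
exists (fun w => L * (abs_poly n).[L^-1 * f w]).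
  by apply: uclosureZ; apply: uclosure_horner => //; exact: uclosureZ.
move=> w; have [a0 ax an] := abs_polyP n (fL w); rewrite [L^-1 * _]mulrC.
have e : `|f w| = L * `|f w / L|.
  by rewrite normrM normfV (gtr0_norm L0) mulrC divfK// gt_eqF.
rewrite e -mulrBr normrM (gtr0_norm L0).
have -> : eps = L * del by rewrite mulrC divfK// gt_eqF.
rewrite ler_pM2l// ger0_norm ?subr_ge0//.
move: an; set D := `|f w / L| - _ => an.
have D0 : 0 <= D by rewrite subr_ge0.
rewrite leNgt; apply/negP => delD.
have : n%:R * del ^+ 2 <= 2.
  have : n%:R * D ^+ 2 <= 2 by lra.
  by apply: le_trans; rewrite ler_wpM2l// ler_pXn2r ?nnegrE// ltW.
by move=> h; move: n2; rewrite ltNge ler_pdivlMr ?exprn_gt0// h.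
Qed.

Lemma uclosure_tent a b f : uclosure f -> uclosure (fun w => tent (a * f w + b)).
Proof.
move=> fK.
have lin c : uclosure (fun w => a * f w + c).
  by apply: uclosureD; [exact: uclosureZ|exact: uclosure_cst].
have e w : tent (a * f w + b) = 2^-1 * (`|a * f w + (b + 1)| + `|a * f w + (b - 1)|)
    + -1 * `|a * f w + b|.
  by rewrite /tent !addrA mulN1r [2^-1 * _]mulrC.
under eq_fun do rewrite e.
apply: uclosureD; apply: uclosureZ; last exact: uclosure_norm.
by apply: uclosureD; exact: uclosure_norm.
Qed.

Lemma uclosure_sin h n : K h -> uclosure (fun w => n.+1%:R * sin (W h w / n.+1%:R)).
Proof.
move=> Kh; split; last split.
- apply: measurable_funM => //.
  apply: (measurableT_comp (continuous_measurable_fun (@continuous_sin R))).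
  exact: measurable_funM.
- exists (n.+1%:R) => w; rewrite normrM ger0_norm// ler_piMr//.
  by rewrite ler_norml sin_geN1 sin_le1.
(* The phase - pi / 2 turns the cosine into a sine. *)
move=> eps eps0; exists [:: (n.+1%:R, - (pi / 2), n.+1%:R^-1 *: h)].
  move=> x; rewrite inE => /eqP -> /=; rewrite -[_ *: h]addr0; exact: K_lin.
have := W_lin isoW n.+1%:R^-1 h 0; have := W_lin isoW (-1) 0 0.
apply: filterS2 => w; rewrite scaler0 addr0 mulN1r addNr => W0.
rewrite addr0 W0 addr0 /trig big_seq1 /cosW /= => ->.
rewrite cosB cos_pihalf mulr0 add0r sin_pihalf mulr1 [_^-1 * _]mulrC subrr normr0.
exact: ltW.
Qed.

Let chaos_trunc p (s : seq (R * H)) (n : nat) (w : Omega) : R :=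
  \sum_(x <- s) x.1 * (hermite R p).[n.+1%:R * sin (W x.2 w / n.+1%:R)].

Let uclosure_chaos_trunc p s n : (forall x, x \in s -> K x.2) -> uclosure (chaos_trunc p s n).
Proof.
rewrite /chaos_trunc; elim: s => [|x s IH] Ks.
  by under eq_fun do rewrite big_nil; exact: uclosure_cst.
under eq_fun do rewrite big_cons; apply: uclosureD.
  apply: uclosureZ; apply: uclosure_horner => //; apply: uclosure_sin.
  exact: (Ks x (mem_head _ _)).
by apply: IH => y ys; apply: Ks; rewrite inE ys orbT.
Qed.

Let cvg_chaos_trunc p s w : chaos_trunc p s n w @[n --> \oo] --> chaos_var W p s w.
Proof.
rewrite /chaos_trunc /chaos_var; elim: s => [|x s IH].
  by under eq_fun do rewrite big_nil; rewrite big_nil; exact: cvg_cst.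
under eq_fun do rewrite big_cons; rewrite big_cons; apply: (@cvgD _ R^o) => //.
apply: cvgM; first exact: cvg_cst.
apply: (@continuous_cvgn _ _ _ (fun y => (hermite R p).[y])).
  exact: continuous_horner.
exact: cvg_sin_scaled.
Qed.

(** Each W x is replaced by n sin (W x / n), at the price of an L^2 error that vanishes by dominated
    convergence; the tent of the truncated sum then lies in the uniform closure. *)
Lemma tent_chaos_trig p s a b (eps : R) : (forall x, x \in s -> K x.2) -> 0 < eps ->
  exists2 t, trigK K t &
    ex P (fun w => (tent (a * chaos_var W p s w + b) - trig W t w) ^+ 2) <= eps.
Proof.
move=> Ks eps0.
pose X := chaos_var W p s.
pose f n w : R := tent (a * chaos_trunc p s n w + b).
have mX : measurable_fun setT X := (allmom_chaos_var isoW p s).1.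
have mt (g : Omega -> R) : measurable_fun setT g -> measurable_fun setT (fun w => tent (a * g w + b)).
  exact: measurableT_comp (measurable_tent a b).
have fK n : uclosure (f n) by apply: uclosure_tent; exact: uclosure_chaos_trunc.
have sqf n : sqint P (f n).
  apply: (@sqint_bnd _ _ _ _ _ 1); first exact: (fK n).1.
  by move=> w; exact: tent_norm.
have sqX : sqint P (fun w => tent (a * X w + b)).
  by apply: (@sqint_bnd _ _ _ _ _ 1); [exact: mt|move=> w; exact: tent_norm].
have cvgf : ex P (fun w => (tent (a * X w + b) - f n w) ^+ 2) @[n --> \oo] --> 0.
  pose g n w : \bar R := ((tent (a * X w + b) - f n w) ^+ 2)%:E.
  have [] := @dominated_convergence _ _ _ P setT measurableT g (cst 0%E) (cst (4%:E)).
  - by move=> n; apply/measurable_EFinP/measurable_funX/measurable_funB; [exact: mt|exact: (fK n).1].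
  - exact: measurable_cst.
  - apply: aeW => w _; rewrite /g; apply: cvg_EFin; first exact: nearW.
    rewrite -[X in _ --> X](_ : (tent (a * X w + b) - tent (a * X w + b)) ^+ 2 = 0); last first.
      by rewrite subrr expr0n.
    apply: (@continuous_cvgn _ _ _ (fun y : R => y ^+ 2)).
      exact: exprn_continuous.
    apply: (@cvgB _ R^o); first exact: cvg_cst.
    apply: (@continuous_cvgn _ _ _ tent); first exact: continuous_tent.
    apply: (@cvgD _ R^o); last exact: cvg_cst.
    by apply: cvgM; [exact: cvg_cst|exact: cvg_chaos_trunc].
  - exact: finite_measure_integrable_cst.
  - apply: aeW => w n _; rewrite /g /= lee_fin normrX.
    have -> : 4 = 2 ^+ 2 :> R by ring.
    rewrite ler_pXn2r ?nnegrE//; apply: le_trans (ler_normB _ _) _.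
    by have := tent_norm (a * X w + b); have := tent_norm (a * chaos_trunc p s n w + b); rewrite /f; lra.
  move=> _ _; rewrite integral0 => h.
  exact: (fine_cvg h).
have e4 : 0 < eps / 4 by rewrite divr_gt0.
move/cvgrPdist_lt : cvgf => /(_ _ e4)[n _ /(_ n (leqnn _))] /=.
rewrite sub0r normrN ger0_norm; last by apply: ex_ge0 => w; exact: sqr_ge0.
move=> nX.
pose del : R := Num.min 1 (eps / 4).
have del0 : 0 < del by rewrite lt_min ltr01 e4.
have [_ [_ /(_ _ del0)[t Kt tE]]] := fK n; exists t => //.
have sqt := sqint_trig W t.
have i1 := (sqintB sqX (sqf n)).2; have i2 := (sqintB (sqf n) sqt).2.
have j1 := intgZ 2 i1; have j2 := intgZ 2 i2.
apply: (@le_trans _ _ (ex P (fun w => 2 * (tent (a * X w + b) - f n w) ^+ 2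
    + 2 * (f n w - trig W t w) ^+ 2))).
  apply: ex_le.
  - exact: (sqintB sqX sqt).2.
  - exact: intgD j1 j2.
  move=> w; have := sqr_ge0 ((tent (a * X w + b) - f n w) - (f n w - trig W t w)).
  by rewrite -/X; set u := tent _; set v := f n w; set z := trig W t w; nra.
rewrite (exD j1 j2) (exZ _ i1) (exZ _ i2).
have : ex P (fun w => (f n w - trig W t w) ^+ 2) <= eps / 4.
  (* The uniform bound holds almost everywhere only; capping the square at eps / 4, which is at
     least del^2, makes it pointwise without changing the expectation. *)
  have -> : ex P (fun w => (f n w - trig W t w) ^+ 2) =
     ex P (fun w => Num.min ((f n w - trig W t w) ^+ 2) (eps / 4)).
    apply: ex_ae; first exact: (intg_meas i2).
      by apply: measurable_minr; [exact: (intg_meas i2)|exact: measurable_cst].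
    apply: filterS tE => w h; rewrite min_l//.
    rewrite -real_normK ?num_real//; apply: le_trans (_ : 1 * del <= _).
      rewrite expr2; apply: ler_pM => //; apply: le_trans h _.
      by rewrite ge_min lexx.
    by rewrite mul1r ge_min lexx orbT.
  rewrite -[leRHS](ex_cst P); apply: ex_le.
  - apply: (@intg_bnd _ _ _ _ _ (eps / 4)).
      by apply: measurable_minr; [exact: (intg_meas i2)|exact: measurable_cst].
    move=> w; rewrite ger0_norm ?ge_min ?lexx ?orbT//.
    by rewrite le_min sqr_ge0 ltW.
  - exact: intg_cst.
  - by move=> w; rewrite ge_min lexx orbT.
lra.
Qed.

End TrigClosure.

(** * Convergence of the fourth cumulant *)

Section Truncation.
Context {R : realType}.

Lemma expr4_ge0 (x : R) : 0 <= x ^+ 4.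
Proof. by rewrite (exprM x 2 2) sqr_ge0. Qed.

(** Its powers are bounded and Lipschitz, hence admissible test functions for convergence in law. *)
Definition trunc (k x : R) : R := Num.min `|x| k.

Lemma trunc_ge0 k x : 0 <= k -> 0 <= trunc k x.
Proof. by move=> k0; rewrite le_min normr_ge0. Qed.
Lemma trunc_le k x : trunc k x <= k.
Proof. by rewrite ge_min lexx orbT. Qed.
Lemma trunc_le_norm k x : trunc k x <= `|x|.
Proof. by rewrite ge_min lexx. Qed.
Lemma trunc_lip k x y : `|trunc k x - trunc k y| <= `|x - y|.
Proof.
apply: le_trans (ler_dist_dist x y); rewrite /trunc.
by case: (leP `|x| k) => hx; case: (leP `|y| k) => hy; rewrite ?subrr ?normr0//;
  rewrite ler_norml; apply/andP; split;
  have := ler_norm (`|x| - `|y|); have := ler_norm (- (`|x| - `|y|)); rewrite normrN; lra.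
Qed.

Lemma measurable_trunc k : measurable_fun setT (trunc k).
Proof. by apply: measurable_minr. Qed.

Lemma trunc2_lip k x y : 0 <= k -> `|trunc k x ^+ 2 - trunc k y ^+ 2| <= 2 * k * `|x - y|.
Proof.
move=> k0; rewrite subr_sqr normrM mulrC; apply: ler_pM => //; last exact: trunc_lip.
have := trunc_ge0 x k0; have := trunc_ge0 y k0; have := trunc_le k x; have := trunc_le k y.
by move=> ? ? ? ?; rewrite ger0_norm; lra.
Qed.

Lemma trunc4_lip k x y : 0 <= k ->
  `|trunc k x ^+ 4 - trunc k y ^+ 4| <= 4 * k ^+ 3 * `|x - y|.
Proof.
move=> k0; rewrite !(exprM _ 2 2) subr_sqr normrM.
have x0 := trunc_ge0 x k0; have y0 := trunc_ge0 y k0.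
have xk := trunc_le k x; have yk := trunc_le k y.
have h1 : trunc k x ^+ 2 <= k ^+ 2 by rewrite lerXn2r ?nnegrE.
have h2 : trunc k y ^+ 2 <= k ^+ 2 by rewrite lerXn2r ?nnegrE.
have -> : 4 * k ^+ 3 * `|x - y| = (2 * k * `|x - y|) * (2 * k ^+ 2) by ring.
apply: ler_pM => //; first exact: trunc2_lip.
by rewrite ger0_norm ?addr_ge0 ?sqr_ge0//; lra.
Qed.

End Truncation.

Section FourthMomentLimit.
Context d {Omega : measurableType d} {R : realType} (P : probability Omega R).
Variables (X : nat -> Omega -> R) (sigma C : R).
Hypothesis sigma0 : sigma != 0.
Hypothesis C0 : 0 <= C.
Hypothesis momX : forall N, allmom P (X N).
Hypothesis X8 : forall N,
  ex P (fun w => X N w ^+ 8) <= C * ex P (fun w => X N w ^+ 2) ^+ 4.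
Local Notation gauss := (normal_prob 0 sigma).
Hypothesis X_lip : forall (phi : R -> R) (L B : R),
  (forall x y, `|phi x - phi y| <= L * `|x - y|) -> (forall x, `|phi x| <= B) ->
  ex P (fun w => phi (X N w)) @[N --> \oo] --> ex gauss phi.

Let ex_gauss0 : ex gauss (fun x => x ^+ 0) = 1.
Proof. exact: (ex_cst gauss 1). Qed.
Let ex_gauss2 : ex gauss (fun x => x ^+ 2) = sigma ^+ 2.
Proof. by have := normal_moment_rec 0 sigma0; rewrite -/(ex _ _) => ->; rewrite -/(ex gauss _) ex_gauss0 mul1r mulr1. Qed.
Let ex_gauss4 : ex gauss (fun x => x ^+ 4) = 3 * sigma ^+ 4.
Proof. by have := normal_moment_rec 2 sigma0; rewrite -/(ex _ _) => ->; rewrite -/(ex gauss _) ex_gauss2; ring. Qed.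

Let gauss_int k : intg gauss (fun x => x ^+ k).
Proof. exact: normal_moment_integrable. Qed.

Let gauss_trunc_int k j : 0 <= k -> intg gauss (fun x => trunc k x ^+ j).
Proof.
move=> k0; apply: (@intg_bnd _ _ _ _ _ (k ^+ j)).
  by apply: measurable_funX; exact: measurable_trunc.
by move=> x; rewrite normrX ger0_norm ?trunc_ge0// lerXn2r ?nnegrE ?trunc_ge0// trunc_le.
Qed.

Let cvg_trunc2 k : 0 <= k ->
  ex P (fun w => trunc k (X N w) ^+ 2) @[N --> \oo] --> ex gauss (fun x => trunc k x ^+ 2).
Proof.
move=> k0; apply: (@X_lip (fun x => trunc k x ^+ 2) (2 * k) (k ^+ 2)) => [x y|x]; first exact: trunc2_lip.
by rewrite normrX ger0_norm ?trunc_ge0// lerXn2r ?nnegrE ?trunc_ge0// trunc_le.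
Qed.

Let cvg_trunc4 k : 0 <= k ->
  ex P (fun w => trunc k (X N w) ^+ 4) @[N --> \oo] --> ex gauss (fun x => trunc k x ^+ 4).
Proof.
move=> k0; apply: (@X_lip (fun x => trunc k x ^+ 4) (4 * k ^+ 3) (k ^+ 4)) => [x y|x]; first exact: trunc4_lip.
by rewrite normrX ger0_norm ?trunc_ge0// lerXn2r ?nnegrE ?trunc_ge0// trunc_le.
Qed.

Let intX N k : intg P (fun w => X N w ^+ k).
Proof. by apply: allmom_intg; exact: allmomX. Qed.

Let meas_truncX N k j : measurable_fun setT (fun w => trunc k (X N w) ^+ j).
Proof.
apply: measurable_funX; apply: (measurableT_comp (measurable_trunc k)); exact: (momX N).1.
Qed.

Let int_truncX N k j : 0 <= k -> intg P (fun w => trunc k (X N w) ^+ j).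
Proof.
move=> k0; apply: (@intg_bnd _ _ _ _ _ (k ^+ j)); first exact: meas_truncX.
by move=> w; rewrite normrX ger0_norm ?trunc_ge0// lerXn2r ?nnegrE ?trunc_ge0// trunc_le.
Qed.

Let X4_le N : ex P (fun w => X N w ^+ 4) ^+ 2 <= C * ex P (fun w => X N w ^+ 2) ^+ 4.
Proof.
apply: le_trans (X8 N).
have sX : sqint P (fun w => X N w ^+ 4) by apply/allmom_sqint/allmomX.
have := ex_CS sX (sqint_cst P 1).
have -> : (fun w => X N w ^+ 4 * 1) = (fun w => X N w ^+ 4) by apply/funext => w; rewrite mulr1.
have -> : (fun w => (X N w ^+ 4) ^+ 2) = (fun w => X N w ^+ 8) by apply/funext => w; rewrite -exprM.
by rewrite ex_cst expr1n mulr1.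
Qed.

(* By X8 and Cauchy-Schwarz at most half of E X^2 comes from the event |X| > k, whose
   probability is bounded through the truncated second moment. *)
Lemma second_moment_bounded :
  exists M, \forall N \near \oo, ex P (fun w => X N w ^+ 2) <= M.
Proof.
(* The truncated second moment is eventually at most sigma^2 + 1, and (sigma^2 + 1) / K = 1 / (4 (C
   + 1)). *)
pose K := 4 * (C + 1) * (sigma ^+ 2 + 1).
have C1 : 0 < C + 1 by rewrite ltr_wpDl.
have s1 : 0 < sigma ^+ 2 + 1 by rewrite ltr_wpDl// sqr_ge0.
have K0 : 0 < K by rewrite /K !mulr_gt0.
pose k := Num.sqrt K.
have kK : k ^+ 2 = K by rewrite sqr_sqrtr// ltW.
have k0 : 0 <= k by exact: sqrtr_ge0.
have lim : ex gauss (fun x => trunc k x ^+ 2) <= sigma ^+ 2.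
  rewrite -ex_gauss2; apply: ex_le; [exact: gauss_trunc_int|exact: gauss_int|move=> x].
  rewrite -[leRHS]real_normK ?num_real// lerXn2r ?nnegrE ?trunc_ge0//.
  exact: trunc_le_norm.
exists (2 * K).
move/cvgrPdist_le : (cvg_trunc2 k0) => /(_ 1 ltr01); apply: filterS => N.
rewrite ler_distl => /andP[tN _].
have {}tN : ex P (fun w => trunc k (X N w) ^+ 2) <= sigma ^+ 2 + 1.
  by move: tN lim; lra.
set m := ex P (fun w => X N w ^+ 2).
have m0 : 0 <= m by apply: ex_ge0 => w; exact: sqr_ge0.
(* A surrogate for the indicator of |X| > k: equal to 1 there, at most 1 everywhere, with an
   expectation controlled by convergence in law. *)
pose th w := K^-1 * trunc k (X N w) ^+ 2.
have th0 w : 0 <= th w by rewrite /th mulr_ge0 ?invr_ge0 ?sqr_ge0// ltW.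
have th1 w : th w <= 1.
  rewrite /th mulrC ler_pdivrMr// mul1r -kK lerXn2r ?nnegrE ?trunc_ge0//; exact: trunc_le.
have mth : measurable_fun setT th by apply: measurable_funM => //; exact: meas_truncX.
have sth : sqint P th.
  by apply: (@sqint_bnd _ _ _ _ _ 1) => // w; rewrite ger0_norm.
have sX2 : sqint P (fun w => X N w ^+ 2) by apply/allmom_sqint/allmomX.
have i1 := sqintM sX2 sth.
set q := ex P (fun w => X N w ^+ 2 * th w).
have q0 : 0 <= q by apply: ex_ge0 => w; rewrite mulr_ge0 ?sqr_ge0.
have mq : m <= K + q.
  rewrite -[K](ex_cst P) /q -exD//; last exact: intg_cst.
  apply: ex_le => //; first by apply: intgD => //; exact: intg_cst.
  move=> w; have [Xk|Xk] := leP `|X N w| k.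
    rewrite -[leLHS]addr0; apply: lerD; last by apply: mulr_ge0; [exact: sqr_ge0|exact: th0].
    by rewrite -kK -real_normK ?num_real// lerXn2r ?nnegrE.
  have -> : th w = 1 by rewrite /th /trunc min_r ?ltW// kK mulVf// gt_eqF.
  by rewrite mulr1 lerDr ltW.
have qCS := ex_CS sX2 sth.
rewrite -/q in qCS.
have exth : ex P th = K^-1 * ex P (fun w => trunc k (X N w) ^+ 2).
  by rewrite exZ//; exact: int_truncX.
have th2 : ex P (fun w => th w ^+ 2) <= ex P th.
  apply: ex_le; [exact: sth.2|exact: sqint_intg|move=> w].
  by rewrite expr2 ler_piMr.
have eta : ex P th <= (4 * (C + 1))^-1.
  apply: (@le_trans _ _ (K^-1 * (sigma ^+ 2 + 1))).
    by rewrite exth ler_wpM2l// invr_ge0 ltW.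
  rewrite (_ : K^-1 * (sigma ^+ 2 + 1) = (4 * (C + 1))^-1)// /K.
  by field; rewrite !gt_eqF.
have A4 := X4_le N; rewrite -/m in A4.
have X4E : (fun w => (X N w ^+ 2) ^+ 2) = (fun w => X N w ^+ 4) by apply/funext => w; rewrite -exprM.
rewrite X4E in qCS.
move: qCS A4; set A := ex P (fun w => X N w ^+ 4).
have A0 : 0 <= A by apply: ex_ge0 => w; exact: expr4_ge0.
move=> qCS A4.
(* Otherwise m^2 / 4 < q^2 <= A / (4 (C + 1)), so A > (C + 1) m^2, against A^2 <= C m^4. *)
suff : q <= m / 2 by lra.
rewrite leNgt; apply/negP => qm.
have h1 : (m / 2) ^+ 2 < q ^+ 2 by rewrite ltrXn2r ?nnegrE ?divr_ge0.
have t0 : 0 <= ex P th by exact: ex_ge0.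
have h2 : q ^+ 2 <= A * (4 * (C + 1))^-1.
  apply: le_trans qCS _; rewrite ler_wpM2l//; exact: le_trans th2 eta.
have h3 : m ^+ 2 * (C + 1) < A.
  have : (m / 2) ^+ 2 < A * (4 * (C + 1))^-1 := lt_le_trans h1 h2.
  rewrite ltr_pdivlMr ?mulr_gt0//.
  suff -> : (m / 2) ^+ 2 * (4 * (C + 1)) = m ^+ 2 * (C + 1) by [].
  by field.
have h4 : (m ^+ 2 * (C + 1)) ^+ 2 < A ^+ 2.
  by rewrite ltrXn2r ?nnegrE// mulr_ge0 ?sqr_ge0// ltW.
have h5 := lt_le_trans h4 A4.
have m4 := expr4_ge0 m.
have : m ^+ 4 * (C + 1) ^+ 2 < m ^+ 4 * C.
  by move: h5; rewrite exprMn -exprM [C * _]mulrC.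
apply/negP; rewrite -leNgt; apply: ler_wpM2l => //; nra.
Qed.

(** One-sided: E X^4 is bounded above and E X^2 below. Truncated moments converge; the discarded
    part is bounded by E X^8 / K for the former, and by the Gaussian fourth moment over K for the
    limit of the latter. *)
Lemma fourth_cumulant_limit (eps : R) : 0 < eps -> \forall N \near \oo,
  ex P (fun w => X N w ^+ 4) - 3 * ex P (fun w => X N w ^+ 2) ^+ 2 <= eps.
Proof.
move=> eps0; have [M0 MN] := second_moment_bounded.
pose M := Num.max 0 M0; have M_ge0 : 0 <= M by rewrite le_max lexx.
pose S := sigma ^+ 2; have S0 : 0 <= S by exact: sqr_ge0.
pose A := C * M ^+ 4; have A0 : 0 <= A by rewrite mulr_ge0 ?exprn_ge0.
(* 18 = 3 * 2 * 3: thrice m^2 >= 2 S m - S^2, with m at least S - 3 S^2 / K - e. The choice of [K]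
   makes B / K at most eps / 2, and K >= 1 allows x^4 <= x^8 / K once x^2 >= K. *)
pose B := A + 18 * S ^+ 3; have B0 : 0 <= B by apply: addr_ge0 => //; apply: mulr_ge0 => //; exact: exprn_ge0.
pose K := 1 + 2 * B / eps.
have K1 : 1 <= K by rewrite lerDl; apply: divr_ge0; [exact: mulr_ge0|exact: ltW].
have K0 : 0 < K by exact: lt_le_trans K1.
have BK : B / K <= eps / 2.
  have e : eps / 2 * (2 * B / eps) = B by field; rewrite gt_eqF.
  rewrite ler_pdivrMr// /K mulrDr mulr1 e.
  by rewrite lerDr; apply: ltW; rewrite divr_gt0.
pose k := Num.sqrt K.
have kK : k ^+ 2 = K by rewrite sqr_sqrtr// ltW.
have k0 : 0 <= k by exact: sqrtr_ge0.
have S6 : 0 < 1 + 6 * S by rewrite ltr_pwDl// mulr_ge0.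
pose e := eps / 2 / (1 + 6 * S).
have e0 : 0 < e by rewrite !divr_gt0.
have eE : e + 6 * S * e = eps / 2 by rewrite /e; field; rewrite gt_eqF.
have lim4 : ex gauss (fun x => trunc k x ^+ 4) <= 3 * S ^+ 2.
  rewrite -[S ^+ 2]exprM -ex_gauss4; apply: ex_le; [exact: gauss_trunc_int|exact: gauss_int|move=> x].
  rewrite -[leRHS]ger0_norm; last exact: expr4_ge0.
  by rewrite normrX lerXn2r ?nnegrE ?trunc_ge0// trunc_le_norm.
have trunc2 x : x ^+ 2 <= trunc k x ^+ 2 + K^-1 * x ^+ 4.
  have [xk|xk] := leP `|x| k.
    rewrite /trunc min_l// real_normK ?num_real// lerDl; apply: mulr_ge0.
      by rewrite invr_ge0 ltW.
    exact: expr4_ge0.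
  apply: (@le_trans _ _ (K^-1 * x ^+ 4)); last by rewrite lerDr sqr_ge0.
  rewrite ler_pdivlMl// (exprM x 2 2) [leRHS]expr2; apply: ler_wpM2r; first exact: sqr_ge0.
  rewrite -kK -[leRHS]real_normK ?num_real//.
  by rewrite lerXn2r ?nnegrE// ltW.
have lim2 : S - K^-1 * (3 * S ^+ 2) <= ex gauss (fun x => trunc k x ^+ 2).
  have -> : S - K^-1 * (3 * S ^+ 2) =
      ex gauss (fun x => x ^+ 2) - K^-1 * ex gauss (fun x => x ^+ 4).
    by rewrite ex_gauss2 ex_gauss4 /S -exprM.
  have j := intgZ K^-1 (gauss_int 4); have j2 := gauss_trunc_int 2 k0.
  rewrite lerBlDr -(exZ _ (gauss_int 4)) -(exD j2 j).
  by apply: ex_le; [exact: gauss_int|exact: intgD j2 j|exact: trunc2].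
have ev2 := (cvgrPdist_le _ _).1 (cvg_trunc2 k0) _ e0.
have ev4 := (cvgrPdist_le _ _).1 (cvg_trunc4 k0) _ e0.
near=> N.
have t2 : S - K^-1 * (3 * S ^+ 2) - e <= ex P (fun w => trunc k (X N w) ^+ 2).
  have : `|ex gauss (fun x => trunc k x ^+ 2) - ex P (fun w => trunc k (X N w) ^+ 2)| <= e by near: N; exact: ev2.
  by rewrite ler_norml => /andP[_ h]; move: lim2 h; lra.
have t4 : ex P (fun w => trunc k (X N w) ^+ 4) <= 3 * S ^+ 2 + e.
  have : `|ex gauss (fun x => trunc k x ^+ 4) - ex P (fun w => trunc k (X N w) ^+ 4)| <= e by near: N; exact: ev4.
  by rewrite ler_norml => /andP[h _]; move: lim4 h; lra.
have mM0 : ex P (fun w => X N w ^+ 2) <= M0 by near: N; exact: MN.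
set m := ex P (fun w => X N w ^+ 2) in mM0 *.
have mM : m <= M by rewrite le_max mM0 orbT.
have m0 : 0 <= m by apply: ex_ge0 => w; exact: sqr_ge0.
have m2 : S - K^-1 * (3 * S ^+ 2) - e <= m.
  apply: le_trans t2 _; apply: ex_le; [exact: int_truncX|exact: intX|move=> w].
  rewrite -[leRHS]real_normK ?num_real// lerXn2r ?nnegrE ?trunc_ge0//.
  exact: trunc_le_norm.
have m4 : ex P (fun w => X N w ^+ 4) <= 3 * S ^+ 2 + e + K^-1 * A.
  apply: (@le_trans _ _ (ex P (fun w => trunc k (X N w) ^+ 4) + K^-1 * ex P (fun w => X N w ^+ 8))).
    have j := intgZ K^-1 (intX N 8).
    rewrite -exZ// -exD//; last exact: int_truncX.
    apply: ex_le => //; first by apply: intgD => //; exact: int_truncX.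
    move=> w; set x := X N w; have [xk|xk] := leP `|x| k.
      rewrite /trunc min_l// -normrX ger0_norm; last exact: expr4_ge0.
      by rewrite lerDl (exprM x 4 2); apply: mulr_ge0; [rewrite invr_ge0 ltW|exact: sqr_ge0].
    rewrite -[leLHS]add0r lerD ?exprn_ge0 ?trunc_ge0//.
    have x2 : K <= x ^+ 2.
      by rewrite -kK -[leRHS]real_normK ?num_real// lerXn2r ?nnegrE// ltW.
    have x1 : 1 <= x ^+ 2 by exact: le_trans x2.
    rewrite ler_pdivlMl//; have -> : x ^+ 8 = x ^+ 4 * (x ^+ 2 * x ^+ 2) by ring.
    rewrite mulrC; apply: ler_wpM2l; first exact: expr4_ge0.
    nra.
  apply: lerD => //; apply: ler_wpM2l; first by rewrite invr_ge0 ltW.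
  apply: le_trans (X8 N) _; apply: ler_wpM2l => //.
  by rewrite lerXn2r ?nnegrE.
have BKe : K^-1 * A + 18 * S ^+ 3 * K^-1 <= eps / 2.
  by move: BK; rewrite /B mulrDl mulrC.
(* The lower bound on m enters through m^2 >= 2 S m - S^2, valid even if that bound is negative and
   cannot be squared. *)
have sq := sqr_ge0 (m - S).
have Sm : S * (S - K^-1 * (3 * S ^+ 2) - e) <= S * m by rewrite ler_wpM2l.
move: m4 BKe Sm; set kA := K^-1 * A; set kS := K^-1.
have -> : S * (S - kS * (3 * S ^+ 2) - e) = S ^+ 2 - 3 * (S ^+ 3 * kS) - S * e by ring.
have -> : 18 * S ^+ 3 * kS = 18 * (S ^+ 3 * kS) by ring.
move: sq eE; rewrite sqrrB; set S3 := S ^+ 3 * kS.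
have -> : 6 * S * e = 6 * (S * e) by ring.
rewrite -[m * S *+ 2]mulr_natl [m * S]mulrC.
set Se := S * e; set SM := S * m; set S2 := S ^+ 2; set m22 := m ^+ 2.
lra.
Unshelve. all: by end_near. Qed.

End FourthMomentLimit.

(** * Asymptotic decorrelation *)

Section MultipleIntegral.
Context {R : realType} {H : hilbertType R} (T : forall n, tensor_power H n).
Context d {Omega : measurableType d} (P : probability Omega R).
Variables (W : H -> {RV P >-> R}) (I : forall n, T n -> {RV P >-> R}).
Hypothesis isoW : isonormal W.
Hypothesis mintI : is_multiple_integral W I.

Lemma sqint_mint n (f : T n) : sym_power f -> sqint P (I f).
Proof.
move=> sf; split => //; apply: intg_ge0_fin.
- exact: measurable_funX.
- by move=> w; exact: sqr_ge0.
have -> : (fun w => I f w ^+ 2) = I f \* I f by apply/funext => w; rewrite expr2.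
by rewrite (mint_isometry mintI)// ltry.
Qed.

Lemma ex_mint_sqr n (f : T n) : sym_power f ->
  ex P (fun w => I f w ^+ 2) = n`!%:R * `|f| ^+ 2.
Proof.
move=> sf; apply: EFin_inj; rewrite -exE; last exact: (sqint_mint sf).2.
have -> : (fun w => I f w ^+ 2) = I f \* I f by apply/funext => w; rewrite expr2.
by rewrite (mint_isometry mintI)// inner_norm.
Qed.

Lemma ex_mint_dist n (f g : T n) : sym_power f -> sym_power g ->
  ex P (fun w => (I f w - I g w) ^+ 2) = n`!%:R * `|f - g| ^+ 2.
Proof.
move=> sf sg; have sd : sym_power (-1 *: g + f) by exact: sym_power_lin.
have -> : f - g = -1 *: g + f by rewrite scaleN1r addrC.
rewrite -ex_mint_sqr//; apply: ex_ae.
- exact/measurable_funX/measurable_funB.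
- exact: measurable_funX.
- apply: filterS (mint_linear mintI (-1) sg sf) => w ->.
  by rewrite mulN1r addrC.
Qed.

Lemma mint_tpow_comb n s : unit_comb s ->
  {ae P, forall w, I (tpow_comb (T n) s) w = chaos_var W n s w}.
Proof.
elim: s => [|x s IH] us.
  rewrite /tpow_comb big_nil.
  (* Linearity at a = 1 and f = g = 0 reads I 0 = I 0 + I 0. *)
  apply: filterS (mint_linear mintI 1 (sym_power0 (T n)) (sym_power0 (T n))) => w.
  rewrite scaler0 addr0 mul1r => /esym/eqP; rewrite -subr_eq0 addrK => /eqP ->.
  by rewrite /chaos_var big_nil.
have us' : unit_comb s by move=> y ys; apply: us; rewrite inE ys orbT.
have x1 := us x (mem_head _ _).
rewrite /tpow_comb big_cons -/(tpow_comb (T n) s).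
apply: (filterS3 _ _ (IH us') (mint_hermite mintI n x1)
  (mint_linear mintI x.1 (sym_tpow (T n) x.2) (sym_tpow_comb (T n) s))) => w h1 h2 ->.
by rewrite h1 /tpow h2 /chaos_var big_cons.
Qed.

Lemma ex_chaos_dist n s t : unit_comb s -> unit_comb t ->
  ex P (fun w => (chaos_var W n s w - chaos_var W n t w) ^+ 2) =
    n`!%:R * `|tpow_comb (T n) s - tpow_comb (T n) t| ^+ 2.
Proof.
move=> us ut; rewrite -ex_mint_dist; [|exact: sym_tpow_comb|exact: sym_tpow_comb].
have mc u : measurable_fun setT (chaos_var W n u) := (allmom_chaos_var isoW n u).1.
apply: ex_ae.
- exact/measurable_funX/measurable_funB.
- exact/measurable_funX/measurable_funB.
- by apply: (filterS2 _ _ (mint_tpow_comb n us) (mint_tpow_comb n ut)) => w -> ->.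
Qed.

Lemma ex_chaos_sqr n s : unit_comb s ->
  ex P (fun w => chaos_var W n s w ^+ 2) = n`!%:R * `|tpow_comb (T n) s| ^+ 2.
Proof.
move=> us; have u0 : unit_comb ([::] : seq (R * H)) by [].
have := ex_chaos_dist n us u0.
rewrite /tpow_comb [X in _ - X]big_nil subr0 => <-; congr ex; apply/funext => w.
by rewrite {3}/chaos_var big_nil subr0.
Qed.

(** The factor (p+2)! (p+2) from [tpow_comb_proj_dist] equals (p+2)^2 (p+1)!, which turns the norm
    of the contraction into E (D_h X)^2, the quantity bounded by [chaos_var_fourth]. The projected
    vectors are rescaled so that [ex_chaos_dist] applies. *)
Lemma chaos_var_orth p s h : unit_comb s -> `|h| = 1 ->
  exists s' : seq (R * H), (forall x, x \in s' -> inner x.2 h = 0) /\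
    6 * p.+1%:R * ex P (fun w => (chaos_var W p.+2 s w - chaos_var W p.+2 s' w) ^+ 2) ^+ 2
    <= p.+2%:R * (ex P (fun w => chaos_var W p.+2 s w ^+ 4)
                  - 3 * ex P (fun w => chaos_var W p.+2 s w ^+ 2) ^+ 2).
Proof.
move=> us h1.
have [s' [us' s's sE]] := tpow_comb_normalize (T p.+2) isT [seq (x.1, orth h x.2) | x <- s].
exists s'; split.
  move=> x /s's[y /mapP[z zs ->] [a ->]] /=; by rewrite innerZl orthK// mulr0.
apply: le_trans (chaos_var_fourth isoW p us h1).
rewrite ler_pM2l ?mulr_gt0 ?ltr0n// ex_chaos_dist// -sE.
have ud : unit_comb [seq (x.1 * inner x.2 h, x.2) | x <- s].
  by move=> x /mapP[y ys ->]; exact: (us y ys).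
rewrite ex_chaos_sqr// lerXn2r ?nnegrE ?mulr_ge0 ?sqr_ge0//.
apply: (@le_trans _ _ (p.+2`!%:R * (p.+2%:R *
    `|tpow_comb (T p.+1) [seq (x.1 * inner x.2 h, x.2) | x <- s]| ^+ 2))).
  by rewrite ler_wpM2l//; exact: tpow_comb_proj_dist.
rewrite factS natrM le_eqVlt; apply/orP; left; apply/eqP; ring.
Qed.

End MultipleIntegral.

(** * Asymptotic covariances with cosines and with square integrable variables *)

Section Mixing.
Context {R : realType} {H : hilbertType R}.
Context d {Omega : measurableType d} (P : probability Omega R).

Definition cov (f g : Omega -> R) : R := ex P (fun w => f w * g w) - ex P f * ex P g.

Lemma ex_mul_bnd (f g : Omega -> R) (eps : R) : sqint P f -> measurable_fun setT g ->
  (forall w, `|g w| <= 1) -> 0 <= eps -> ex P (fun w => f w ^+ 2) <= eps ^+ 2 ->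
  `|ex P (fun w => f w * g w)| <= eps.
Proof.
move=> sf mg g1 eps0 fe; have sg := sqint_bnd P mg g1.
rewrite -(@ler_pXn2r _ 2) ?nnegrE// real_normK ?num_real//.
apply: le_trans (ex_CS sf sg) _; apply: le_trans fe.
rewrite ler_piMr//; first by apply: ex_ge0 => w; exact: sqr_ge0.
rewrite -[leRHS](ex_cst P); apply: ex_le; [exact: sg.2|exact: intg_cst|move=> w].
by rewrite -real_normK ?num_real// exprn_ile1.
Qed.

(** The expected product and the product of means each move by at most eps, since |g| <= 1; hence
    the factor 2. *)
Lemma cov_close (f f' g : Omega -> R) (eps : R) : sqint P f -> sqint P f' ->
  measurable_fun setT g -> (forall w, `|g w| <= 1) -> 0 <= eps ->
  ex P (fun w => (f w - f' w) ^+ 2) <= eps ^+ 2 -> `|cov f g - cov f' g| <= 2 * eps.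
Proof.
move=> sf sf' mg g1 eps0 fe; have sg := sqint_bnd P mg g1.
have sd := sqintB sf sf'.
have h1 := ex_mul_bnd sd mg g1 eps0 fe.
have h2 := ex_mul_bnd sd (@measurable_cst _ _ _ _ setT (1 : R))
  (fun w => eq_ind_r (fun x => x <= 1) (lexx (1 : R)) (normr1 R)) eps0 fe.
have -> : cov f g - cov f' g =
    ex P (fun w => (f w - f' w) * g w) - ex P (fun w => (f w - f' w) * 1) * ex P g.
  have -> : (fun w => (f w - f' w) * g w) = (fun w => f w * g w - f' w * g w).
    by apply/funext => w; rewrite mulrBl.
  have -> : (fun w => (f w - f' w) * 1) = (fun w => f w - f' w).
    by apply/funext => w; rewrite mulr1.
  rewrite (exB (sqintM sf sg) (sqintM sf' sg)) (exB (sqint_intg sf) (sqint_intg sf')).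
  by rewrite /cov; ring.
have h3 : `|ex P g| <= 1.
  by rewrite -[leRHS](ex_cst P); apply: ex_norm_le => //; [exact: sqint_intg|exact: intg_cst].
apply: le_trans (ler_normB _ _) _; rewrite normrM mulr_natl mulr2n lerD//.
by rewrite -[leRHS]mulr1 ler_pM.
Qed.

Lemma cov_linr (f g h : Omega -> R) a : sqint P f -> sqint P g -> sqint P h ->
  cov f (fun w => a * g w + h w) = a * cov f g + cov f h.
Proof.
move=> sf sg sh; rewrite /cov.
have -> : (fun w => f w * (a * g w + h w)) = (fun w => a * (f w * g w) + f w * h w).
  by apply/funext => w; ring.
have i1 := sqintM sf sg; have i2 := sqintM sf sh.
rewrite (exD (intgZ a i1) i2) (exZ _ i1).
rewrite (exD (intgZ a (sqint_intg sg)) (sqint_intg sh)) (exZ _ (sqint_intg sg)); ring.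
Qed.

Lemma cov_linl (f g h : Omega -> R) a : sqint P f -> sqint P g -> sqint P h ->
  cov (fun w => a * g w + h w) f = a * cov g f + cov h f.
Proof.
move=> sf sg sh; have := cov_linr a sf sg sh; rewrite /cov.
have C u v : ex P (fun w => u w * v w) = ex P (fun w => v w * u w).
  by congr ex; apply/funext => w; rewrite mulrC.
rewrite C mulrC => ->; rewrite (C f g) (C f h); ring.
Qed.

Lemma cov_cstr (f : Omega -> R) a : sqint P f -> cov f (fun=> a) = 0.
Proof.
move=> sf; rewrite /cov ex_cst.
have -> : (fun w => f w * a) = (fun w => a * f w) by apply/funext => w; rewrite mulrC.
by rewrite exZ; [ring|exact: sqint_intg].
Qed.

Variable W : H -> {RV P >-> R}.
Hypothesis isoW : isonormal W.

Lemma sqint_tent a b (f : Omega -> R) : measurable_fun setT f ->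
  sqint P (fun w => tent (a * f w + b)).
Proof.
move=> mf; apply: (@sqint_bnd _ _ _ _ _ 1) => [|w]; last exact: tent_norm.
exact: measurableT_comp (measurable_tent a b) mf.
Qed.

Lemma tent_close a b (f g : Omega -> R) : sqint P f -> sqint P g ->
  ex P (fun w => (tent (a * f w + b) - tent (a * g w + b)) ^+ 2)
    <= (2 * a) ^+ 2 * ex P (fun w => (f w - g w) ^+ 2).
Proof.
move=> sf sg; have sd := sqintB sf sg.
rewrite -exZ; last exact: sd.2.
apply: ex_le; [exact: (sqintB (sqint_tent a b sf.1) (sqint_tent a b sg.1)).2|exact: intgZ sd.2|].
move=> w; rewrite -[leLHS]real_normK ?num_real//.
have -> : (2 * a) ^+ 2 * (f w - g w) ^+ 2 = (2 * `|a * f w + b - (a * g w + b)|) ^+ 2.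
  rewrite exprMn [RHS]exprMn real_normK ?num_real//; ring.
by rewrite lerXn2r ?nnegrE ?mulr_ge0// tent_lip.
Qed.

(** The tent is an L^2 limit of cosine sums over the orthogonal of g, and each such cosine factors
    exactly against [cosW W g c] by [ex_cosW_orth]. *)
Lemma cov_chaos_orth p s a b g c : (forall x, x \in s -> inner x.2 g = 0) ->
  cov (fun w => tent (a * chaos_var W p s w + b)) (cosW W g c) = 0.
Proof.
move=> sg; have mX := (allmom_chaos_var isoW p s).1.
have st := sqint_tent a b mX.
apply/eqP; rewrite -normr_eq0 eq_le normr_ge0 andbT; apply/ler_addgt0Pl => eps eps0.
rewrite addr0; have e2 : 0 < eps / 2 by rewrite divr_gt0.
have K_lin : forall (r : R) x y, inner x g = 0 -> inner y g = 0 -> inner (r *: x + y) g = 0.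
  by move=> r x y xg yg; rewrite inner_linl xg yg mulr0 addr0.
have [t Kt tE] := tent_chaos_trig isoW (K := fun x => inner x g = 0) K_lin (inner0l g) p a b sg
  (exprn_gt0 2 e2).
have := cov_close st (sqint_trig W t) (measurable_cosW W g c) (cosW_le1 W g c) (ltW e2) tE.
suff -> : cov (trig W t) (cosW W g c) = 0 by rewrite subr0 mulrC divfK.
elim: t Kt {tE} => [|x t IH] Kt.
  have -> : trig W [::] = (fun=> 0) by apply/funext => w; rewrite /trig big_nil.
  rewrite /cov; under eq_fun do rewrite mul0r.
  by rewrite ex_cst mul0r subrr.
have -> : trig W (x :: t) = (fun w => x.1.1 * cosW W x.2 x.1.2 w + trig W t w).
  by apply/funext => w; rewrite /trig big_cons.
rewrite (cov_linl _ (sqint_cosW W g c) (sqint_cosW W _ _) (sqint_trig W t)).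
rewrite IH; last by move=> y yt; apply: Kt; rewrite inE yt orbT.
by rewrite /cov (ex_cosW_orth isoW) ?subrr ?mulr0 ?addr0//; exact: (Kt x (mem_head _ _)).
Qed.

Variables (p : nat) (s : nat -> seq (R * H)).
Local Notation X := (fun N => chaos_var W p (s N)).
Hypothesis asym_orth : forall h, `|h| = 1 -> forall eps : R, 0 < eps ->
  \forall N \near \oo, exists s' : seq (R * H), (forall x, x \in s' -> inner x.2 h = 0) /\
     ex P (fun w => (chaos_var W p (s N) w - chaos_var W p s' w) ^+ 2) <= eps.
Variables (a b : R).
Local Notation Y := (fun N w => tent (a * chaos_var W p (s N) w + b)).

Let sY N : sqint P (Y N).
Proof. by apply: sqint_tent; exact: (allmom_chaos_var isoW p (s N)).1. Qed.

(** [asym_orth] is applied to g / |g|: the tent of the projected variable is exactly uncorrelated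
    with the cosine, and [tent_close] with [cov_close] bounds the cost of projecting. *)
Lemma cov_cosW g c (eps : R) : 0 < eps ->
  \forall N \near \oo, `|cov (Y N) (cosW W g c)| <= eps.
Proof.
move=> eps0; have [g0|g0] := eqVneq g 0.
  apply: nearW => N; rewrite cov_chaos_orth; first by rewrite normr0 ltW.
  by move=> x _; rewrite g0 inner0r.
pose h := `|g|^-1 *: g.
have h1 : `|h| = 1 by rewrite normrZ normfV normr_id mulVf ?normr_eq0.
have gh : g = `|g| *: h by rewrite scalerA divff ?normr_eq0// scale1r.
pose k : R := (2 * a) ^+ 2 + 1; have k0 : 0 < k by rewrite ltr_wpDl ?sqr_ge0.
have e0 : 0 < (eps / 2) ^+ 2 / k by rewrite divr_gt0// exprn_gt0// divr_gt0.
apply: filterS (asym_orth h1 e0) => N [s' [s'h s'E]].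
have sX u : sqint P (chaos_var W p u) by exact/allmom_sqint/allmom_chaos_var.
have close : ex P (fun w => (tent (a * chaos_var W p (s N) w + b) -
     tent (a * chaos_var W p s' w + b)) ^+ 2) <= (eps / 2) ^+ 2.
  apply: le_trans (tent_close a b (sX _) (sX _)) _.
  apply: (@le_trans _ _ (k * ((eps / 2) ^+ 2 / k))); last by rewrite mulrC divfK// gt_eqF.
  apply: ler_pM => //; rewrite ?sqr_ge0// ?lerDl//.
  by apply: ex_ge0 => w; exact: sqr_ge0.
have e2 : 0 <= eps / 2 by rewrite divr_ge0// ltW.
have := cov_close (sY N) (sqint_tent a b (sX s').1) (measurable_cosW W g c) (cosW_le1 W g c) e2 close.
rewrite [X in _ - X]cov_chaos_orth; first by rewrite subr0 mulrC divfK.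
by move=> x xs; rewrite gh innerZr s'h// mulr0.
Qed.

Lemma cov_trig t (eps : R) : 0 < eps ->
  \forall N \near \oo, `|cov (Y N) (trig W t)| <= eps.
Proof.
elim: t eps => [|x t IH] eps eps0.
  apply: nearW => N; have -> : trig W [::] = (fun=> 0).
    by apply/funext => w; rewrite /trig big_nil.
  by rewrite cov_cstr// normr0 ltW.
have e2 : 0 < eps / 2 by rewrite divr_gt0.
have k0 : 0 < `|x.1.1| + 1 by rewrite ltr_wpDl.
have e1 : 0 < eps / 2 / (`|x.1.1| + 1) by rewrite divr_gt0.
apply: (filterS2 _ _ (IH _ e2) (cov_cosW x.2 x.1.2 e1)) => N h1 h2.
have -> : trig W (x :: t) = (fun w => x.1.1 * cosW W x.2 x.1.2 w + trig W t w).
  by apply/funext => w; rewrite /trig big_cons.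
rewrite (cov_linr _ (sY N) (sqint_cosW W _ _) (sqint_trig W t)).
apply: le_trans (ler_normD _ _) _; rewrite [leRHS]splitr lerD// normrM.
apply: (@le_trans _ _ ((`|x.1.1| + 1) * (eps / 2 / (`|x.1.1| + 1)))).
  by apply: ler_pM => //; rewrite lerDl.
by rewrite mulrC divfK// gt_eqF.
Qed.

(* A near minimizer of E (U - trig t)^2 stands in for the orthogonal projection on
   the closure of the trigonometric sums. *)
Lemma trig_near_projection (U : Omega -> R) (del : R) : sqint P U -> 0 < del ->
  exists t, forall v, ex P (fun w => (U w - trig W t w) * trig W v w) ^+ 2
    <= del * ex P (fun w => trig W v w ^+ 2).
Proof.
move=> sU del0; pose q t := ex P (fun w => (U w - trig W t w) ^+ 2).
pose Q : set R := [set r | exists t, r = q t].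
have q0 t : 0 <= q t by apply: ex_ge0 => w; exact: sqr_ge0.
have Qinf : has_inf Q.
  split; first by exists (q [::]), [::].
  by exists 0 => r [t ->].
have [_ [t ->] qt] := inf_adherent del0 Qinf.
exists t => v.
have sR : sqint P (fun w => U w - trig W t w) by apply: sqintB => //; exact: sqint_trig.
have sv : sqint P (trig W v) := sqint_trig W v.
set e := ex P (fun w => (U w - trig W t w) * trig W v w); set b2 := ex P (fun w => trig W v w ^+ 2).
(* Moving [t] by tau times [v] stays among the cosine sums, so it cannot lower the squared distance
   by more than [del]; tau = e / b2 is then optimal. *)
have key tau : 0 <= del - 2 * tau * e + tau ^+ 2 * b2.
  have [u _ uE] := @trigK_lin _ _ _ _ _ W (fun=> True) tau v t (fun _ _ => Logic.I) (fun _ _ => Logic.I).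
  have : inf Q <= q u by apply: ge_inf; [exact: Qinf.2|exists u].
  have -> : q u = q t - 2 * tau * e + tau ^+ 2 * b2.
    have -> : q u = ex P (fun w => ((U w - trig W t w) ^+ 2 +
        (- (2 * tau)) * ((U w - trig W t w) * trig W v w)) + tau ^+ 2 * trig W v w ^+ 2).
      by congr ex; apply/funext => w; rewrite uE; ring.
    have i1 := sqintM sR sv.
    rewrite (exD (intgD sR.2 (intgZ _ i1)) (intgZ _ sv.2)) (exD sR.2 (intgZ _ i1)).
    by rewrite (exZ _ i1) (exZ _ sv.2) -/(q t) mulNr.
  by move: qt; lra.
have b20 : 0 <= b2 by apply: ex_ge0 => w; exact: sqr_ge0.
have CS : e ^+ 2 <= q t * b2 by exact: ex_CS.
move: b20; rewrite le_eqVlt => /orP[/eqP b20|b20].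
  by move: CS; rewrite -b20 !mulr0.
have := key (e / b2).
have -> : del - 2 * (e / b2) * e + (e / b2) ^+ 2 * b2 = (del * b2 - e ^+ 2) / b2.
  by field; rewrite gt_eqF.
by rewrite pmulr_lge0 ?invr_gt0// subr_ge0.
Qed.

(** The centring constant is the entry with vector 0 and phase 0. *)
Lemma tent_centered_trig N (eta : R) : 0 < eta -> exists v,
  ex P (fun w => ((Y N w - ex P (Y N)) - trig W v w) ^+ 2) <= eta.
Proof.
move=> eta0.
have [t _ tE] := tent_chaos_trig isoW (K := fun=> True) (fun _ _ _ _ _ => Logic.I) Logic.I p a b
  (s := s N) (fun _ _ => Logic.I) eta0.
exists ((- ex P (Y N), 0, 0) :: t); apply: le_trans tE.
rewrite le_eqVlt; apply/orP; left; apply/eqP.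
have mt u : measurable_fun setT (trig W u) := (sqint_trig W u).1.
have mY : measurable_fun setT (Y N) := (sY N).1.
apply: ex_ae.
- by apply: measurable_funX; apply: measurable_funB => //; exact: measurable_funB.
- by apply: measurable_funX; exact: measurable_funB.
apply: filterS (W_lin isoW (-1) 0 0) => w; rewrite scaler0 addr0 mulN1r addNr => W0.
have -> : trig W ((- ex P (Y N), 0, 0) :: t) w = - ex P (Y N) + trig W t w.
  by rewrite /trig big_cons /cosW /= W0 addr0 cos0 mulr1.
by congr (_ ^+ 2); ring.
Qed.

(** U splits into a cosine sum, settled by [cov_trig], and a remainder nearly orthogonal to all
    cosine sums. The centred [Y N] is an L^2 limit of such sums and has second moment at most 4, so
    its covariance with the remainder is small uniformly in N. *)
Lemma cov_sqint (U : Omega -> R) (eps : R) : sqint P U -> 0 < eps ->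
  \forall N \near \oo, `|cov (Y N) U| <= eps.
Proof.
move=> sU eps0.
have e2 : 0 < eps / 2 by rewrite divr_gt0.
(* 16 = 2 * 8: E J^2 <= 4 yields E (trig v)^2 <= 8 + 2 eta, and (x + y)^2 <= 2 x^2 + 2 y^2 doubles
   it; eta is then sent to 0. *)
pose del := (eps / 2) ^+ 2 / 16; have del0 : 0 < del by rewrite divr_gt0// exprn_gt0.
have [t tE] := trig_near_projection sU del0.
apply: filterS (cov_trig t e2) => N cN.
pose U2 w := U w - trig W t w.
have sU2 : sqint P U2 by apply: sqintB => //; exact: sqint_trig.
have -> : cov (Y N) U = cov (Y N) (trig W t) + cov (Y N) U2.
  rewrite -[cov _ (trig W t)]mul1r -(cov_linr _ (sY N) (sqint_trig W t) sU2).
  by congr cov; apply/funext => w; rewrite /U2; ring.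
apply: le_trans (ler_normD _ _) _; rewrite [leRHS]splitr lerD//.
set J := fun w => Y N w - ex P (Y N).
have sJ : sqint P J by apply: sqintB; [exact: sY|exact: sqint_cst].
have -> : cov (Y N) U2 = ex P (fun w => U2 w * J w).
  have -> : (fun w => U2 w * J w) = (fun w => Y N w * U2 w - ex P (Y N) * U2 w).
    by apply/funext => w; rewrite /J; ring.
  rewrite (exB (sqintM (sY N) sU2) (intgZ _ (sqint_intg sU2))).
  by rewrite (exZ _ (sqint_intg sU2)).
have exY : `|ex P (Y N)| <= 1.
  rewrite -[leRHS](ex_cst P); apply: ex_norm_le; [exact/sqint_intg/sY|exact: intg_cst|].
  by move=> w; exact: tent_norm.
have J2 : ex P (fun w => J w ^+ 2) <= 4.
  rewrite -[leRHS](ex_cst P); apply: ex_le; [exact: sJ.2|exact: intg_cst|move=> w].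
  have -> : 4 = 2 ^+ 2 :> R by ring.
  rewrite -[leLHS]real_normK ?num_real// lerXn2r ?nnegrE//.
  apply: le_trans (ler_normB _ _) _.
  by have := tent_norm (a * chaos_var W p (s N) w + b); move: exY; lra.
set z := ex P (fun w => U2 w ^+ 2).
have z0 : 0 <= z by apply: ex_ge0 => w; exact: sqr_ge0.
pose e := ex P (fun w => U2 w * J w).
have key eta : 0 < eta -> e ^+ 2 <= 2 * (del * (8 + 2 * eta)) + 2 * (z * eta).
  move=> eta0; have [v vE] := tent_centered_trig N eta0.
  have sv := sqint_trig W v; have sD := sqintB sJ sv.
  have eE : e = ex P (fun w => U2 w * trig W v w) + ex P (fun w => U2 w * (J w - trig W v w)).
    rewrite -(exD (sqintM sU2 sv) (sqintM sU2 sD)); congr ex; apply/funext => w.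
    by ring.
  have h1 : ex P (fun w => trig W v w ^+ 2) <= 8 + 2 * eta.
    apply: (@le_trans _ _ (ex P (fun w => 2 * J w ^+ 2 + 2 * (J w - trig W v w) ^+ 2))).
      apply: ex_le; [exact: sv.2|exact: intgD (intgZ 2 sJ.2) (intgZ 2 sD.2)|move=> w].
      by have := sqr_ge0 (2 * J w - trig W v w); nra.
    rewrite (exD (intgZ 2 sJ.2) (intgZ 2 sD.2)) (exZ _ sJ.2) (exZ _ sD.2).
    by move: vE J2; rewrite -/J; lra.
  have h2 := tE v; rewrite -/U2 in h2.
  have h3 := ex_CS sU2 sD; rewrite -/z in h3.
  have h4 : z * ex P (fun w => (J w - trig W v w) ^+ 2) <= z * eta by rewrite ler_wpM2l.
  have h5 : del * ex P (fun w => trig W v w ^+ 2) <= del * (8 + 2 * eta).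
    by rewrite ler_wpM2l// ltW.
  have h6 := le_trans h2 h5; have h7 := le_trans h3 h4.
  rewrite eE; set x := ex P (fun w => U2 w * trig W v w) in h6 *.
  set y := ex P (fun w => U2 w * (J w - trig W v w)) in h7 *.
  by have := sqr_ge0 (x - y); nra.
have : e ^+ 2 <= 16 * del.
  apply/ler_addgt0Pr => c c0.
  have k0 : 0 < 4 * del + 2 * z + 1 by rewrite ltr_pwDr// addr_ge0// mulr_ge0// ltW.
  have := key (c / (4 * del + 2 * z + 1)) (divr_gt0 c0 k0).
  set eta := c / _.
  have ce : eta * (4 * del + 2 * z + 1) = c by rewrite divfK// gt_eqF.
  have eta0 : 0 < eta by rewrite divr_gt0.
  move: ce; nra.
have -> : 16 * del = (eps / 2) ^+ 2 by rewrite /del mulrC divfK.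
rewrite -/e => h; rewrite -(@ler_pXn2r _ 2) ?nnegrE ?real_normK ?num_real//.
exact: ltW e2.
Qed.

End Mixing.

(** * Joint convergence *)

Section TentInterpolation.
Context {R : realType}.

(** Second differences telescope to first differences. *)
Lemma tent_sum m (t : R) : \sum_(i < m) tent (t - i%:R) =
  ((`|t + 1| - `|t|) - (`|t - m%:R + 1| - `|t - m%:R|)) / 2.
Proof.
elim: m => [|m IH]; first by rewrite big_ord0 subr0 subrr mul0r.
rewrite big_ord_recr/= IH /tent -[m.+1%:R]natr1.
have -> : t - (m%:R + 1) + 1 = t - m%:R by ring.
have -> : t - (m%:R + 1) = t - m%:R - 1 by ring.
by field.
Qed.

Lemma tent_sum_le1 m (t : R) : \sum_(i < m) tent (t - i%:R) <= 1.
Proof.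
rewrite tent_sum.
have h1 : `|t + 1| - `|t| <= 1 by rewrite lerBlDl -{2}(normr1 R) ler_normD.
have h2 : `|t - m%:R| - `|t - m%:R + 1| <= 1.
  rewrite lerBlDl; have := ler_normB (t - m%:R + 1) 1.
  by rewrite addrK normr1.
by lra.
Qed.

Lemma tent_sum1 m (t : R) : 0 <= t -> t <= m%:R -> \sum_(i < m.+1) tent (t - i%:R) = 1.
Proof.
move=> t0 tm; rewrite tent_sum -[m.+1%:R]natr1 (ger0_norm t0) ger0_norm ?addr_ge0//.
by rewrite !ler0_norm; [field|lra|lra].
Qed.

Lemma tent_gt0 (x : R) : tent x != 0 -> `|x| < 1.
Proof.
rewrite tentE; apply: contraNT; rewrite -leNgt => x1.
by rewrite max_l// subr_le0.
Qed.

(** Heine-Cantor with only the first point confined to the square; compactness is used as a covering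
    property shared by a point and a small [del]. *)
Lemma uniform_continuous_square (Phi : R * R -> R) (L eps : R) : continuous Phi -> 0 < eps ->
  exists2 del, 0 < del & forall x y x' y', `|x| <= L -> `|y| <= L ->
    `|x - x'| < del -> `|y - y'| < del -> `|Phi (x, y) - Phi (x', y')| <= eps.
Proof.
move=> cPhi eps0.
pose A := `[- L, L] `*` `[- L, L] : set (R * R).
have cA : compact A by apply: compact_setX; exact: segment_compact.
have /compact_near_coveringP nc := cA.
pose Q (del : R) (z : R * R) := forall x' y', `|z.1 - x'| < del -> `|z.2 - y'| < del ->
  `|Phi z - Phi (x', y')| <= eps.
have /nc : forall z, A z -> \forall z' \near z & del \near 0^'+, Q del z'.
  move=> z _.
  have e2 : 0 < eps / 2 by rewrite divr_gt0.
  have /cvgrPdist_le /(_ _ e2) := cPhi z.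
  rewrite -filter_from_ballE => -[r /= r0 rB].
  have r2 : 0 < r / 2 by rewrite divr_gt0.
  exists (ball z (r / 2), [set del | 0 < del < r / 2]) => /=.
    split; first exact: nbhsx_ballx.
    near=> del; apply/andP; split; near: del; [exact: nbhs_right_gt|exact: nbhs_right_lt].
  move=> [z' del] [/= [zz1 zz2] /andP[del0 delr]] x' y' h1 h2.
  rewrite /ball/= in zz1 zz2.
  have b1 : ball z r z' by split; rewrite /ball/=; apply: lt_trans zz1 _ || apply: lt_trans zz2 _; lra.
  have b2 : ball z r (x', y').
    split; rewrite /ball/=.
    - have -> : z.1 - x' = (z.1 - z'.1) + (z'.1 - x') by ring.
      by apply: le_lt_trans (ler_normD _ _) _; move: zz1 h1 delr => /=; lra.
    - have -> : z.2 - y' = (z.2 - z'.2) + (z'.2 - y') by ring.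
      by apply: le_lt_trans (ler_normD _ _) _; move: zz2 h2 delr => /=; lra.
  have c1 := rB _ b1; have c2 := rB _ b2.
  have -> : Phi z' - Phi (x', y') = (Phi z - Phi (x', y')) - (Phi z - Phi z') by ring.
  by apply: le_trans (ler_normB _ _) _; move: c1 c2 => /=; lra.
move=> nQ.
have [del [del0 Qdel]] : exists del, 0 < del /\ A `<=` Q del.
  have : \forall del \near 0^'+, 0 < del /\ A `<=` Q del.
    by near=> del; split; near: del; [exact: nbhs_right_gt|exact: nQ].
  by move/filter_ex.
exists del => // x y x' y' xL yL; apply: (Qdel (x, y)).
by split; rewrite /= in_itv/= -ler_norml.
Unshelve. all: by end_near. Qed.

Definition tent_grid m (a : R) (b : nat -> R) (c : nat -> nat -> R) (x y : R) : R :=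
  \sum_(i < m) \sum_(j < m) c i j * (tent (a * x + b i) * tent (a * y + b j)).

(** Interpolation at grid nodes. Products of tents form a partition of unity on the square, each
    supported within one mesh of its node, which gives the uniform error; their total mass is at
    most 1 everywhere, which gives the bound B off the square. *)
Lemma tent_grid_approx (Phi : R * R -> R) (B L eps : R) : continuous Phi ->
  (forall z, `|Phi z| <= B) -> 0 < L -> 0 < eps ->
  exists m a b c,
    (forall x y, `|x| <= L -> `|y| <= L -> `|Phi (x, y) - tent_grid m a b c x y| <= eps) /\
    (forall x y, `|tent_grid m a b c x y| <= B).
Proof.
move=> cPhi PhiB L0 eps0.
have [del del0 uc] := uniform_continuous_square L cPhi eps0.
have [n nL] : exists n, L / del < n.+1%:R.
  by exists (Num.truncn (L / del)); exact: Num.Theory.truncnS_gt.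
pose r := L / n.+1%:R; have r0 : 0 < r by rewrite divr_gt0// ltr0n.
have rdel : r < del by rewrite ltr_pdivrMr ?ltr0n// mulrC -ltr_pdivrMr.
have nr : n.+1%:R * r = L by rewrite mulrC divfK// pnatr_eq0.
pose a := r^-1; pose b (i : nat) : R := n.+1%:R - i%:R.
pose x_ (i : nat) : R := (i%:R - n.+1%:R) * r.
pose c i j := Phi (x_ i, x_ j).
(* From -L to L with step r there are 2 (n + 1) intervals, hence one more node. *)
pose m := (n.+1 + n.+1).+1.
have tE x (i : nat) : tent (a * x + b i) = tent (a * x + n.+1%:R - i%:R) by rewrite /b addrA.
have t1 x : \sum_(i < m) tent (a * x + b i) <= 1.
  under eq_bigr do rewrite tE.
  exact: tent_sum_le1.
have t1E x : `|x| <= L -> \sum_(i < m) tent (a * x + b i) = 1.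
  move=> xL; under eq_bigr do rewrite tE.
  have : `|a * x| <= n.+1%:R.
    by rewrite normrM /a gtr0_norm ?invr_gt0// mulrC ler_pdivrMr// nr.
  rewrite ler_norml => /andP[h1 h2].
  by apply: tent_sum1; rewrite ?natrD; lra.
have tx x (i : nat) : tent (a * x + b i) != 0 -> `|x - x_ i| < del.
  move=> /tent_gt0 h; apply: lt_trans rdel.
  have -> : x - x_ i = r * (a * x + b i) by rewrite /x_ /a /b; field; rewrite gt_eqF.
  by rewrite normrM gtr0_norm// -[ltRHS]mulr1 ltr_pM2l.
have mass0 x y : 0 <= (\sum_(i < m) tent (a * x + b i)) * (\sum_(j < m) tent (a * y + b j)).
  by apply: mulr_ge0; apply: sumr_ge0 => i _; exact: tent_ge0.
have mass1 x y : (\sum_(i < m) tent (a * x + b i)) * (\sum_(j < m) tent (a * y + b j)) <= 1.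
  by rewrite -[leRHS]mulr1; apply: ler_pM => //; apply: sumr_ge0 => i _; exact: tent_ge0.
have massE x y : (\sum_(i < m) tent (a * x + b i)) * (\sum_(j < m) tent (a * y + b j)) =
    \sum_(i < m) \sum_(j < m) tent (a * x + b i) * tent (a * y + b j).
  by rewrite mulr_suml; apply: eq_bigr => i _; rewrite mulr_sumr.
(* Serves twice: with coefficients c i j for the global bound, and with Phi (x, y) - c i j for the
   error, where a nonzero tent puts the node within [del]. *)
have grid_le (e : nat -> nat -> R) x y K : 0 <= K ->
    (forall i j, tent (a * x + b i) != 0 -> tent (a * y + b j) != 0 -> `|e i j| <= K) ->
    `|tent_grid m a b e x y| <= K.
  move=> K0 eK; apply: (@le_trans _ _ (K * ((\sum_(i < m) tent (a * x + b i)) * (\sum_(j < m) tent (a * y + b j))))); last first.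
    by rewrite -[leRHS]mulr1 ler_wpM2l.
  rewrite massE mulr_sumr; apply: le_trans (ler_norm_sum _ _ _) _.
  apply: ler_sum => i _; rewrite mulr_sumr; apply: le_trans (ler_norm_sum _ _ _) _.
  apply: ler_sum => j _; rewrite normrM.
  have p0 : 0 <= tent (a * x + b i) * tent (a * y + b j) by rewrite mulr_ge0// tent_ge0.
  rewrite [`|_ * tent _|]ger0_norm//.
  have [->|ti] := eqVneq (tent (a * x + b i)) 0; first by rewrite mul0r !mulr0.
  have [->|tj] := eqVneq (tent (a * y + b j)) 0; first by rewrite !mulr0.
  by rewrite ler_wpM2r// eK.
exists m, a, b, c; split=> [x y xL yL|x y]; last first.
  by apply: grid_le => [|i j _ _]; [exact: le_trans (normr_ge0 (Phi (0, 0))) _|exact: PhiB].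
have -> : Phi (x, y) - tent_grid m a b c x y =
    tent_grid m a b (fun i j => Phi (x, y) - c i j) x y.
  rewrite -[Phi (x, y) in LHS]mulr1 -[1 in LHS](mulr1 1) -{1}(t1E x xL) -{1}(t1E y yL) massE.
  rewrite mulr_sumr -sumrB; apply: eq_bigr => i _; rewrite mulr_sumr -sumrB.
  by apply: eq_bigr => j _; rewrite -mulrBl.
by apply: grid_le => [|i j ti tj]; [exact: ltW|apply: uc => //; exact: tx].
Qed.

End TentInterpolation.

Section Laws.
Context {R : realType}.

Lemma equal_law_ex d d' (Omega : measurableType d) (Omega' : measurableType d')
    (P : probability Omega R) (P' : probability Omega' R)
    (X : {RV P >-> R}) (X' : {RV P' >-> R}) (f : R -> R) :
  has_law X' (distribution P X) -> measurable_fun setT f -> (forall x, 0 <= f x) ->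
  ex P' (fun w => f (X' w)) = ex P (fun w => f (X w)).
Proof.
move=> XL mf f0; rewrite /ex /Rintegral; congr fine.
have mF : measurable_fun setT (EFin \o f) by exact/measurable_EFinP.
have F0 x : (0 <= (EFin \o f) x)%E by rewrite lee_fin.
rewrite -[LHS](ge0_integral_distribution X' mF F0) -[RHS](ge0_integral_distribution X mF F0).
by apply: eq_measure_integral => A mA _; exact: XL.
Qed.

(** Independence on rectangles is what [product_measure_unique] asks in order to identify the joint
    law with the product of the laws; Tonelli then applies to nonnegative f and g. *)
Lemma independent_ex d (Omega : measurableType d) (P : probability Omega R)
    (X Y : {RV P >-> R}) (f g : R -> R) : independent_RV X Y ->
  measurable_fun setT f -> measurable_fun setT g ->
  (forall x, 0 <= f x <= 1) -> (forall x, 0 <= g x <= 1) ->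
  ex P (fun w => f (X w) * g (Y w)) = ex P (fun w => f (X w)) * ex P (fun w => g (Y w)).
Proof.
move=> XY mf mg f01 g01.
have f0 x : 0 <= f x by case/andP: (f01 x).
have g0 x : 0 <= g x by case/andP: (g01 x).
have mXY : measurable_fun setT (fun w => (X w, Y w)).
  by apply: measurable_fun_pair; exact: measurable_funP.
pose XYm : {mfun Omega >-> (R * R)%type} :=
  HB.pack (fun w => (X w, Y w)) (isMeasurableFun.Build _ _ _ _ _ mXY).
have prodE := @product_measure_unique _ _ R R R (distribution P X) (distribution P Y)
  (distribution P XYm) (fun A B mA mB => XY A B mA mB).
pose F (z : (R * R)%type) : \bar R := (f z.1 * g z.2)%:E.
have mF : measurable_fun setT F.
  apply/measurable_EFinP; apply: measurable_funM.
    by apply: (measurableT_comp mf); exact: measurable_fst.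
  by apply: (measurableT_comp mg); exact: measurable_snd.
have F0 z : (0 <= F z)%E by rewrite lee_fin mulr_ge0.
have if_ : intg P (fun w => f (X w)).
  apply: (@intg_bnd _ _ _ _ _ 1); first exact: measurableT_comp.
  by move=> w; rewrite ger0_norm//; case/andP: (f01 (X w)).
have ig_ : intg P (fun w => g (Y w)).
  apply: (@intg_bnd _ _ _ _ _ 1); first exact: measurableT_comp.
  by move=> w; rewrite ger0_norm//; case/andP: (g01 (Y w)).
have ifg : intg P (fun w => f (X w) * g (Y w)).
  apply: (@intg_bnd _ _ _ _ _ 1); first by apply: measurable_funM; exact: measurableT_comp.
  move=> w; rewrite ger0_norm ?mulr_ge0// -[leRHS]mulr1.
  by apply: ler_pM => //; [case/andP: (f01 (X w))|case/andP: (g01 (Y w))].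
apply: EFin_inj; rewrite EFinM -(exE ifg) -(exE if_) -(exE ig_) !unlock.
rewrite -[LHS](ge0_integral_distribution XYm mF F0).
rewrite -(eq_measure_integral _ (fun A mA _ => prodE A mA)) fubini_tonelli1//.
have mfE : measurable_fun setT (EFin \o f) by exact/measurable_EFinP.
have mgE : measurable_fun setT (EFin \o g) by exact/measurable_EFinP.
have fE0 x : (0 <= (EFin \o f) x)%E by rewrite lee_fin.
have gE0 x : (0 <= (EFin \o g) x)%E by rewrite lee_fin.
rewrite -[X in (X * _)%E](ge0_integral_distribution X mfE fE0).
rewrite -[X in (_ * X)%E](ge0_integral_distribution Y mgE gE0).
rewrite -ge0_integralZr//; last exact: integral_ge0.
apply: eq_integral => x _; rewrite /fubini_F/= /F/=.
by under eq_integral do rewrite EFinM; rewrite ge0_integralZl_EFin// => y _; rewrite lee_fin.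
Qed.

End Laws.

Section JointConvergence.
Context {R : realType}.

(** Phi is a pointwise limit of tent grids fitted on growing squares, and these are finite sums of
    products of measurable functions of one variable. *)
Lemma measurable_continuous_pair d (Omega : measurableType d) (X Y : Omega -> R)
    (Phi : R * R -> R) (B : R) : measurable_fun setT X -> measurable_fun setT Y ->
  continuous Phi -> (forall z, `|Phi z| <= B) -> measurable_fun setT (fun w => Phi (X w, Y w)).
Proof.
move=> mX mY cPhi PhiB.
have G n : exists g : R -> R -> R,
    measurable_fun setT (fun w => g (X w) (Y w)) /\
    (forall x y, `|x| <= n.+1%:R -> `|y| <= n.+1%:R -> `|Phi (x, y) - g x y| <= n.+1%:R^-1).
  have [m [a [b [c [gE _]]]]] := tent_grid_approx cPhi PhiB (ltr0Sn R n) (divr_gt0 ltr01 (ltr0Sn R n)).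
  rewrite div1r in gE.
  exists (tent_grid m a b c); split => //.
  apply: measurable_sum => i; apply: measurable_sum => j; apply: measurable_funM => //.
  by apply: measurable_funM; [exact: (measurableT_comp (measurable_tent _ _) mX)|exact: (measurableT_comp (measurable_tent _ _) mY)].
have [g gP] := choice G.
apply: (@measurable_fun_cvg _ _ _ _ (fun n w => g n (X w) (Y w))) => [n|w _]; first exact: (gP n).1.
apply/cvgrPdist_le => eps eps0; near=> n.
apply: (@le_trans _ _ n.+1%:R^-1).
  apply: (gP n).2; apply: (@le_trans _ _ (`|X w| + `|Y w|)); rewrite ?lerDl ?lerDr//.
    by apply: (@le_trans _ _ n%:R); [near: n; exact: nbhs_infty_ger|rewrite ler_nat].
  by apply: (@le_trans _ _ n%:R); [near: n; exact: nbhs_infty_ger|rewrite ler_nat].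
by apply: ltW; near: n; exact: (near_infty_natSinv_lt (PosNum eps0)).
Unshelve. all: by end_near. Qed.

(** Tightness of one variable in terms of tents: 1 - E tent (X / n) stands in for a tail
    probability. *)
Lemma ex_tent_to1 d (Omega : measurableType d) (P : probability Omega R) (X : Omega -> R) :
  measurable_fun setT X -> ex P (fun w => tent (n.+1%:R^-1 * X w + 0)) @[n --> \oo] --> (1 : R).
Proof.
move=> mX.
have [] := @dominated_convergence _ _ _ P setT measurableT
  (fun n w => (tent (n.+1%:R^-1 * X w + 0))%:E) (cst 1%E) (cst 1%E).
- by move=> n; apply/measurable_EFinP; exact: (measurableT_comp (measurable_tent _ _) mX).
- exact: measurable_cst.
- apply: aeW => w _; apply: cvg_EFin; first exact: nearW.
  rewrite [X in _ --> X](_ : _ = tent (0 * X w + 0)); last first.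
    by rewrite mul0r addr0 tentE normr0 subr0 max_r.
  apply: (@continuous_cvgn _ _ _ tent); first exact: continuous_tent.
  apply: (@cvgD _ R^o); last exact: cvg_cst.
  by apply: cvgM; [exact: cvg_harmonic|exact: cvg_cst].
- exact: finite_measure_integrable_cst.
- by apply: aeW => w n _; rewrite lee_fin tent_norm.
move=> _ _; rewrite integral_cst// [X in (1 * X)%E](@probability_setT _ _ _ P) mul1e => h.
exact: (fine_cvg h).
Qed.

(** Off the square some coordinate v has |v| > L, where 1 - tent (v / (2 L)) >= 1/2; the crude bound
    2 B on the difference is then at most 4 B times that defect. *)
Lemma ex_tent_grid_close d (Omega : measurableType d) (P : probability Omega R) (X Y : Omega -> R)
    (Phi : R * R -> R) (g : R -> R -> R) (B L eps : R) :
  measurable_fun setT X -> measurable_fun setT Y -> measurable_fun setT (fun w => g (X w) (Y w)) ->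
  continuous Phi -> (forall z, `|Phi z| <= B) -> (forall x y, `|g x y| <= B) ->
  0 < L -> 0 <= eps ->
  (forall x y, `|x| <= L -> `|y| <= L -> `|Phi (x, y) - g x y| <= eps) ->
  `|ex P (fun w => Phi (X w, Y w)) - ex P (fun w => g (X w) (Y w))| <= eps +
     4 * B * ((1 - ex P (fun w => tent ((2 * L)^-1 * X w + 0))) + (1 - ex P (fun w => tent ((2 * L)^-1 * Y w + 0)))).
Proof.
move=> mX mY mg cPhi PhiB gB L0 eps0 Pg.
have B0 : 0 <= B := le_trans (normr_ge0 _) (PhiB (0, 0)).
have iPhi : intg P (fun w => Phi (X w, Y w)).
  by apply: (@intg_bnd _ _ _ _ _ B) => //; exact: (measurable_continuous_pair mX mY cPhi PhiB).
have ig : intg P (fun w => g (X w) (Y w)) by exact: (@intg_bnd _ _ _ _ _ B).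
have it (V : Omega -> R) : measurable_fun setT V -> intg P (fun w => tent ((2 * L)^-1 * V w + 0)).
  move=> mV; apply: (@intg_bnd _ _ _ _ _ 1); first exact: (measurableT_comp (measurable_tent _ _) mV).
  by move=> w; exact: tent_norm.
have i1 := intgB (intg_cst P 1) (it _ mX); have i2 := intgB (intg_cst P 1) (it _ mY).
have i3 := intgD (intg_cst P eps) (intgZ (4 * B) (intgD i1 i2)).
rewrite -(exB iPhi ig).
have <- : ex P (fun w => eps + 4 * B * ((1 - tent ((2 * L)^-1 * X w + 0)) + (1 - tent ((2 * L)^-1 * Y w + 0)))) =
    eps + 4 * B * ((1 - ex P (fun w => tent ((2 * L)^-1 * X w + 0))) + (1 - ex P (fun w => tent ((2 * L)^-1 * Y w + 0)))).
  rewrite (exD (intg_cst P eps) (intgZ (4 * B) (intgD i1 i2))) ex_cst (exZ _ (intgD i1 i2)) (exD i1 i2).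
  by rewrite (exB (intg_cst P 1) (it _ mX)) (exB (intg_cst P 1) (it _ mY)) !ex_cst.
apply: ex_norm_le => //; first exact: intgB.
move=> w; set x := X w; set y := Y w.
have far (v : R) : L < `|v| -> tent ((2 * L)^-1 * v + 0) <= 1 / 2.
  move=> vL; rewrite addr0 tentE ge_max; apply/andP; split; first by rewrite divr_ge0.
  rewrite normrM gtr0_norm ?invr_gt0 ?mulr_gt0//.
  suff : 1 / 2 <= (2 * L)^-1 * `|v| by lra.
  rewrite ler_pdivlMl ?mulr_gt0//; apply: le_trans (ltW vL).
  by rewrite le_eqVlt; apply/orP; left; apply/eqP; field.
have tx := tent_le1 ((2 * L)^-1 * x + 0); have ty := tent_le1 ((2 * L)^-1 * y + 0).
have big : 1 / 2 <= (1 - tent ((2 * L)^-1 * x + 0)) + (1 - tent ((2 * L)^-1 * y + 0)) ->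
    `|Phi (x, y) - g x y| <= eps + 4 * B * ((1 - tent ((2 * L)^-1 * x + 0)) + (1 - tent ((2 * L)^-1 * y + 0))).
  move=> h; apply: le_trans (ler_normB _ _) _.
  have h1 := PhiB (x, y); have h2 := gB x y.
  by move: h h1 h2; set u := (1 - _ + _); nra.
have [xL|/far xL] := leP `|x| L; last by apply: big; lra.
have [yL|/far yL] := leP `|y| L; last by apply: big; lra.
apply: le_trans (Pg _ _ xL yL) _; rewrite lerDl mulr_ge0 ?mulr_ge0//.
by lra.
Qed.

(** Since tent 0 = 1, the hypothesis contains the convergence of the tents of X N and the equality
    of those of Y and Y'. Tightness is thus checked on (Z, Y') and inherited by (X N, Y) for large
    N; on a large square Phi is replaced by a finite grid sum. *)
Lemma tent_joint_convergence d (Omega : measurableType d) (P : probability Omega R)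
    d' (Omega' : measurableType d') (P' : probability Omega' R)
    (X : nat -> Omega -> R) (Y : Omega -> R) (Z Y' : Omega' -> R) (Phi : R * R -> R) (B : R) :
  (forall N, measurable_fun setT (X N)) -> measurable_fun setT Y ->
  measurable_fun setT Z -> measurable_fun setT Y' ->
  (forall a b a' b', ex P (fun w => tent (a * X N w + b) * tent (a' * Y w + b')) @[N --> \oo] -->
     ex P' (fun w => tent (a * Z w + b) * tent (a' * Y' w + b'))) ->
  continuous Phi -> (forall z, `|Phi z| <= B) ->
  ex P (fun w => Phi (X N w, Y w)) @[N --> \oo] --> ex P' (fun w => Phi (Z w, Y' w)).
Proof.
move=> mX mY mZ mY' XYt cPhi PhiB.
have B0 : 0 <= B := le_trans (normr_ge0 _) (PhiB (0, 0)).
have tent0 (x : R) : tent (0 * x + 0) = 1 by rewrite mul0r addr0 tentE normr0 subr0 max_r.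
have ttr (O : Type) (U V : O -> R) a b :
    (fun w => tent (a * U w + b) * tent (0 * V w + 0)) = (fun w => tent (a * U w + b)).
  by apply/funext => w; rewrite tent0 mulr1.
have ttl (O : Type) (U V : O -> R) a b :
    (fun w => tent (0 * U w + 0) * tent (a * V w + b)) = (fun w => tent (a * V w + b)).
  by apply/funext => w; rewrite tent0 mul1r.
have Xt a b : ex P (fun w => tent (a * X N w + b)) @[N --> \oo] --> ex P' (fun w => tent (a * Z w + b)).
  by have := XYt a b 0 0; rewrite ttr; under eq_fun do rewrite ttr.
have Yt a b : ex P (fun w => tent (a * Y w + b)) = ex P' (fun w => tent (a * Y' w + b)).
  have := XYt 0 0 a b; rewrite ttl; under eq_fun do rewrite ttl.
  by move/cvg_lim => <- //; rewrite lim_cst.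
apply/cvgrPdist_le => eps eps0.
(* Budget: three errors eps / 8 and five terms 4 B k <= eps / 8 add up to eps; the added 1 covers B
   = 0. *)
pose k := eps / 8 / (4 * B + 1).
have k1 : 0 < 4 * B + 1 by rewrite ltr_pwDr// mulr_ge0.
have k0 : 0 < k by rewrite !divr_gt0.
have Bk : 4 * B * k <= eps / 8.
  have : k * (4 * B + 1) = eps / 8 by rewrite divfK// gt_eqF.
  by lra.
have [L [L0 LZ LY]] : exists L, [/\ 0 < L, 1 - ex P' (fun w => tent ((2 * L)^-1 * Z w + 0)) <= k &
    1 - ex P' (fun w => tent ((2 * L)^-1 * Y' w + 0)) <= k].
  have /cvgrPdist_le /(_ _ k0) nZ := ex_tent_to1 P' mZ.
  have /cvgrPdist_le /(_ _ k0) nY := ex_tent_to1 P' mY'.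
  have [n [hZ hY]] := filter_ex (filterI nZ nY).
  (* This choice gives (2 L)^-1 = 1 / (n + 1), the scale of [ex_tent_to1]. *)
  exists (n.+1%:R / 2); rewrite [2 * _]mulrC divfK//; split; first by rewrite divr_gt0.
  - exact: le_trans (ler_norm _) hZ.
  - exact: le_trans (ler_norm _) hY.
have e8 : 0 < eps / 8 by rewrite divr_gt0.
have [m [a [b [c [gE gB]]]]] := tent_grid_approx cPhi PhiB L0 e8.
set g := tent_grid m a b c in gE gB.
have mgrid d0 (O : measurableType d0) (U V : O -> R) : measurable_fun setT U ->
    measurable_fun setT V -> measurable_fun setT (fun w => g (U w) (V w)).
  move=> mU mV; apply: measurable_sum => i; apply: measurable_sum => j; apply: measurable_funM => //.
  by apply: measurable_funM; [exact: (measurableT_comp (measurable_tent _ _) mU)|exact: (measurableT_comp (measurable_tent _ _) mV)].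
have exgrid d0 (O : measurableType d0) (Q : probability O R) (U V : O -> R) :
    measurable_fun setT U -> measurable_fun setT V ->
    ex Q (fun w => g (U w) (V w)) =
    \sum_(i < m) \sum_(j < m) c i j * ex Q (fun w => tent (a * U w + b i) * tent (a * V w + b j)).
  move=> mU mV.
  have itt i j : intg Q (fun w => tent (a * U w + b i) * tent (a * V w + b j)).
    apply: (@intg_bnd _ _ _ _ _ 1).
      by apply: measurable_funM; [exact: (measurableT_comp (measurable_tent _ _) mU)|exact: (measurableT_comp (measurable_tent _ _) mV)].
    by move=> w; rewrite normrM -[leRHS]mulr1 ler_pM// tent_norm.
  rewrite /g /tent_grid ex_sum => [|i]; last by apply: intg_sum => j; exact: intgZ (itt i j).
  apply: eq_bigr => i _; rewrite ex_sum => [|j]; last exact: intgZ (itt i j).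
  by apply: eq_bigr => j _; rewrite (exZ _ (itt i j)).
have cvg_grid : ex P (fun w => g (X N w) (Y w)) @[N --> \oo] --> ex P' (fun w => g (Z w) (Y' w)).
  under eq_fun do rewrite exgrid//.
  rewrite exgrid//; apply: cvg_big => [|i _]; first exact: (@add_continuous R^o).
  apply: cvg_big => [|j _]; first exact: (@add_continuous R^o).
  by apply: cvgM; [exact: cvg_cst|exact: XYt].
have nG := (cvgrPdist_le _ _).1 cvg_grid _ e8.
have nX := (cvgrPdist_le _ _).1 (Xt (2 * L)^-1 0) _ k0.
near=> N.
have h1 : `|ex P' (fun w => g (Z w) (Y' w)) - ex P (fun w => g (X N w) (Y w))| <= eps / 8.
  by near: N; exact: nG.
have h2 : `|ex P' (fun w => tent ((2 * L)^-1 * Z w + 0)) - ex P (fun w => tent ((2 * L)^-1 * X N w + 0))| <= k.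
  by near: N; exact: nX.
have c1 := ex_tent_grid_close P (mX N) mY (mgrid _ _ _ _ (mX N) mY) cPhi PhiB gB L0 (ltW e8) gE.
have c2 := ex_tent_grid_close P' mZ mY' (mgrid _ _ _ _ mZ mY') cPhi PhiB gB L0 (ltW e8) gE.
rewrite Yt in c1.
move: h2; rewrite ler_norml => /andP[h2 h2'].
set A := ex P' _ in c2 *; set A' := ex P _ in c1 *.
have -> : A - A' = (A - ex P' (fun w => g (Z w) (Y' w))) +
   ((ex P' (fun w => g (Z w) (Y' w)) - ex P (fun w => g (X N w) (Y w)))
    - (A' - ex P (fun w => g (X N w) (Y w)))) by ring.
apply: le_trans (ler_normD _ _) _.
apply: (@le_trans _ _ (eps / 8 + 4 * B * (k + k) + (eps / 8 + (eps / 8 + 4 * B * (k + k + k))))); last first.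
  rewrite !mulrDr; lra.
apply: lerD.
  apply: le_trans c2 _; rewrite lerD2l ler_wpM2l ?mulr_ge0//; exact: lerD.
apply: le_trans (ler_normB _ _) _; apply: lerD => //.
apply: le_trans c1 _; rewrite lerD2l ler_wpM2l ?mulr_ge0//; apply: lerD => //; lra.
Unshelve. all: by end_near. Qed.

End JointConvergence.

Section Transfer.
Context d {Omega : measurableType d} {R : realType} (P : probability Omega R).

Lemma lipschitz_continuous (phi : R -> R) (L : R) :
  (forall x y, `|phi x - phi y| <= L * `|x - y|) -> continuous phi.
Proof.
move=> phiL x; apply/cvgrPdist_le => e e0.
have L1 : 0 < `|L| + 1 by rewrite ltr_wpDl.
have /cvgrPdist_le /(_ _ (divr_gt0 e0 L1)) idx : y @[y --> x] --> x by exact: cvg_id.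
near=> y.
apply: le_trans (phiL x y) _; apply: (@le_trans _ _ ((`|L| + 1) * (e / (`|L| + 1)))).
  apply: (@le_trans _ _ ((`|L| + 1) * `|x - y|)).
    by apply: ler_wpM2r => //; apply: le_trans (ler_norm L) _; rewrite lerDl.
  by rewrite ler_pM2l//; near: y; exact: idx.
by rewrite mulrC divfK// gt_eqF.
Unshelve. all: by end_near. Qed.

Lemma cvg_ex_close (f f' : nat -> Omega -> R) (U : Omega -> R) (l : R) :
  (forall N, sqint P (f N)) -> (forall N, sqint P (f' N)) ->
  measurable_fun setT U -> (forall w, `|U w| <= 1) ->
  (forall eps, 0 < eps -> \forall N \near \oo, ex P (fun w => (f N w - f' N w) ^+ 2) <= eps) ->
  ex P (fun w => f N w * U w) @[N --> \oo] --> l ->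
  ex P (fun w => f' N w * U w) @[N --> \oo] --> l.
Proof.
move=> sf sf' mU U1 ff' fl; apply/cvgrPdist_le => eps eps0.
have e2 : 0 < eps / 2 by rewrite divr_gt0.
have nl := (cvgrPdist_le _ _).1 fl _ e2.
have nf := ff' _ (exprn_gt0 2 e2).
have sU := sqint_bnd P mU U1.
near=> N.
have h1 : `|l - ex P (fun w => f N w * U w)| <= eps / 2 by near: N; exact: nl.
have h2 : ex P (fun w => (f N w - f' N w) ^+ 2) <= (eps / 2) ^+ 2 by near: N; exact: nf.
have h3 := ex_mul_bnd (sqintB (sf N) (sf' N)) mU U1 (ltW e2) h2.
have -> : l - ex P (fun w => f' N w * U w) = (l - ex P (fun w => f N w * U w)) +
    ex P (fun w => (f N w - f' N w) * U w).
  have -> : (fun w => (f N w - f' N w) * U w) = (fun w => f N w * U w - f' N w * U w).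
    by apply/funext => w; rewrite mulrBl.
  by rewrite (exB (sqintM (sf N) sU) (sqintM (sf' N) sU)); ring.
by apply: le_trans (ler_normD _ _) _; lra.
Unshelve. all: by end_near. Qed.

Lemma cvg_ex_lipschitz_close (X V : nat -> Omega -> R) (phi : R -> R) (L B l : R) :
  (forall N, sqint P (X N)) -> (forall N, sqint P (V N)) ->
  (forall eps, 0 < eps -> \forall N \near \oo, ex P (fun w => (X N w - V N w) ^+ 2) <= eps) ->
  (forall x y, `|phi x - phi y| <= L * `|x - y|) -> (forall x, `|phi x| <= B) ->
  ex P (fun w => phi (X N w)) @[N --> \oo] --> l ->
  ex P (fun w => phi (V N w)) @[N --> \oo] --> l.
Proof.
move=> sX sV XV phiL phiB.
have mphi := continuous_measurable_fun (lipschitz_continuous phiL).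
have sphi (Q : Omega -> R) : sqint P Q -> sqint P (fun w => phi (Q w)).
  by move=> sQ; apply: (@sqint_bnd _ _ _ _ _ B) => //; exact: measurableT_comp mphi sQ.1.
have mul1 (Q : nat -> Omega -> R) : (fun N => ex P (fun w => phi (Q N w))) =
    (fun N => ex P (fun w => phi (Q N w) * 1)).
  by apply/funext => N; congr ex; apply/funext => w; rewrite mulr1.
rewrite !mul1; apply: cvg_ex_close => [N|N||w|eps eps0].
- exact: sphi.
- exact: sphi.
- exact: measurable_cst.
- by rewrite normr1.
have L1 : 0 < L ^+ 2 + 1 by rewrite ltr_wpDl ?sqr_ge0.
apply: filterS (XV _ (divr_gt0 eps0 L1)) => N XVN.
have sD := sqintB (sX N) (sV N).
apply: (@le_trans _ _ ((L ^+ 2 + 1) * (eps / (L ^+ 2 + 1)))); last first.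
  by rewrite mulrC divfK// gt_eqF.
apply: (@le_trans _ _ ((L ^+ 2 + 1) * ex P (fun w => (X N w - V N w) ^+ 2))); last first.
  by rewrite ler_pM2l.
rewrite -(exZ _ sD.2); apply: ex_le; [exact: (sqintB (sphi _ (sX N)) (sphi _ (sV N))).2|exact: intgZ sD.2|].
move=> w; apply: (@le_trans _ _ ((L * `|X N w - V N w|) ^+ 2)).
  rewrite -[leLHS]real_normK ?num_real// lerXn2r ?nnegrE//.
  exact: le_trans (normr_ge0 (phi (X N w) - phi (V N w))) _.
by rewrite exprMn real_normK ?num_real// ler_wpM2r ?sqr_ge0// lerDl.
Qed.

End Transfer.

Section Chaos.
Context {R : realType} {H : hilbertType R} (T : forall n, tensor_power H n).
Context d {Omega : measurableType d} (P : probability Omega R).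
Variables (W : H -> {RV P >-> R}) (I : forall n, T n -> {RV P >-> R}).
Hypothesis isoW : isonormal W.
Hypothesis mintI : is_multiple_integral W I.

Lemma mint_chaos_approx n (f : T n) (eps : R) : (0 < n)%N -> sym_power f -> 0 < eps ->
  exists2 s, unit_comb s & ex P (fun w => (I f w - chaos_var W n s w) ^+ 2) <= eps.
Proof.
move=> n0 sf eps0.
have nf : 0 < n`!%:R :> R by rewrite ltr0n fact_gt0.
have r0 : 0 < Num.sqrt (eps / n`!%:R) by rewrite sqrtr_gt0 divr_gt0.
have [s us fs] := sym_power_approx n0 sf r0; exists s => //.
have -> : ex P (fun w => (I f w - chaos_var W n s w) ^+ 2) =
    ex P (fun w => (I f w - I (tpow_comb (T n) s) w) ^+ 2).
  apply: ex_ae.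
  - by apply/measurable_funX/measurable_funB => //; exact: (allmom_chaos_var isoW n s).1.
  - exact/measurable_funX/measurable_funB.
  - by apply: filterS (mint_tpow_comb mintI n us) => w ->.
rewrite (ex_mint_dist mintI)//; last exact: sym_tpow_comb.
have -> : eps = n`!%:R * Num.sqrt (eps / n`!%:R) ^+ 2.
  by rewrite sqr_sqrtr ?divr_ge0 ?ltW// mulrC divfK// gt_eqF.
by rewrite ler_pM2l// lerXn2r ?nnegrE ?(ltW r0)// ltW.
Qed.

Variables (p : nat) (f : nat -> T p.+2) (sigma : R).
Hypothesis symf : forall N, sym_power (f N).
Hypothesis sigma0 : sigma != 0.
Hypothesis If_lip : forall (phi : R -> R) (L B : R),
  (forall x y, `|phi x - phi y| <= L * `|x - y|) -> (forall x, `|phi x| <= B) ->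
  ex P (fun w => phi (I (f N) w)) @[N --> \oo] --> ex (normal_prob 0 sigma) phi.

(** The moment inequalities concern finite Hermite sums [V N], taken within squared L^2 distance 1 /
    (N + 1) of I (f N). Convergence in law passes to [V N] through Lipschitz functions, mixing is
    proved there, and the result returns to I (f N) because tents are Lipschitz. *)
Lemma mint_tent_mixing a b (U : Omega -> R) : measurable_fun setT U ->
  (forall w, `|U w| <= 1) ->
  ex P (fun w => tent (a * I (f N) w + b) * U w) @[N --> \oo] -->
    ex (normal_prob 0 sigma) (fun x => tent (a * x + b)) * ex P U.
Proof.
move=> mU U1.
have sE N : exists s, unit_comb s /\
    ex P (fun w => (I (f N) w - chaos_var W p.+2 s w) ^+ 2) <= N.+1%:R^-1.
  have N0 : 0 < N.+1%:R^-1 :> R by rewrite invr_gt0 ltr0n.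
  by have [s us fs] := mint_chaos_approx (ltn0Sn p.+1) (symf N) N0; exists s.
have [s sP] := choice sE.
pose V N := chaos_var W p.+2 (s N).
have momV N : allmom P (V N) := allmom_chaos_var isoW p.+2 (s N).
have sV N : sqint P (V N) by exact: allmom_sqint.
have sI N : sqint P (I (f N)) := sqint_mint mintI (symf N).
have IV eps : 0 < eps -> \forall N \near \oo, ex P (fun w => (I (f N) w - V N w) ^+ 2) <= eps.
  move=> eps0; near=> N; apply: le_trans (sP N).2 _.
  by apply: ltW; near: N; exact: (near_infty_natSinv_lt (PosNum eps0)).
have V_lip (phi : R -> R) (L B : R) :
  (forall x y, `|phi x - phi y| <= L * `|x - y|) -> (forall x, `|phi x| <= B) ->
  ex P (fun w => phi (V N w)) @[N --> \oo] --> ex (normal_prob 0 sigma) phi.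
  move=> phiL phiB; apply: (cvg_ex_lipschitz_close sI sV IV phiL phiB).
  exact: If_lip phiL phiB.
have V8 N : ex P (fun w => V N w ^+ 8) <= 7 ^+ (4 * p.+2) * ex P (fun w => V N w ^+ 2) ^+ 4.
  exact: chaos_var_moment8 (sP N).1.
have orthV h : `|h| = 1 -> forall eps : R, 0 < eps -> \forall N \near \oo,
    exists s' : seq (R * H), (forall x, x \in s' -> inner x.2 h = 0) /\
     ex P (fun w => (chaos_var W p.+2 (s N) w - chaos_var W p.+2 s' w) ^+ 2) <= eps.
  move=> h1 eps eps0.
  have p1 : 0 < 6 * p.+1%:R :> R by rewrite mulr_gt0// ltr0n.
  have p2 : 0 < p.+2%:R :> R by rewrite ltr0n.
  have d0 : 0 < 6 * p.+1%:R * eps ^+ 2 / p.+2%:R.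
    by rewrite divr_gt0// mulr_gt0// exprn_gt0.
  have C0 : 0 <= 7 ^+ (4 * p.+2) :> R by exact: exprn_ge0.
  apply: filterS (fourth_cumulant_limit sigma0 C0 momV V8 V_lip d0) => N VN.
  have [s' [s'h s'E]] := chaos_var_orth isoW mintI p (sP N).1 h1; exists s'; split=> //.
  set e := ex P _ in s'E *.
  have e0 : 0 <= e by apply: ex_ge0 => w; exact: sqr_ge0.
  rewrite -(@ler_pXn2r _ 2) ?nnegrE ?(ltW eps0)// -(ler_pM2l p1).
  apply: le_trans s'E _; rewrite mulrC -ler_pdivlMr//.
have mixV : ex P (fun w => tent (a * V N w + b) * U w) @[N --> \oo] -->
    ex (normal_prob 0 sigma) (fun x => tent (a * x + b)) * ex P U.
  have tlip x y : `|tent (a * x + b) - tent (a * y + b)| <= 2 * `|a| * `|x - y|.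
    apply: le_trans (tent_lip _ _) _; rewrite -mulrA -normrM.
    by have -> : a * x + b - (a * y + b) = a * (x - y) by ring.
  have Vt := V_lip _ _ _ tlip (fun x => tent_norm (a * x + b)).
  have c0 : cov P (fun w => tent (a * V N w + b)) U @[N --> \oo] --> 0.
    apply/cvgrPdist_le => eps eps0.
    apply: filterS (cov_sqint isoW orthV a b (sqint_bnd P mU U1) eps0) => N.
    by rewrite sub0r normrN.
  have -> : (fun N => ex P (fun w => tent (a * V N w + b) * U w)) =
     (fun N => cov P (fun w => tent (a * V N w + b)) U + ex P (fun w => tent (a * V N w + b)) * ex P U).
    by apply/funext => N; rewrite /cov subrK.
  rewrite -[X in _ --> X]add0r; apply: (@cvgD _ R^o) => //.
  by apply: cvgM => //; exact: cvg_cst.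
apply: (cvg_ex_close _ _ mU U1 _ mixV) => [N|N|eps eps0].
- exact/sqint_tent/(sV N).1.
- exact/sqint_tent/(sI N).1.
have a1 : 0 < (2 * a) ^+ 2 + 1 by rewrite ltr_wpDl ?sqr_ge0.
apply: filterS (IV _ (divr_gt0 eps0 a1)) => N IVN.
apply: le_trans (tent_close a b (sV N) (sI N)) _.
have -> : (fun w => (V N w - I (f N) w) ^+ 2) = (fun w => (I (f N) w - V N w) ^+ 2).
  by apply/funext => w; rewrite -sqrrN opprB.
apply: (@le_trans _ _ (((2 * a) ^+ 2 + 1) * (eps / ((2 * a) ^+ 2 + 1)))); last first.
  by rewrite mulrC divfK// gt_eqF.
apply: ler_pM => //; rewrite ?sqr_ge0 ?lerDl//.
by apply: ex_ge0 => w; exact: sqr_ge0.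
Unshelve. all: by end_near. Qed.

End Chaos.

Theorem theorem1 (R : realType)
    (H : hilbertType R) (sepH : separable H)
    (T : forall n : nat, tensor_power H n)
    (d : measure_display) (Omega : measurableType d) (P : probability Omega R)
    (W : H -> {RV P >-> R}) (isoW : isonormal W)
    (I : forall n : nat, T n -> {RV P >-> R}) (mintI : is_multiple_integral W I)
    (p : nat) (p_ge2 : (2 <= p)%N)
    (f : nat -> T p) (symf : forall N, sym_power (f N))
    (sigma : R) (sigma2_gt0 : 0 < sigma ^+ 2)
    (cvgX : cvg_in_distribution P (fun N => I p (f N) : Omega -> R)
              (normal_prob 0 sigma) (fun z : R => z))
    (Y : {RV P >-> R}) (Y_L2 : (Y : Omega -> R) \in Lfun P 2%:E)
    (d' : measure_display) (Omega' : measurableType d')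
    (P' : probability Omega' R) (Z Y' : {RV P' >-> R})
    (lawZ : has_law Z (normal_prob 0 sigma))
    (lawY' : has_law Y' (distribution P Y))
    (indep : independent_RV Z Y') :
  cvg_in_distribution P (fun N w => (I p (f N) w, Y w))
    P' (fun w => (Z w, Y' w)).
Proof.
have sigma0 : sigma != 0 by move: sigma2_gt0; apply: contraTneq => ->; rewrite expr0n ltxx.
case: p p_ge2 f symf cvgX => [|[|p]]// _ f symf cvgX.
have If_lip (phi : R -> R) (L B : R) :
    (forall x y, `|phi x - phi y| <= L * `|x - y|) -> (forall x, `|phi x| <= B) ->
    ex P (fun w => phi (I p.+2 (f N) w)) @[N --> \oo] --> ex (normal_prob 0 sigma) phi.
  move=> phiL phiB; have cphi := lipschitz_continuous phiL.
  have mphi := continuous_measurable_fun cphi.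
  have bphi : bounded_fun phi.
    by exists B; split; [exact: num_real|move=> M BM x _; exact: le_trans (phiB x) (ltW BM)].
  have h := cvgX phi cphi bphi.
  have eG : ('E_(normal_prob 0 sigma)[phi \o (fun z : R => z)] = (ex (normal_prob 0 sigma) phi)%:E)%E.
    by apply: (@exE _ _ _ (normal_prob 0 sigma) phi); exact: (@intg_bnd _ _ _ _ _ B).
  have eI N : ('E_P[phi \o I p.+2 (f N)] = (ex P (fun w => phi (I p.+2 (f N) w)))%:E)%E.
    by apply: exE; apply: (@intg_bnd _ _ _ _ _ B) => [|w]; [exact: measurableT_comp|exact: phiB].
  by move: h; rewrite eG => /fine_cvg; under eq_fun do rewrite /= eI.
move=> Phi cPhi [M [_ PhiM]].
have PhiB z : `|Phi z| <= M + 1 by apply: PhiM => //; rewrite ltrDl.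
have mI N : measurable_fun setT (I p.+2 (f N)) by exact: measurable_funP.
have key : ex P (fun w => Phi (I p.+2 (f N) w, Y w)) @[N --> \oo] --> ex P' (fun w => Phi (Z w, Y' w)).
  (* A tent of Y is the bounded variable U of [mint_tent_mixing]; on the limit side independence and
     the two laws produce the same product. *)
  apply: (tent_joint_convergence (B := M + 1)) => // a b a' b'.
  have t01 (u v x : R) : 0 <= tent (u * x + v) <= 1 by rewrite tent_ge0 tent_le1.
  rewrite (independent_ex indep (measurable_tent a b) (measurable_tent a' b') (t01 a b) (t01 a' b')).
  rewrite (equal_law_ex lawY' (measurable_tent a' b')); last by move=> x; exact: tent_ge0.
  have iG : (normal_prob 0 sigma).-integrable setT (EFin \o (fun x => tent (a * x + b))).
    by apply: (@intg_bnd _ _ _ _ _ 1); [exact: measurable_tent|move=> x; exact: tent_norm].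
  rewrite (has_law_ex lawZ (measurable_tent a b) iG).2.
  apply: (mint_tent_mixing isoW mintI symf sigma0 If_lip) => [|w]; last exact: tent_norm.
  exact: (measurableT_comp (measurable_tent a' b')).
have iPhi d0 (O : measurableType d0) (Q : probability O R) (U V : O -> R) :
    measurable_fun setT U -> measurable_fun setT V -> intg Q (fun w => Phi (U w, V w)).
  move=> mU mV; apply: (@intg_bnd _ _ _ _ _ (M + 1)) => [|w]; last exact: PhiB.
  exact: measurable_continuous_pair mU mV cPhi PhiB.
have eZ : ('E_P'[Phi \o (fun w => (Z w, Y' w))] = (ex P' (fun w => Phi (Z w, Y' w)))%:E)%E.
  by apply: exE; exact: iPhi.
have eI N : ('E_P[Phi \o (fun w => (I p.+2 (f N) w, Y w))] =
    (ex P (fun w => Phi (I p.+2 (f N) w, Y w)))%:E)%E.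
  by apply: exE; exact: iPhi.
rewrite eZ; under eq_fun do rewrite eI.
by apply: cvg_EFin => //; exact: nearW.
Qed.
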